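(* For every constant $p\in(0,1)$, the sequence $\mathsf{P}\bigl(\exists k,\ell,m\ \ X(k,\ell,m)>0\bigr)$, where $X(k,\ell,m)$ is computed on the random graph $G(n,p)$, does not converge as $n\to\infty$.
   Context: $G(n,p)$ denotes the binomial random graph on vertex set $[n]=\{1,\dots,n\}$ in which each pair of distinct vertices is joined by an edge with probability $p$, independently of all other pairs. For positive integers $k,\ell,m$, $X(k,\ell,m)$ is the number of 6-tuples $(X_1,x_1,X_2,x_2,X_3,x_3)$ with $X_1,X_2,X_3\subset[n]$ and $x_1\in X_1$, $x_2\in X_2$, $x_3\in X_3$ such that: (i) $|X_1|=k$, $|X_2|=\ell$, $|X_3|=m$ and the sets $X_1,X_2,X_3$ are pairwise disjoint; (ii) every vertex of $[n]\setminus(X_1\sqcup X_2\sqcup X_3)$ has at least one neighbor in each of $X_1$, $X_2$, $X_3$; (iii) for any distinct $i,j\in\{1,2,3\}$ there is exactly one edge between $X_i$ and $X_j$, namely the edge $x_ix_j$. *)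

(* Defs.v *)
From HB Require Import structures.
From mathcomp Require Import all_boot all_order all_algebra.
From mathcomp Require Import all_classical all_reals all_analysis.
Set Implicit Arguments.
Unset Strict Implicit.
Unset Printing Implicit Defensive.
Import Order.TTheory GRing.Theory Num.Theory.
Import numFieldNormedType.Exports.
Local Open Scope classical_set_scope.
Local Open Scope ring_scope.

(* A simple graph on the vertex set 'I_n is its set of edges, an edge being a
   two-element set of vertices. *)
Record sgraph (n : nat) := SGraph {
  edges : {set {set 'I_n}};
  edges_card2 : [forall e in edges, #|e| == 2]
}.

HB.instance Definition _ (n : nat) := [isSub for @edges n].
HB.instance Definition _ (n : nat) := [Finite of sgraph n by <:].

Definition adj n (G : sgraph n) (u v : 'I_n) : bool :=
  [set u; v]%SET \in edges G.

Definition edges_between n (G : sgraph n) (A B : {set 'I_n}) :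
    {set {set 'I_n}} :=
  [set e in edges G | [exists u in A, exists v in B, e == [set u; v]%SET]]%SET.

Definition gnp_pmf (R : realType) (n : nat) (p : R) (G : sgraph n) : R :=
  \prod_(e : {set 'I_n} | #|e| == 2) bernoulli_pmf p (e \in edges G).

Definition gnp_prob (R : realType) (n : nat) (p : R) (A : set (sgraph n)) : R :=
  \sum_(G : sgraph n | G \in A) gnp_pmf p G.

Lemma gnp_prob_setT (R : realType) (n : nat) (p : R) :
  gnp_prob p [set: sgraph n] = 1.
Proof.
pose P2 := [set e : {set 'I_n} | #|e| == 2]%SET.
have sum1 : \prod_(e in P2) \sum_(b : bool) bernoulli_pmf p b = 1.
  by rewrite big1// => e _; rewrite big_bool/= addrCA subrr addr0.
rewrite -sum1 (big_distr_big_dep false).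
have E0 : [forall e in (finset.set0 : {set {set 'I_n}}), #|e| == 2].
  by apply/forall_inP => e; rewrite finset.in_set0.
pose h (f : {ffun {set 'I_n} -> bool}) : sgraph n :=
  insubd (SGraph E0) [set e in P2 | f e]%SET.
have hE f : edges (h f) = [set e in P2 | f e]%SET.
  by rewrite insubdK//; apply/forall_inP => e; rewrite !inE => /andP[].
rewrite /gnp_prob.
rewrite [RHS](reindex_onto (fun G : sgraph n => [ffun e => e \in edges G]) h)
    /=; last first.
  move=> f /pfamilyP[/fintype.subsetP fs _].
  apply/ffunP => e; rewrite ffunE hE inE.
  case: (boolP (f e)) => [fe|]; last by rewrite andbF.
  by rewrite andbT; apply: fs; rewrite unfold_in /= fe.
apply: eq_big => [G|G _].
  rewrite in_setT; apply/esym/andP; split.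
    apply/pfamilyP; split => //; apply/fintype.subsetP => e.
    rewrite unfold_in ffunE inE.
    case: (boolP (e \in edges G)) => // eG _.
    exact: (forall_inP (edges_card2 G)).
  apply/eqP/val_inj; rewrite /= hE; apply/setP => e; rewrite !inE ffunE.
  case: (boolP (e \in edges G)) => [eG|]; last by rewrite andbF.
  by rewrite (forall_inP (edges_card2 G)).
rewrite /gnp_pmf; apply: eq_big => [e|e _]; first by rewrite inE.
by rewrite ffunE.
Qed.

(* The one-edge condition between X_i and X_j is symmetric in i and j, so the
   three unordered pairs suffice. *)
Definition admissible n (G : sgraph n) (k l m : nat)
    (X1 : {set 'I_n}) (x1 : 'I_n) (X2 : {set 'I_n}) (x2 : 'I_n)
    (X3 : {set 'I_n}) (x3 : 'I_n) : bool :=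
  [&& [&& x1 \in X1, x2 \in X2 & x3 \in X3],
      [&& #|X1| == k, #|X2| == l & #|X3| == m],
      [&& [disjoint X1 & X2], [disjoint X1 & X3] & [disjoint X2 & X3]],
      [forall v in ~: (X1 :|: X2 :|: X3),
         [&& [exists u in X1, adj G v u],
             [exists u in X2, adj G v u] &
             [exists u in X3, adj G v u]]] &
      [&& edges_between G X1 X2 == [set [set x1; x2]]%SET,
          edges_between G X1 X3 == [set [set x1; x3]]%SET &
          edges_between G X2 X3 == [set [set x2; x3]]%SET]].

Definition X_count n (G : sgraph n) (k l m : nat) : nat :=
  #|[set t : {set 'I_n} * 'I_n * {set 'I_n} * 'I_n * {set 'I_n} * 'I_n |
      let: (X1, x1, X2, x2, X3, x3) := t in
      admissible G k l m X1 x1 X2 x2 X3 x3]%SET|.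

(* Main.v *)
(* Write q = 1 - p. For sets of sizes k, l, m the expected number of tuples is
   about k l m times a product of Poisson weights: with the pair exponents
   distributed cyclically, q^(kl + lm + mk) n^(k + l + m) / (k! l! m!) times the
   domination probability exp(- n (q^k + q^l + q^m)) equals
     Pois(l; n q^k) Pois(m; n q^l) Pois(k; n q^m),
   where Pois(j; y) = y^j e^(-y) / j!.  Each factor is at most 1, and it is
   exponentially small unless y is close to j.  Hence tuples can exist only if
   n q^j is close to j for some j (and then k = l = m = j).

   - For n ~ k q^(-k-1/2) no such j exists, and the union bound tends to 0;
     sizes far from log n are handled by cruder bounds.
   - For n ~ k q^(-k) and k = l = m, the expected number is bounded below, thanks
     to the factor k^3 for the choice of the three roots.  Its second moment is
     at most a constant times mean + mean^2: if r_ia is the number of common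
     vertices of the i-th class of one tuple and the a-th class of another, the
     classes share S pairs, and k * sum r - S is at least a constant times k
     times either sum r or the distance of r to k times a permutation matrix.
     In the first case the two tuples behave independently, in the second one
     the second tuple is a small perturbation of the first.  So the probability
     stays bounded away from 0 along this sequence. *)
Require Import Defs.
From HB Require Import structures.
From mathcomp Require Import all_boot all_order all_algebra all_fingroup.
From mathcomp Require Import all_classical all_reals all_analysis.
From mathcomp Require Import zify ring lra.
Set Implicit Arguments.
Unset Strict Implicit.
Unset Printing Implicit Defensive.
Import Order.TTheory GRing.Theory Num.Theory.
Import numFieldNormedType.Exports.
Local Open Scope ring_scope.
Local Open Scope set_scope.

(** * Independent random bits *)

(** Linking prescribes the bits of the pairs between classes, while domination only uses pairs at
    uncolored vertices; hence the two are independent and single probabilities are exact products.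
    The difficulty is the second moment. At a vertex uncolored by both tuples six sets have to be
    hit, and two of them with r common vertices are both missed with probability q^(2k - r). Over n
    vertices this adds about k q^(k - r), negligible for r up to k / 2 and at most 2 r beyond, so it
    costs a factor exp(2 sum r), which the saving in crossing pairs beats. For nearly coinciding
    tuples the weight to reach is that of one tuple rather than its square, and domination by the
    first tuple alone is kept. The saving is linear with constant 1 / 36, the source of w =
    q^(1/36). Its size is immaterial: only exponential decay in k matters, as there are at most (k +
    1)^9 overlap matrices. In the first moment a large set cannot be handled by counting alone; its
    choice is summed away by the binomial theorem. *)

Section BitProbability.
Variables (R : realFieldType) (p : R) (E : finType).
Hypothesis p01 : 0 <= p <= 1.
Implicit Types (f g : {ffun E -> bool}) (S : {set E}).
Implicit Types (A B : pred {ffun E -> bool}).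

Definition bit_weight (b : bool) : R := if b then p else 1 - p.
Definition weight f : R := \prod_e bit_weight (f e).
Definition Pr A : R := \sum_(f | A f) weight f.

Lemma bit_weight_ge0 b : 0 <= bit_weight b.
Proof. by case/andP: p01 => ? ?; case: b => /=; lra. Qed.

Lemma bit_weight_sum : \sum_(b : bool) bit_weight b = 1.
Proof. by rewrite big_bool /=; lra. Qed.

Lemma weight_ge0 f : 0 <= weight f.
Proof. by apply: prodr_ge0 => e _; apply: bit_weight_ge0. Qed.

Lemma Pr_ge0 A : 0 <= Pr A.
Proof. by apply: sumr_ge0 => f _; apply: weight_ge0. Qed.

Lemma PrE A : Pr A = \sum_f weight f * (A f)%:R.
Proof.
rewrite /Pr big_mkcond; apply: eq_bigr => f _.
by case: (A f); rewrite ?mulr1 ?mulr0.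
Qed.

Lemma eq_Pr A B : A =1 B -> Pr A = Pr B.
Proof. by move=> AB; apply: eq_bigl. Qed.

(** The sum over all bit vectors factors over coordinates; those outside [S] contribute p + (1 - p)
    = 1. *)
Lemma Pr_cylinder S (g : E -> bool) :
  Pr (fun f => [forall e in S, f e == g e]) = \prod_(e in S) bit_weight (g e).
Proof.
pose F e := if e \in S then pred1 (g e) else predT.
transitivity (\prod_e \sum_(b | F e b) bit_weight b).
  rewrite bigA_distr_big_dep /Pr; apply: eq_bigl => f.
  apply/forallP/familyP => h e; move: (h e); rewrite /F.
    by case: (e \in S).
  by case: (e \in S).
rewrite [RHS]big_mkcond /=; apply: eq_bigr => e _; rewrite /F.
case: (e \in S); first by rewrite big_pred1_eq.
exact: bit_weight_sum.
Qed.

Lemma Pr_true : Pr xpredT = 1.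
Proof.
have := Pr_cylinder finset.set0 xpredT; rewrite big_set0 => <-.
by apply: eq_Pr => f; apply/esym/forallP => e; rewrite inE.
Qed.

Lemma Pr_le A B : (forall f, A f -> B f) -> Pr A <= Pr B.
Proof.
move=> AB; rewrite !PrE; apply: ler_sum => f _.
apply: ler_wpM2l; first exact: weight_ge0.
by case: (A f) (AB f) => [->//|_]; rewrite ler_nat.
Qed.

Lemma Pr_union (T : finType) (P : pred T) (A : T -> pred {ffun E -> bool}) :
  Pr (fun f => [exists t, P t && A t f]) <= \sum_(t | P t) Pr (A t).
Proof.
rewrite PrE; under [leRHS]eq_bigr do rewrite PrE.
rewrite [leRHS]exchange_big; apply: ler_sum => f _ /=.
rewrite -mulr_sumr; apply: ler_wpM2l; first exact: weight_ge0.
case: existsP => [[t /andP[Pt At]]|_]; last by apply: sumr_ge0.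
by rewrite (bigD1 t) //= At lerDl; apply: sumr_ge0.
Qed.

Definition depends S A := forall f g, {in S, f =1 g} -> A f = A g.

Lemma dependsS S S' A : S \subset S' -> depends S A -> depends S' A.
Proof. by move=> /fintype.subsetP sS dA f g fg; apply: dA => e /sS; apply: fg. Qed.

Lemma depends_forall (T : finType) (P : pred T) (A : T -> pred {ffun E -> bool}) S :
  (forall t, P t -> depends S (A t)) -> depends S (fun f => [forall (t | P t), A t f]).
Proof.
move=> dA f g fg; apply: eq_forallb => t.
by case: (boolP (P t)) => //= Pt; rewrite (dA t Pt f g fg).
Qed.

(** Swapping argument on two independent samples [f] and [g]: exchanging their bits outside [S]
    preserves the joint weight and moves both events onto [f], leaving [g] unconstrained. *)
Lemma Pr_indep S S' A B : depends S A -> depends S' B -> [disjoint S & S'] ->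
  Pr (fun f => A f && B f) = Pr A * Pr B.
Proof.
move=> dA dB dS.
pose mix f g : {ffun E -> bool} := [ffun e => if e \in S then f e else g e].
pose sw (u : {ffun E -> bool} * {ffun E -> bool}) := (mix u.1 u.2, mix u.2 u.1).
have swK : involutive sw.
  case=> f g; rewrite /sw /=; congr pair; apply/ffunP => e; rewrite !ffunE; by case: (e \in S).
rewrite {2 3}/Pr big_distrlr /= pair_big /=.
rewrite (reindex_inj (inv_inj swK)) /=.
transitivity (Pr (fun f => A f && B f) * Pr xpredT); first by rewrite Pr_true mulr1.
rewrite /Pr big_distrlr /= pair_big /=; apply: eq_big => [[f g]|[f g] _] /=.
  rewrite andbT; congr (_ && _).
    by apply: dA => e eS; rewrite ffunE eS.
  apply: dB => e eS; rewrite ffunE; case: ifP => // eS'.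
  by have := disjointFr dS eS'; rewrite eS.
rewrite /weight -!big_split /=; apply: eq_bigr => e _; rewrite !ffunE.
by case: ifP => // _; rewrite mulrC.
Qed.

Lemma Pr_indep_big (T : finType) (P : pred T) (S : T -> {set E})
    (A : T -> pred {ffun E -> bool}) :
  (forall t, P t -> depends (S t) (A t)) ->
  (forall s t, P s -> P t -> s != t -> [disjoint S s & S t]) ->
  Pr (fun f => [forall (t | P t), A t f]) = \prod_(t | P t) Pr (A t).
Proof.
move=> dA dS.
suff H (r : seq T) : uniq r -> all P r ->
    Pr (fun f => all (fun t => A t f) r) = \prod_(t <- r) Pr (A t).
  rewrite -big_filter -H; first last.
  - exact: filter_all.
  - by rewrite filter_uniq // index_enum_uniq.
  apply: eq_Pr => f; apply/forallP/allP => [h t|h t].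
    by rewrite mem_filter => /andP[Pt _]; move: (h t); rewrite Pt.
  by apply/implyP => Pt; apply: h; rewrite mem_filter Pt mem_index_enum.
elim: r => [|t r IH]; first by rewrite big_nil Pr_true.
move=> /=/andP[tr ur] /andP[Pt Pr']; rewrite big_cons -(IH ur Pr').
apply: (@Pr_indep (S t) (\bigcup_(s in r) S s)).
- exact: dA.
- move=> f g fg; apply: eq_in_all => s sr; apply: (dA _ (allP Pr' s sr)) => e es.
  by apply: fg; apply/bigcupP; exists s.
- apply/bigcup_disjointP => s sr; apply: dS => //.
    exact: (allP Pr').
  by apply: contraNneq tr => ->.
Qed.

Lemma Pr_none S : Pr (fun f => [forall e in S, ~~ f e]) = (1 - p) ^+ #|S|.
Proof.
rewrite -prodr_const -(Pr_cylinder S xpred0).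
by apply: eq_Pr => f; apply: eq_forallb => e; case: (f e).
Qed.

Lemma PrC A : Pr (fun f => ~~ A f) = 1 - Pr A.
Proof.
apply/eqP; rewrite eq_sym subr_eq -Pr_true !PrE -big_split /=; apply/eqP.
by apply: eq_bigr => f _; case: (A f) => /=; rewrite !(mulr0, mulr1, add0r, addr0).
Qed.

Lemma Pr_some S : Pr (fun f => [exists e in S, f e]) = 1 - (1 - p) ^+ #|S|.
Proof.
rewrite -Pr_none -PrC; apply: eq_Pr => f.
rewrite negb_forall; apply: eq_existsb => e.
by rewrite negb_imply negbK.
Qed.

Lemma depends_some S : depends S (fun f => [exists e in S, f e]).
Proof.
move=> f g fg; apply: eq_existsb => e.
by case: (boolP (e \in S)) => //= eS; rewrite fg.
Qed.

Lemma depends_cylinder S (g : E -> bool) :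
  depends S (fun f => [forall e in S, f e == g e]).
Proof.
move=> f h fh; apply: eq_forallb => e.
by case: (boolP (e \in S)) => //= eS; rewrite fh.
Qed.

(* Pointwise, with N the number of missed sets, [N = 0] is bounded by
   1 - N + N (N - 1) / 2. *)
Lemma Pr_hit_all (T : finType) (Z : T -> {set E}) :
  Pr (fun f => [forall t, [exists e in Z t, f e]]) <=
  1 - \sum_t (1 - p) ^+ #|Z t|
    + 2^-1 * \sum_s \sum_(t | t != s) (1 - p) ^+ #|Z s :|: Z t|.
Proof.
pose F t (f : {ffun E -> bool}) : bool := [forall e in Z t, ~~ f e].
have FE t : (1 - p) ^+ #|Z t| = \sum_f weight f * (F t f)%:R.
  by rewrite -Pr_none PrE.
have FFE s t : (1 - p) ^+ #|Z s :|: Z t| =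
    \sum_f weight f * ((F s f)%:R * (F t f)%:R).
  rewrite -Pr_none PrE; apply: eq_bigr => f _; rewrite -natrM mulnb.
  congr (_ * (nat_of_bool _)%:R); apply/forallP/andP => [h|[/forallP h1 /forallP h2] e].
    by split; apply/forallP => e; apply/implyP => eZ; move: (h e); rewrite inE eZ ?orbT.
  by rewrite inE; apply/implyP => /orP[] eZ; [move: (h1 e)|move: (h2 e)]; rewrite eZ.
under eq_bigr do rewrite FE.
under [X in _ + _ * X]eq_bigr do under eq_bigr do rewrite FFE.
rewrite exchange_big /=.
under [X in _ + _ * X]eq_bigr do rewrite exchange_big /=.
rewrite [X in _ + _ * X]exchange_big /=.
have W1 : 1 = \sum_f weight f * 1.
  by rewrite -{1}Pr_true; apply: eq_bigr => f _; rewrite mulr1.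
rewrite PrE [X in _ <= X - _ + _]W1 -sumrB mulr_sumr -big_split /=.
apply: ler_sum => f _.
rewrite -mulr_sumr -mulrBr.
under [X in _ + _ * X]eq_bigr do rewrite -mulr_sumr.
rewrite -mulr_sumr mulrCA -mulrDr; apply: ler_wpM2l; first exact: weight_ge0.
pose N := (\sum_t (F t f : nat))%N.
have sumN : \sum_t (F t f)%:R = N%:R :> R by rewrite /N natr_sum.
rewrite sumN.
have -> : \sum_s \sum_(t | t != s) (F s f)%:R * (F t f)%:R = N%:R * N%:R - N%:R :> R.
  rewrite -[X in _ = X * _ - X]sumN mulr_suml -sumrB; apply: eq_bigr => s _.
  rewrite -sumN [in RHS](bigD1 s) //= mulrDr mulr_sumr -natrM.
  by case: (F s f) => /=; rewrite !(mul1n, mul0n, subrr, addr0) // addrC addrA addNr add0r.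
case: (posnP N) => [NE|NE].
  rewrite NE mul0r !subr0 mulr0 addr0.
  by rewrite lern1 leq_b1.
have -> : [forall t, [exists e in Z t, f e]] = false.
  apply/negP => /forallP h; move: NE; rewrite /N big1 // => t _.
  apply/eqP; rewrite eqb0; apply/negP => /forallP Ft.
  have /existsP[e /andP[eZ fe]] := h t.
  by move: (Ft e); rewrite eZ fe.
case: (N) NE => // -[|m] _; first by rewrite !mulr1 !subrr mulr0 addr0.
(* With N = m + 2 the claim reads 0 <= (N - 1)(N - 2) / 2. *)
have : 0 <= m%:R :> R by [].
rewrite -(natr1 m.+1) -(natr1 m) => /= m0; nra.
Qed.

End BitProbability.

(** * Overlap matrices *)

Section Overlap.
Variable R : realFieldType.
Implicit Types k a b c d e f g h i : R.

(** The letters form a 3 x 3 matrix read row by row; each entry is multiplied by its minor, the sum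
    of the four entries outside its row and column. This is [shared] written out, in a form that
    [lra] can handle. *)
Definition cross9 a b c d e f g h i : R :=
  a * (e + f + (h + i)) + b * (d + f + (g + i)) + c * (d + e + (g + h))
  + (d * (b + c + (h + i)) + e * (a + c + (g + i)) + f * (a + b + (g + h)))
  + (g * (b + c + (e + f)) + h * (a + c + (d + f)) + i * (a + b + (d + e))).

(** 36 k times the total minus [18 * cross9] is 18 times the sum of entry times deficit, where the
    deficit 2 k - minor is never negative. Each diagonal entry is at least k / 2, and the three
    diagonal deficits add up to at least 3 k - (a + e + i), because the off-diagonal mass is at most
    that. *)
Lemma cross9_near k a b c d e f g h i :
  0 <= a -> 0 <= b -> 0 <= c -> 0 <= d -> 0 <= e -> 0 <= f ->
  0 <= g -> 0 <= h -> 0 <= i -> 0 <= k ->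
  a + b + c <= k -> d + e + f <= k -> g + h + i <= k ->
  a + d + g <= k -> b + e + h <= k -> c + f + i <= k ->
  k <= 2 * a -> k <= 2 * e -> k <= 2 * i ->
  18 * cross9 a b c d e f g h i + k * (3 * k) <=
  36 * (k * (a + b + c + (d + e + f) + (g + h + i))) + k * (a + e + i).
Proof.
rewrite /cross9 => a0 b0 c0 d0 e0 f0 g0 h0 i0 k0 R1 R2 R3 C1 C2 C3 A E I.
have Ha : 0 <= (2 * a - k) * (2 * k - (e + f + (h + i))) by apply: mulr_ge0; lra.
have He : 0 <= (2 * e - k) * (2 * k - (a + c + (g + i))) by apply: mulr_ge0; lra.
have Hi : 0 <= (2 * i - k) * (2 * k - (a + b + (d + e))) by apply: mulr_ge0; lra.
have Hk : 0 <= k * (6 * k - (e + f + (h + i)) - (a + c + (g + i)) - (a + b + (d + e))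
   - (3 * k - (a + e + i))) by apply: mulr_ge0; lra.
have Hk' : 0 <= k * (3 * k - (a + e + i)) by apply: mulr_ge0; lra.
have Hb : 0 <= b * (2 * k - (d + f + (g + i))) by apply: mulr_ge0; lra.
have Hc : 0 <= c * (2 * k - (d + e + (g + h))) by apply: mulr_ge0; lra.
have Hd : 0 <= d * (2 * k - (b + c + (h + i))) by apply: mulr_ge0; lra.
have Hf : 0 <= f * (2 * k - (a + b + (g + h))) by apply: mulr_ge0; lra.
have Hg : 0 <= g * (2 * k - (b + c + (e + f))) by apply: mulr_ge0; lra.
have Hh : 0 <= h * (2 * k - (a + c + (d + f))) by apply: mulr_ge0; lra.
clear -Ha He Hi Hk Hk' Hb Hc Hd Hf Hg Hh; lra.
Qed.

(** Here [a] may be bad. The entries [e], [f], [h], [i] of its minor have deficit at least k / 6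
    each and together weigh at least 11 k / 6, more than a third of the total, which is at most 3
    k. *)
Lemma cross9_far k a b c d e f g h i :
  0 <= a -> 0 <= b -> 0 <= c -> 0 <= d -> 0 <= e -> 0 <= f ->
  0 <= g -> 0 <= h -> 0 <= i -> 0 <= k ->
  a + b + c <= k -> d + e + f <= k -> g + h + i <= k ->
  a + d + g <= k -> b + e + h <= k -> c + f + i <= k ->
  11 * k <= 6 * (e + f + (h + i)) ->
  6 * (a + c + (g + i)) <= 11 * k -> 6 * (a + b + (g + h)) <= 11 * k ->
  6 * (a + c + (d + f)) <= 11 * k -> 6 * (a + b + (d + e)) <= 11 * k ->
  18 * cross9 a b c d e f g h i
    + k * (a + b + c + (d + e + f) + (g + h + i)) <=
  36 * (k * (a + b + c + (d + e + f) + (g + h + i))).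
Proof.
rewrite /cross9 => a0 b0 c0 d0 e0 f0 g0 h0 i0 k0 R1 R2 R3 C1 C2 C3 A E F H I.
have Ha : 0 <= a * (2 * k - (e + f + (h + i))) by apply: mulr_ge0; lra.
have Hb : 0 <= b * (2 * k - (d + f + (g + i))) by apply: mulr_ge0; lra.
have Hc : 0 <= c * (2 * k - (d + e + (g + h))) by apply: mulr_ge0; lra.
have Hd : 0 <= d * (2 * k - (b + c + (h + i))) by apply: mulr_ge0; lra.
have Hg : 0 <= g * (2 * k - (b + c + (e + f))) by apply: mulr_ge0; lra.
have He : 0 <= e * (11 * k - 6 * (a + c + (g + i))) by apply: mulr_ge0; lra.
have Hf : 0 <= f * (11 * k - 6 * (a + b + (g + h))) by apply: mulr_ge0; lra.
have Hh : 0 <= h * (11 * k - 6 * (a + c + (d + f))) by apply: mulr_ge0; lra.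
have Hi : 0 <= i * (11 * k - 6 * (a + b + (d + e))) by apply: mulr_ge0; lra.
have Hk : 0 <= k * (3 * (e + f + (h + i)) -
    (a + b + c + (d + e + f) + (g + h + i))) by apply: mulr_ge0; lra.
clear -Ha He Hi Hk Hb Hc Hd Hf Hg Hh; lra.
Qed.

(** Every deficit 2 k - minor is at least k / 6, so the gain is at least 3 k times the total. *)
Lemma cross9_good k a b c d e f g h i :
  0 <= a -> 0 <= b -> 0 <= c -> 0 <= d -> 0 <= e -> 0 <= f ->
  0 <= g -> 0 <= h -> 0 <= i -> 0 <= k ->
  6 * (e + f + (h + i)) <= 11 * k -> 6 * (d + f + (g + i)) <= 11 * k ->
  6 * (d + e + (g + h)) <= 11 * k -> 6 * (b + c + (h + i)) <= 11 * k ->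
  6 * (a + c + (g + i)) <= 11 * k -> 6 * (a + b + (g + h)) <= 11 * k ->
  6 * (b + c + (e + f)) <= 11 * k -> 6 * (a + c + (d + f)) <= 11 * k ->
  6 * (a + b + (d + e)) <= 11 * k ->
  18 * cross9 a b c d e f g h i
    + k * (a + b + c + (d + e + f) + (g + h + i)) <=
  36 * (k * (a + b + c + (d + e + f) + (g + h + i))).
Proof.
rewrite /cross9 => a0 b0 c0 d0 e0 f0 g0 h0 i0 k0 A B C D E F G H I.
have Ha := ler_wpM2l a0 A; have Hb := ler_wpM2l b0 B.
have Hc := ler_wpM2l c0 C; have Hd := ler_wpM2l d0 D.
have He := ler_wpM2l e0 E; have Hf := ler_wpM2l f0 F.
have Hg := ler_wpM2l g0 G; have Hh := ler_wpM2l h0 H.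
have Hi := ler_wpM2l i0 I.
have Hk : 0 <= k * (a + b + c + (d + e + f) + (g + h + i)) by apply: mulr_ge0; lra.
clear -Hk Ha Hb Hc Hd He Hf Hg Hh Hi; lra.
Qed.

End Overlap.

Section OverlapMatrix.
Variable R : realFieldType.
Implicit Types (r : 'I_3 -> 'I_3 -> R) (k : R).

Definition minor r i a : R := \sum_(j | j != i) \sum_(b | b != a) r j b.
Definition shared r : R := \sum_i \sum_a r i a * minor r i a.
Definition total r : R := \sum_i \sum_a r i a.

Lemma big_neq_perm (s : {perm 'I_3}) i (F : 'I_3 -> R) :
  \sum_(j | j != i) F (s j) = \sum_(j | j != s i) F j.
Proof.
rewrite [RHS](reindex_inj (@perm_inj _ s)) /=; apply: eq_bigl => j.
by rewrite (inj_eq (@perm_inj _ s)).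
Qed.

Lemma big_perm (s : {perm 'I_3}) (F : 'I_3 -> R) : \sum_j F (s j) = \sum_j F j.
Proof. by rewrite [RHS](reindex_inj (@perm_inj _ s)). Qed.

Lemma minor_perm (s t : {perm 'I_3}) r i a :
  minor (fun j b => r (s j) (t b)) i a = minor r (s i) (t a).
Proof.
rewrite /minor.
under eq_bigr do rewrite (big_neq_perm t a (r _)).
exact: (big_neq_perm s i (fun j => \sum_(b | b != t a) r j b)).
Qed.

Lemma shared_perm (s t : {perm 'I_3}) r :
  shared (fun i a => r (s i) (t a)) = shared r.
Proof.
rewrite /shared.
under eq_bigr do under eq_bigr do rewrite minor_perm.
under eq_bigr do rewrite (big_perm t (fun a => r _ a * minor r _ a)).
exact: (big_perm s (fun i => \sum_a r i a * minor r i a)).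
Qed.

Lemma total_perm (s t : {perm 'I_3}) r :
  total (fun i a => r (s i) (t a)) = total r.
Proof.
rewrite /total.
under eq_bigr do rewrite (big_perm t (r _)).
exact: (big_perm s (fun i => \sum_a r i a)).
Qed.

Let i0 : 'I_3 := ord0.
Let i1 : 'I_3 := lift ord0 ord0.
Let i2 : 'I_3 := lift ord0 (lift ord0 ord0).

Lemma ord3P (i : 'I_3) : [\/ i = i0, i = i1 | i = i2].
Proof.
by case: i => [[|[|[|m]]] lt_m] //; [constructor 1 | constructor 2 | constructor 3];
   apply: val_inj.
Qed.

Lemma big_ord3 (F : 'I_3 -> R) : \sum_i F i = F i0 + F i1 + F i2.
Proof. by rewrite !big_ord_recl big_ord0 addr0 addrA. Qed.

Lemma big_ord3_neq (F : 'I_3 -> R) :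
  (\sum_(j | j != i0) F j = F i1 + F i2) *
  (\sum_(j | j != i1) F j = F i0 + F i2) *
  (\sum_(j | j != i2) F j = F i0 + F i1).
Proof. by do !split; rewrite big_mkcond big_ord3 /= ?add0r ?addr0. Qed.

Lemma minor9 r :
  (minor r i0 i0 = r i1 i1 + r i1 i2 + (r i2 i1 + r i2 i2)) *
  (minor r i0 i1 = r i1 i0 + r i1 i2 + (r i2 i0 + r i2 i2)) *
  (minor r i0 i2 = r i1 i0 + r i1 i1 + (r i2 i0 + r i2 i1)) *
  (minor r i1 i0 = r i0 i1 + r i0 i2 + (r i2 i1 + r i2 i2)) *
  (minor r i1 i1 = r i0 i0 + r i0 i2 + (r i2 i0 + r i2 i2)) *
  (minor r i1 i2 = r i0 i0 + r i0 i1 + (r i2 i0 + r i2 i1)) *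
  (minor r i2 i0 = r i0 i1 + r i0 i2 + (r i1 i1 + r i1 i2)) *
  (minor r i2 i1 = r i0 i0 + r i0 i2 + (r i1 i0 + r i1 i2)) *
  (minor r i2 i2 = r i0 i0 + r i0 i1 + (r i1 i0 + r i1 i1)).
Proof.
by do !split; rewrite /minor !big_ord3_neq.
Qed.

Lemma sharedE r : shared r =
  cross9 (r i0 i0) (r i0 i1) (r i0 i2) (r i1 i0) (r i1 i1) (r i1 i2)
         (r i2 i0) (r i2 i1) (r i2 i2).
Proof. by rewrite /shared !big_ord3 !minor9 /cross9. Qed.

Lemma totalE r : total r =
  r i0 i0 + r i0 i1 + r i0 i2 + (r i1 i0 + r i1 i1 + r i1 i2)
  + (r i2 i0 + r i2 i1 + r i2 i2).
Proof. by rewrite /total !big_ord3. Qed.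

Variable k : R.
Hypothesis k0 : 0 <= k.

(* Call an entry bad if its minor exceeds 11 k / 6, so that the two complementary
   rows and columns are almost full. Two bad entries in different rows and columns
   make [r] close to [k] times a permutation matrix; otherwise at least a third of
   the total of [r] lies in entries that are not bad. *)
Lemma overlap_dichotomy r :
  (forall i a, 0 <= r i a) ->
  (forall i, \sum_a r i a <= k) -> (forall a, \sum_i r i a <= k) ->
  18 * shared r + k * total r <= 36 * (k * total r) \/
  exists s : {perm 'I_3},
    18 * shared r + k * (3 * k) <= 36 * (k * total r) + k * \sum_i r i (s i).
Proof.
move=> r0 rowk colk.
have [/existsP[i /existsP[a bad]]|/existsPn good] :=
    boolP [exists i, exists a, 11 * k < 6 * minor r i a]; last first.
  left; have G i a : 6 * minor r i a <= 11 * k.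
    by have /existsPn/(_ a) := good i; rewrite -leNgt.
  rewrite sharedE totalE.
  have := (G i0 i0, G i0 i1, G i0 i2, (G i1 i0, G i1 i1, G i1 i2), (G i2 i0, G i2 i1, G i2 i2)).
  rewrite !minor9 => -[[[[[? ?] ?] [[? ?] ?]] [[? ?] ?]]].
  exact: cross9_good.
(* [shared] and [total] are invariant under separate permutations of rows and columns, so the bad
   entry may be moved to position (0, 0). *)
pose s := tperm i0 i; pose t := tperm i0 a.
pose r1 i a := r (s i) (t a).
have r1_0 j b : 0 <= r1 j b by exact: r0.
have rowk1 j : \sum_b r1 j b <= k by rewrite /r1 (big_perm t (r _)).
have colk1 b : \sum_j r1 j b <= k.
  by rewrite /r1 (big_perm s (fun j => r j _)).
have bad1 : 11 * k < 6 * minor r1 i0 i0 by rewrite minor_perm !tpermL.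
have [/existsP[j /andP[j0 /existsP[b /andP[b0 badb]]]]|/existsPn good] :=
    boolP [exists j, (j != i0) && [exists b, (b != i0) && (11 * k < 6 * minor r1 j b)]]; last first.
  left; rewrite -(shared_perm s t) -(total_perm s t) -/r1.
  have G j b : j != i0 -> b != i0 -> 6 * minor r1 j b <= 11 * k.
    move=> j0 b0; have := good j; rewrite j0 /= => /existsPn/(_ b).
    by rewrite b0 /= -leNgt.
  rewrite sharedE totalE.
  have := (rowk1 i0, rowk1 i1, rowk1 i2, (colk1 i0, colk1 i1, colk1 i2)).
  rewrite !big_ord3 => -[[[? ?] ?] [[? ?] ?]].
  have := (G i1 i1 isT isT, G i1 i2 isT isT, G i2 i1 isT isT, G i2 i2 isT isT, ltW bad1).
  rewrite !minor9 => -[[[[? ?] ?] ?] ?].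
  exact: cross9_far.
right.
pose s' := tperm i1 j; pose t' := tperm i1 b.
pose r2 i a := r1 (s' i) (t' a).
have s'0 : s' i0 = i0 by rewrite tpermD // eq_sym.
have t'0 : t' i0 = i0 by rewrite tpermD // eq_sym.
have bad2 : 11 * k < 6 * minor r2 i0 i0 by rewrite minor_perm s'0 t'0.
have bad3 : 11 * k < 6 * minor r2 i1 i1 by rewrite minor_perm !tpermL.
have r2_0 u v : 0 <= r2 u v by exact: r1_0.
have rowk2 u : \sum_v r2 u v <= k by rewrite /r2 (big_perm t' (r1 _)).
have colk2 v : \sum_u r2 u v <= k by rewrite /r2 (big_perm s' (fun u => r1 u _)).
(* [r2 u v] is the entry of [r] in row [(s' * s) u] and column [(t' * t) v], so the diagonal of [r2]
   is the transversal of [r] along this permutation. *)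
exists ((s' * s)^-1 * (t' * t))%g.
rewrite -(big_perm (s' * s)%g (fun i => r i _)).
under [in leRHS]eq_bigr do rewrite [X in r _ X]permM permK !permM.
rewrite -(shared_perm s t) -(total_perm s t) -/r1.
rewrite -(shared_perm s' t') -(total_perm s' t') -/r2.
rewrite sharedE totalE big_ord3.
have := (rowk2 i0, rowk2 i1, rowk2 i2, (colk2 i0, colk2 i1, colk2 i2)).
rewrite !big_ord3 => -[[[? ?] ?] [[? ?] ?]].
move: bad2 bad3; rewrite !minor9 => bad2 bad3.
have := (r2_0 i0 i0, r2_0 i0 i1, r2_0 i0 i2, (r2_0 i1 i0, r2_0 i1 i1, r2_0 i1 i2),
  (r2_0 i2 i0, r2_0 i2 i1, r2_0 i2 i2)).
move=> -[[[[? ?] ?] [[? ?] ?]] [[? ?] ?]].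
(* The two bad minors fill rows and columns so far that every diagonal entry of [r2] is at least k /
   2. *)
apply: cross9_near => //; lra.
Qed.

End OverlapMatrix.

(** * From graphs to bits *)

Section Bridge.
Variables (R : realType) (p : R) (n : nat).
Notation bits := {ffun {set 'I_n} -> bool}.
Implicit Types (f : bits) (c : {ffun 'I_n -> option 'I_3}) (x : {ffun 'I_3 -> 'I_n}).

(* There is one bit for every set of vertices; those of sets that are not pairs
   are ignored. *)
Fact graph_of_bits_subproof f :
  [forall e in [set e : {set 'I_n} | f e & #|e| == 2], #|e| == 2].
Proof. by apply/forall_inP => e; rewrite inE => /andP[]. Qed.

Definition graph_of_bits f : sgraph n := SGraph (graph_of_bits_subproof f).

Lemma gnp_probE (A : classical_sets.set (sgraph n)) :
  gnp_prob p A = Pr p (fun f : bits => graph_of_bits f \in A).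
Proof.
rewrite /gnp_prob /Pr (partition_big graph_of_bits (fun G => G \in A)) //=.
apply: eq_bigr => G GA.
(* Bits of sets that are not pairs are unconstrained and sum to 1. *)
pose F (e : {set 'I_n}) := if #|e| == 2 then pred1 (e \in edges G) else predT.
transitivity (\prod_e \sum_(b | F e b) bit_weight p b).
  rewrite /gnp_pmf big_mkcond /=; apply: eq_bigr => e _; rewrite /F.
  by case: ifP => _; rewrite ?bit_weight_sum // big_pred1_eq.
rewrite bigA_distr_big_dep; apply: eq_bigl => f.
apply/familyP/andP => [fF|[_ /eqP fG] e].
  have -> : graph_of_bits f = G.
    apply: val_inj; apply/setP => e; rewrite !inE.
    have := fF e; rewrite /F; case: eqP => [_|/eqP e2] /=.
      by rewrite andbT => /eqP.
    move=> _; rewrite andbF; apply/esym/negbTE; apply: contra e2.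
    exact: (forall_inP (edges_card2 G)).
  by rewrite GA.
rewrite /F; case: ifP => // e2.
by rewrite -fG inE /= !inE e2 andbT.
Qed.

(** A tuple is encoded as a coloring [c], with [None] outside the three sets, and a root map [x].
    Disjointness is then automatic, and renaming the three sets is composition with a
    permutation. *)
Definition cls c i : {set 'I_n} := [set v | c v == Some i].
Definition cross_rel c : rel 'I_n :=
  fun u v => [&& c u != None, c v != None & c u != c v].
(** The pairs whose bits are prescribed by the one-edge conditions: 1 on [triangle x] and 0
    elsewhere. *)
Definition crossing c : {set {set 'I_n}} :=
  [set e | [exists u, exists v, cross_rel c u v && (e == [set u; v])]].
Definition triangle x : {set {set 'I_n}} :=
  [set e | [exists i, exists j, (i != j) && (e == [set x i; x j])]].
Definition spokes (v : 'I_n) (Z : {set 'I_n}) : {set {set 'I_n}} :=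
  [set [set v; u] | u in Z].
Definition rooted c x : bool := [forall i, c (x i) == Some i].
Definition linked c x f : bool :=
  [forall e in crossing c, f e == (e \in triangle x)].
Definition dominated c f : bool :=
  [forall (v | c v == None), [forall i, [exists e in spokes v (cls c i), f e]]].
Definition good_event c x f : bool := [&& rooted c x, linked c x f & dominated c f].

Lemma triangleE c x u v i j : rooted c x -> c u = Some i -> c v = Some j ->
  i != j -> ([set u; v] \in triangle x) = ([set u; v] == [set x i; x j]).
Proof.
move=> /forallP rx cu cv ij; rewrite inE; apply/existsP/idP => [[i' /existsP[j' /andP[ij' /eqP E]]]|E].
  have cx a b : x a = b -> c b = Some a by move=> <-; apply/eqP.
  have : u \in [set x i'; x j'] by rewrite -E set21.
  have : v \in [set x i'; x j'] by rewrite -E set22.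
  rewrite E !inE => /orP[]/eqP/esym/cx; rewrite cv => -[jE] /orP[]/eqP/esym/cx; rewrite cu => -[iE]; subst.
  - by rewrite eqxx in ij.
  - by rewrite finset.setUC.
  - by [].
  - by rewrite eqxx in ij.
by exists i; apply/existsP; exists j; rewrite ij.
Qed.

Lemma adjE f u v : adj (graph_of_bits f) u v = (u != v) && f [set u; v].
Proof. by rewrite /adj inE cards2 andbC; case: (u =P v). Qed.

Lemma edges_betweenP f (A B : {set 'I_n}) a b :
  [disjoint A & B] -> a \in A -> b \in B ->
  reflect (forall u v, u \in A -> v \in B -> f [set u; v] = ([set u; v] == [set a; b]))
          (edges_between (graph_of_bits f) A B == [set [set a; b]]).
Proof.
move=> dAB aA bB.
have neq u v : u \in A -> v \in B -> u != v.
  by move=> uA vB; apply: contraTneq uA => ->; rewrite (disjointFl dAB vB).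
apply: (iffP eqP) => [E u v uA vB|H].
  have -> : ([set u; v] == [set a; b]) =
      ([set u; v] \in edges_between (graph_of_bits f) A B) by rewrite E inE.
  rewrite 2!inE cards2 (neq u v uA vB) andbT.
  case: (f _) => //=; apply/esym/existsP; exists u; rewrite uA /=.
  by apply/existsP; exists v; rewrite vB eqxx.
apply/setP => e; rewrite 3!inE.
apply/andP/eqP => [[/andP[fe _] /existsP[u /andP[uA /existsP[v /andP[vB /eqP eE]]]]]|->].
  by move: fe; rewrite eE H // => /eqP.
rewrite H // eqxx cards2 neq //; split=> //.
by apply/existsP; exists a; rewrite aA; apply/existsP; exists b; rewrite bB eqxx.
Qed.

Lemma cls_disjoint c i j : i != j -> [disjoint cls c i & cls c j].
Proof.
move=> ij; rewrite disjoint_subset; apply/fintype.subsetP => v; rewrite !inE => /eqP ->.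
by apply: contra ij => /eqP[->].
Qed.

Lemma linkedP c x f : rooted c x ->
  reflect (forall i j, i != j ->
             edges_between (graph_of_bits f) (cls c i) (cls c j) = [set [set x i; x j]])
          (linked c x f).
Proof.
move=> rx; have xin i : x i \in cls c i by rewrite inE; exact: (forallP rx).
apply: (iffP forallP) => [H i j ij|H e].
  apply/eqP/edges_betweenP => //; first exact: cls_disjoint.
  move=> u v; rewrite !inE => /eqP cu /eqP cv.
  rewrite -(triangleE rx cu cv ij); move: (H [set u; v]).
  suff -> : [set u; v] \in crossing c by move/eqP.
  rewrite inE; apply/existsP; exists u; apply/existsP; exists v.
  by rewrite eqxx /cross_rel cu cv /= andbT; apply: contra ij => /eqP[->].
apply/implyP; rewrite inE => /existsP[u /existsP[v /andP[/and3P[]]]].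
case cu: (c u) => [i|] // _; case cv: (c v) => [j|] // _ ij /eqP ->.
have {}ij : i != j by apply: contra ij => /eqP ->.
rewrite (triangleE rx cu cv ij); apply/eqP.
move: (H i j ij) => /eqP /(edges_betweenP _ (cls_disjoint c ij) (xin i) (xin j)).
by apply; rewrite inE ?cu ?cv.
Qed.

Lemma dominatedP c f :
  reflect (forall v i, c v = None -> exists2 u, u \in cls c i & adj (graph_of_bits f) v u)
          (dominated c f).
Proof.
apply: (iffP forallP) => [H v i cv|H v].
  move: (H v); rewrite cv eqxx /= => /forallP/(_ i)/existsP[e /andP[/imsetP[u ui ->] fe]].
  exists u => //; rewrite adjE fe andbT; apply: contraTneq ui => <-.
  by rewrite inE cv.
apply/implyP => /eqP cv; apply/forallP => i.
have [u ui] := H v i cv; rewrite adjE => /andP[_ fe].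
by apply/existsP; exists [set v; u]; rewrite fe andbT; apply: imset_f.
Qed.

Let i0 : 'I_3 := ord0.
Let i1 : 'I_3 := lift ord0 ord0.
Let i2 : 'I_3 := lift ord0 (lift ord0 ord0).

Definition coloring_of (X1 X2 X3 : {set 'I_n}) : {ffun 'I_n -> option 'I_3} :=
  [ffun v => if v \in X1 then Some i0 else if v \in X2 then Some i1
             else if v \in X3 then Some i2 else None].

Lemma cls_coloring_of (X1 X2 X3 : {set 'I_n}) :
  [disjoint X1 & X2] -> [disjoint X1 & X3] -> [disjoint X2 & X3] ->
  [/\ cls (coloring_of X1 X2 X3) i0 = X1, cls (coloring_of X1 X2 X3) i1 = X2 &
      cls (coloring_of X1 X2 X3) i2 = X3].
Proof.
move=> d12 d13 d23; split; apply/setP => v; rewrite inE ffunE.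
- by case: ifP => // _; case: ifP => // _; case: ifP.
- case: ifP => [v1|_]; first by rewrite (disjointFr d12 v1).
  by case: ifP => // _; case: ifP.
- case: ifP => [v1|_]; first by rewrite (disjointFr d13 v1).
  case: ifP => [v2|_]; first by rewrite (disjointFr d23 v2).
  by case: ifP.
Qed.

Lemma edges_betweenC (G : sgraph n) (A B : {set 'I_n}) : edges_between G A B = edges_between G B A.
Proof.
apply/setP => e; rewrite !inE; congr (_ && _).
by apply/existsP/existsP => -[u /andP[ua /existsP[v /andP[va /eqP ->]]]];
  exists v; rewrite va; apply/existsP; exists u; rewrite ua finset.setUC /=.
Qed.

Lemma coloring_of_None (X1 X2 X3 : {set 'I_n}) v :
  (coloring_of X1 X2 X3 v == None) = (v \in ~: (X1 :|: X2 :|: X3)).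
Proof. by rewrite ffunE !inE; case: (v \in X1); case: (v \in X2); case: (v \in X3). Qed.

(** The sizes are recovered as class sizes, positive because the roots lie in their classes;
    conversely three disjoint sets define a coloring. *)
Lemma ex_X_countP f :
  reflect (exists k l m : nat,
    [/\ (0 < k)%N, (0 < l)%N, (0 < m)%N & (0 < X_count (graph_of_bits f) k l m)%N])
  [exists t : {ffun 'I_n -> option 'I_3} * {ffun 'I_3 -> 'I_n}, good_event t.1 t.2 f].
Proof.
apply: (iffP existsP) => [[[c x] /= /and3P[rx]]|[k [l [m [k0 l0 m0]]]]].
  move=> /(linkedP _ rx) lx /dominatedP dx.
  have xin i : x i \in cls c i by rewrite inE; exact: (forallP rx).
  have pos i : (0 < #|cls c i|)%N by apply/card_gt0P; exists (x i).
  exists #|cls c i0|, #|cls c i1|, #|cls c i2|; split=> //.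
  apply/card_gt0P; exists (cls c i0, x i0, cls c i1, x i1, cls c i2, x i2).
  rewrite inE /admissible !xin !eqxx !cls_disjoint //= !lx // !eqxx !andbT.
  apply/forallP => v; apply/implyP; rewrite !inE => /norP[/norP[c0 c1] c2].
  have cv : c v = None.
    move: c0 c1 c2; case: (c v) => // i.
    by case: (ord3P i) => ->; rewrite eqxx.
  by apply/and3P; split; [have [u ui uv] := dx v i0 cv | have [u ui uv] := dx v i1 cv |
    have [u ui uv] := dx v i2 cv]; apply/existsP; exists u; rewrite ui.
move=> /card_gt0P[[[[[[X1 x1] X2] x2] X3] x3]]; rewrite inE.
case/and5P=> /and3P[x1X x2X x3X] _ /and3P[d12 d13 d23] dom /and3P[e12 e13 e23].
have [C1 C2 C3] := cls_coloring_of d12 d13 d23.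
set c := coloring_of X1 X2 X3 in C1 C2 C3.
pose x : {ffun 'I_3 -> 'I_n} := [ffun i : 'I_3 => nth x1 [:: x1; x2; x3] i].
have xE : [/\ x i0 = x1, x i1 = x2 & x i2 = x3] by rewrite !ffunE.
case: xE => xE0 xE1 xE2.
have rx : rooted c x.
  apply/forallP => i; suff : x i \in cls c i by rewrite inE.
  by case: (ord3P i) => ->; rewrite ?C1 ?C2 ?C3 ?xE0 ?xE1 ?xE2.
exists (c, x); apply/and3P; split=> //=.
  apply/(linkedP _ rx) => i j.
  case: (ord3P i) => ->; case: (ord3P j) => -> // _;
    rewrite ?C1 ?C2 ?C3 ?xE0 ?xE1 ?xE2; apply/eqP => //;
    by rewrite edges_betweenC [[set _; _]]finset.setUC.
apply/dominatedP => v i cv.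
have : v \in ~: (X1 :|: X2 :|: X3) by rewrite -coloring_of_None; apply/eqP.
move=> vX; have /forallP/(_ v) := dom; rewrite vX /= => /and3P[].
move=> /existsP[u1 /andP[? ?]] /existsP[u2 /andP[? ?]] /existsP[u3 /andP[? ?]].
by case: (ord3P i) => ->; [exists u1; rewrite ?C1|exists u2; rewrite ?C2|exists u3; rewrite ?C3].
Qed.

Definition gnp_good : R :=
  gnp_prob p (fun G : sgraph n => exists k l m : nat,
    [/\ (0 < k)%N, (0 < l)%N, (0 < m)%N & (0 < X_count G k l m)%N]).

Lemma gnp_goodE : gnp_good =
  Pr p (fun f : bits =>
    [exists t : {ffun 'I_n -> option 'I_3} * {ffun 'I_3 -> 'I_n}, good_event t.1 t.2 f]).
Proof.
rewrite /gnp_good gnp_probE; apply: eq_Pr => f.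
by apply/idP/ex_X_countP => [/set_mem|/mem_set].
Qed.

End Bridge.

(** Double counting: as [r] is symmetric and irreflexive, every edge comes from exactly two ordered
    pairs. *)
Lemma card_edge_set (T : finType) (r : rel T) : symmetric r -> irreflexive r ->
  (#|[set e : {set T} | [exists u, exists v, r u v && (e == [set u; v])]]| * 2 =
   \sum_u \sum_v r u v)%N.
Proof.
move=> sr ir; pose pr (w : T * T) := [set w.1; w.2].
rewrite pair_bigA /=.
transitivity (#|[set w : T * T | r w.1 w.2]|); last first.
  by rewrite -sum1dep_card big_mkcond; apply: eq_bigr => w _; case: (r _ _).
rewrite -[RHS]sum1dep_card (partition_big pr (fun e =>
   [exists u, exists v, r u v && (e == [set u; v])])) /=; last first.
  by case=> u v /= ruv; apply/existsP; exists u; apply/existsP; exists v; rewrite ruv eqxx.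
rewrite -sum1dep_card big_distrl /=; apply: eq_bigr => e.
move=> /existsP[u /existsP[v /andP[ruv /eqP ->]]].
have uv : u != v by apply: contraTneq ruv => ->; rewrite ir.
rewrite sum1dep_card mul1n; symmetry.
have -> : 2%N = #|[set (u, v); (v, u)]|.
  by rewrite cards2; case: eqP => // -[E]; rewrite E eqxx in uv.
apply: eq_card => -[a b]; rewrite !inE /pr /=.
apply/andP/orP => [[rab /eqP E]|[]/eqP[-> ->]]; last 2 first.
- by [].
- by rewrite sr finset.setUC.
have ab : a != b by apply: contraTneq rab => ->; rewrite ir.
have : a \in [set u; v] by rewrite -E set21.
have : b \in [set u; v] by rewrite -E set22.
rewrite !inE => /orP[]/eqP bE /orP[]/eqP aE; rewrite aE bE ?eqxx in ab *; by [right|left|].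
Qed.

(** * Common crossing pairs of two colorings, and independence of linking and domination *)

Section Events.
Variables (R : realFieldType) (p : R) (n : nat).
Hypothesis p01 : 0 < p < 1.
Notation bits := {ffun {set 'I_n} -> bool}.
Implicit Types (f : bits) (c : {ffun 'I_n -> option 'I_3}) (x : {ffun 'I_3 -> 'I_n}).

Local Notation q := (1 - p).
Let pw : 0 <= p <= 1. Proof. by case/andP: p01 => ? ?; rewrite !ltW. Qed.
Let q0 : 0 < q. Proof. by rewrite subr_gt0; case/andP: p01. Qed.
Let q1 : q < 1. Proof. by rewrite gtrBl; case/andP: p01. Qed.

Definition overlap c c' i a : nat := #|cls c i :&: cls c' a|.

Lemma cross_rel_sym c : symmetric (cross_rel c).
Proof. by move=> u v; rewrite /cross_rel; case: (c u) (c v) => [i|] [j|] //=; rewrite eq_sym. Qed.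

Lemma cross_rel_irr c : irreflexive (cross_rel c).
Proof. by move=> u; rewrite /cross_rel eqxx !andbF. Qed.

(** A vertex colored by both colorings lies in exactly one cell [cls c i :&: cls c' a], so at most
    one term of the sum is 1. *)
Lemma cross_rel_sum c c' u v :
  (cross_rel c u v && cross_rel c' u v : nat) =
  (\sum_i \sum_a (u \in cls c i :&: cls c' a) *
     \sum_(j | j != i) \sum_(b | b != a) (v \in cls c j :&: cls c' b))%N.
Proof.
rewrite /cross_rel.
have none w i a : (c w == None) || (c' w == None) -> (w \in cls c i :&: cls c' a) = false.
  by rewrite !inE => /orP[]/eqP->; rewrite /= ?andbF.
case: (boolP ((c u == None) || (c' u == None))) => [cu|].
  rewrite [RHS]big1 => [|i _]; last by rewrite big1 // => a _; rewrite none.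
  by case/orP: cu => ->; rewrite /= ?andbF.
case: (boolP ((c v == None) || (c' v == None))) => [cv _|].
  rewrite [RHS]big1 => [|i _].
    by case/orP: cv => ->; rewrite /= ?andbF ?andFb.
  rewrite big1 // => a _; rewrite [X in (_ * X)%N]big1 ?muln0 // => j _.
  by rewrite big1 // => b _; rewrite none.
have single w i0 a0 : c w = Some i0 -> c' w = Some a0 ->
    forall i a, (w \in cls c i :&: cls c' a) = (i == i0) && (a == a0).
  by move=> cw cw' i a; rewrite !inE cw cw' [Some i0 == _]eq_sym [Some a0 == _]eq_sym.
case cv: (c v) => [j0|] //; case cv': (c' v) => [b0|] // _.
case cu: (c u) => [i0|] //; case cu': (c' u) => [a0|] // _ /=.
rewrite (bigD1 i0) //= (bigD1 a0) //= (single _ _ _ cu cu') !eqxx mul1n.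
rewrite [X in (_ + X + _)%N]big1 ?addn0 => [|a aa]; last first.
  by rewrite (single _ _ _ cu cu') (negbTE aa) andbF.
rewrite [X in (_ + X)%N]big1 ?addn0 => [|i ii]; last first.
  by rewrite big1 // => a _; rewrite (single _ _ _ cu cu') (negbTE ii).
rewrite big_mkcond (bigD1 j0) //= [X in (_ + X)%N]big1 ?addn0 => [|j jj]; last first.
  by case: ifP => // _; rewrite big1 // => b _; rewrite (single _ _ _ cv cv') (negbTE jj).
have -> : (Some i0 != Some j0) = (j0 != i0) by rewrite eq_sym.
case: eqP => //= _.
rewrite big_mkcond (bigD1 b0) //= [X in (_ + X)%N]big1 ?addn0 => [|b bb]; last first.
  by case: ifP => // _; rewrite (single _ _ _ cv cv') (negbTE bb) andbF.
have -> : (Some a0 != Some b0) = (b0 != a0) by rewrite eq_sym.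
by case: eqP => //= _; rewrite (single _ _ _ cv cv') !eqxx.
Qed.

(** The two ordered pairs that exhibit a common pair may be reversed to each other; symmetry of
    [cross_rel] aligns them. *)
Lemma crossingI c c' : crossing c :&: crossing c' =
  [set e | [exists u, exists v, (cross_rel c u v && cross_rel c' u v) && (e == [set u; v])]].
Proof.
apply/setP => e; rewrite !inE; apply/andP/existsP => [[]|].
  move=> /existsP[u /existsP[v /andP[ruv /eqP ->]]].
  move=> /existsP[u' /existsP[v' /andP[ruv' /eqP E]]].
  have uv : u != v by apply: contraTneq ruv => ->; rewrite cross_rel_irr.
  exists u; apply/existsP; exists v; rewrite ruv eqxx andbT /=.
  have : u \in [set u'; v'] by rewrite -E set21.
  have : v \in [set u'; v'] by rewrite -E set22.
  rewrite !inE => /orP[]/eqP vE /orP[]/eqP uE; rewrite uE vE ?eqxx // in uv *.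
  by rewrite cross_rel_sym.
move=> [u /existsP[v /andP[/andP[ruv ruv'] /eqP ->]]].
by split; apply/existsP; exists u; apply/existsP; exists v; rewrite ?ruv ?ruv' eqxx.
Qed.

(** Both sides count ordered pairs of vertices that cross in [c] and in [c'], sorted by the cells of
    their ends. Through this the matrix inequalities bound the exponent of [q] that two events
    share. *)
Lemma card_crossingI c c' :
  shared (fun i a => (overlap c c' i a)%:R) = (2 * #|crossing c :&: crossing c'|)%:R :> R.
Proof.
rewrite mulnC crossingI card_edge_set; last 2 first.
- by move=> u v; rewrite cross_rel_sym [cross_rel c' _ _]cross_rel_sym.
- by move=> u; rewrite cross_rel_irr.
under eq_bigr do under eq_bigr do rewrite cross_rel_sum.
transitivity ((\sum_i \sum_a (\sum_u (u \in cls c i :&: cls c' a)) *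
    \sum_(j | j != i) \sum_(b | b != a) \sum_v (v \in cls c j :&: cls c' b))%N%:R : R).
  rewrite natr_sum; apply: eq_bigr => i _; rewrite natr_sum; apply: eq_bigr => a _.
  rewrite natrM; congr (_ * _).
    by rewrite /overlap -sum1_card big_mkcond.
  rewrite natr_sum; apply: eq_bigr => j _; rewrite natr_sum; apply: eq_bigr => b _.
  by rewrite /overlap -sum1_card big_mkcond.
congr (_%:R).
under [RHS]eq_bigr do (rewrite exchange_big /=; under eq_bigr do rewrite exchange_big /=).
rewrite [RHS]exchange_big /=; apply: eq_bigr => i _.
rewrite [RHS]exchange_big /=; apply: eq_bigr => a _.
rewrite big_distrl /=; apply: eq_bigr => u _.
rewrite -big_distrr /=; congr (_ * _)%N.
rewrite [RHS]exchange_big /=; apply: eq_bigr => j _.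
by rewrite [RHS]exchange_big.
Qed.

Lemma card_spokes (v : 'I_n) (Z : {set 'I_n}) : v \notin Z -> #|spokes v Z| = #|Z|.
Proof.
move=> vZ; apply: card_in_imset => u w uZ wZ E.
have : u \in [set v; w] by rewrite -E set22.
by rewrite !inE => /orP[]/eqP // uv; rewrite -uv uZ in vZ.
Qed.

Lemma spokesU (v : 'I_n) (Z Z' : {set 'I_n}) : spokes v Z :|: spokes v Z' = spokes v (Z :|: Z').
Proof. by rewrite /spokes imsetU. Qed.

Lemma spokes_disjoint (v : 'I_n) (Z Z' : {set 'I_n}) : v \notin Z -> [disjoint Z & Z'] ->
  [disjoint spokes v Z & spokes v Z'].
Proof.
move=> vZ dZ; rewrite disjoint_subset; apply/fintype.subsetP => _ /imsetP[u uZ ->].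
rewrite inE; apply/imsetP => -[w wZ E].
have : u \in [set v; w] by rewrite -E set22.
rewrite !inE => /orP[]/eqP uE; first by rewrite -uE uZ in vZ.
by move: (disjointFr dZ uZ); rewrite uE wZ.
Qed.

(** The pairs in [U] avoid [V], and spokes from different vertices of [V] into [W] are different
    pairs since [V] and [W] are disjoint. So all these events depend on disjoint sets of bits. *)
Lemma Pr_linked_dominated (U : {set {set 'I_n}}) (g : {set 'I_n} -> bool)
    (V W : {set 'I_n}) (B : 'I_n -> pred bits) :
  [disjoint V & W] ->
  (forall e, e \in U -> [disjoint e & V]) ->
  (forall v, v \in V -> depends (spokes v W) (B v)) ->
  Pr p (fun f => [forall e in U, f e == g e] && [forall v in V, B v f]) =
  (\prod_(e in U) bit_weight p (g e)) * \prod_(v in V) Pr p (B v).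
Proof.
move=> dVW dU dB.
rewrite (@Pr_indep _ p _ U (\bigcup_(v in V) spokes v W)).
- rewrite Pr_cylinder; congr (_ * _); apply: (@Pr_indep_big _ p _ _ _ (fun v => spokes v W)) => //.
  move=> s t sV tV st; rewrite disjoint_subset; apply/fintype.subsetP => _ /imsetP[u uW ->].
  rewrite inE; apply/imsetP => -[w wW E].
  have : s \in [set t; w] by rewrite -E set21.
  rewrite !inE (negbTE st) /= => /eqP sw.
  by move: (disjointFr dVW sV); rewrite sw wW.
- exact: depends_cylinder.
- apply: depends_forall => v vV; apply: dependsS (dB v vV).
  exact: (finset.bigcup_sup v).
- apply/bigcup_disjointP => v vV; rewrite disjoint_sym disjoint_subset.
  apply/fintype.subsetP => _ /imsetP[u uW ->]; rewrite inE; apply/negP => /dU.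
  rewrite disjoint_subset => /fintype.subsetP/(_ v (set21 _ _)).
  by rewrite inE vV.
Qed.

Lemma Pr_spokes_hit c v : c v = None ->
  Pr p (fun f : bits => [forall i, [exists e in spokes v (cls c i), f e]]) =
  \prod_i (1 - q ^+ #|cls c i|).
Proof.
move=> cv; have vc i : v \notin cls c i by rewrite inE cv.
transitivity (\prod_i Pr p (fun f : bits => [exists e in spokes v (cls c i), f e])).
  apply: (@Pr_indep_big _ p _ _ xpredT (fun i => spokes v (cls c i))) => [i _|i j _ _ ij].
    exact: depends_some.
  by apply: spokes_disjoint => //; apply: cls_disjoint.
by apply: eq_bigr => i _; rewrite Pr_some card_spokes.
Qed.

Lemma depends_spokes_hit c v (W : {set 'I_n}) : (forall i, cls c i \subset W) ->
  depends (spokes v W) (fun f : bits => [forall i, [exists e in spokes v (cls c i), f e]]).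
Proof.
move=> cW; apply: (@depends_forall _ _ xpredT) => i _.
by apply: dependsS (@depends_some _ _) => //; apply: imsetS.
Qed.

End Events.

Lemma card_crossing n (c : {ffun 'I_n -> option 'I_3}) : (2 * #|crossing c| =
  \sum_i \sum_(j | j != i) #|cls c i| * #|cls c j|)%N.
Proof.
apply/eqP; rewrite -(eqr_nat rat) -{1}[crossing c]finset.setIid -card_crossingI.
have ov i a : overlap c c i a = if i == a then #|cls c i| else 0%N.
  rewrite /overlap; case: eqP => [->|ia]; first by rewrite finset.setIid.
  by apply/eqP; rewrite cards_eq0 setI_eq0 cls_disjoint //; apply/eqP.
rewrite /shared natr_sum; apply/eqP/eq_bigr => i _.
rewrite (bigD1 i) //= [X in _ + X]big1 ?addr0 => [|a ai]; last first.
  by rewrite ov eq_sym (negbTE ai) mul0r.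
rewrite ov eqxx /minor natr_sum mulr_sumr; apply: eq_bigr => j ji.
rewrite natrM; congr (_ * _).
rewrite (bigD1 j) //= [X in _ + X]big1 ?addr0 => [|b /andP[_ bj]]; last first.
  by rewrite ov eq_sym (negbTE bj).
by rewrite ov eqxx.
Qed.

(** * Probabilities of good events *)

Section EventBounds.
Variables (R : realFieldType) (p : R) (n : nat).
Hypothesis p01 : 0 < p < 1.
Notation bits := {ffun {set 'I_n} -> bool}.
Implicit Types (f : bits) (c : {ffun 'I_n -> option 'I_3}) (x : {ffun 'I_3 -> 'I_n}).
Local Notation q := (1 - p).

Let pw : 0 <= p <= 1. Proof. by case/andP: p01 => ? ?; rewrite !ltW. Qed.
Let p0 : 0 < p. Proof. by case/andP: p01. Qed.
Let q0 : 0 < q. Proof. by rewrite subr_gt0; case/andP: p01. Qed.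
Let q1 : q < 1. Proof. by rewrite gtrBl; case/andP: p01. Qed.

Definition free c : {set 'I_n} := [set v | c v == None].

Lemma card_free c : (#|free c| + \sum_i #|cls c i| = n)%N.
Proof.
rewrite -[RHS]card_ord -[RHS]sum1_card (bigID (mem (free c))) /= sum1_card; congr (_ + _)%N.
rewrite (partition_big (fun v => odflt ord0 (c v)) predT) //=; apply: eq_bigr => i _.
rewrite sum1dep_card; apply: eq_card => v; rewrite !inE.
by case: (c v).
Qed.

Lemma card_triangle x : (#|triangle x| <= 3)%N.
Proof.
pose i0 : 'I_3 := ord0.
pose i1 : 'I_3 := lift ord0 ord0.
pose i2 : 'I_3 := lift ord0 (lift ord0 ord0).
apply: (@leq_trans #|[set [set x i0; x i1]; [set x i0; x i2]; [set x i1; x i2]]|); last first.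
  by rewrite -!finset.setUA !cardsU1 cards1; do 2 case: (_ \notin _).
apply/subset_leq_card/fintype.subsetP => e.
rewrite !inE => /existsP[i /existsP[j /andP[ij /eqP ->]]].
case: (ord3P i) ij => ->; case: (ord3P j) => -> // _; rewrite ?eqxx ?orbT //;
 by rewrite finset.setUC eqxx ?orbT.
Qed.

(** A bit prescribed to be 1 has weight p <= 1 in place of q; at most [m] extra factors of [q]
    repair this. *)
Lemma bits_prod_le (U : {set {set 'I_n}}) (g : {set 'I_n} -> bool) m :
  (#|[set e in U | g e]| <= m)%N ->
  q ^+ m * \prod_(e in U) bit_weight p (g e) <= q ^+ #|U|.
Proof.
move=> gm; rewrite (bigID g) /=.
have q0' := ltW q0; have q1' := ltW q1.
have -> : #|U| = (#|[set e in U | g e]| + #|[set e in U | ~~ g e]|)%N.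
  by rewrite -(cardsID [set e | g e]); congr (_ + _)%N; apply: eq_card => e; rewrite !inE // andbC.
rewrite exprD mulrA; apply: ler_pM.
- apply: mulr_ge0; first exact: exprn_ge0.
  by apply: prodr_ge0 => e _; apply: bit_weight_ge0.
- by apply: prodr_ge0 => e _; apply: bit_weight_ge0.
- rewrite -[leRHS]mulr1; apply: ler_pM; rewrite ?exprn_ge0 //.
  + by apply: prodr_ge0 => e _; apply: bit_weight_ge0.
  + by apply: ler_wiXn2l.
  + apply: prodr_ile1 => e _; rewrite bit_weight_ge0 //=.
    by rewrite /bit_weight; case: (g e) => //; case/andP: pw.
- rewrite -prodr_const big_mkcond [leRHS]big_mkcond /=.
  rewrite le_eqVlt; apply/orP; left; apply/eqP; apply: eq_bigr => e _; rewrite inE.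
  by case: ifP => // /andP[_ /negbTE ->].
Qed.

Lemma bits_prod_ge (U : {set {set 'I_n}}) (g : {set 'I_n} -> bool) m :
  (#|[set e in U | g e]| <= m)%N ->
  p ^+ m * q ^+ #|U| <= \prod_(e in U) bit_weight p (g e).
Proof.
move=> gm; rewrite (bigID g) /=.
have q0' := ltW q0; have q1' := ltW q1.
have -> : #|U| = (#|[set e in U | g e]| + #|[set e in U | ~~ g e]|)%N.
  by rewrite -(cardsID [set e | g e]); congr (_ + _)%N; apply: eq_card => e; rewrite !inE // andbC.
rewrite exprD mulrA; apply: ler_pM; rewrite ?mulr_ge0 ?exprn_ge0 ?(ltW p0) //.
- rewrite -[leRHS]mulr1; apply: ler_pM; rewrite ?exprn_ge0 ?(ltW p0) ?exprn_ile1 //.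
  apply: (@le_trans _ _ (p ^+ #|[set e in U | g e]|)).
    by apply: ler_wiXn2l; rewrite ?(ltW p0) //; case/andP: pw.
  rewrite -prodr_const big_mkcond [leRHS]big_mkcond /=.
  rewrite le_eqVlt; apply/orP; left; apply/eqP; apply: eq_bigr => e _; rewrite inE.
  by case: ifP => // /andP[_ ->].
- rewrite -prodr_const big_mkcond [leRHS]big_mkcond /=.
  rewrite le_eqVlt; apply/orP; left; apply/eqP; apply: eq_bigr => e _; rewrite inE.
  by case: ifP => // /andP[_ /negbTE ->].
Qed.

Lemma crossing_disjoint_free c e : e \in crossing c -> [disjoint e & free c].
Proof.
rewrite inE => /existsP[u /existsP[v /andP[/and3P[cu cv _] /eqP ->]]].
rewrite disjoint_subset; apply/fintype.subsetP => w; rewrite !inE.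
by move=> /orP[]/eqP->.
Qed.

Lemma cls_disjoint_free c i : cls c i \subset ~: free c.
Proof. by apply/fintype.subsetP => v; rewrite !inE => /eqP ->. Qed.

Lemma Pr_good_eventE c x : rooted c x ->
  Pr p (good_event c x) = (\prod_(e in crossing c) bit_weight p (e \in triangle x)) *
    (\prod_i (1 - q ^+ #|cls c i|)) ^+ #|free c|.
Proof.
move=> rx; rewrite -prodr_const.
transitivity (Pr p (fun f : bits => [forall e in crossing c, f e == (e \in triangle x)] &&
   [forall v in free c, [forall i, [exists e in spokes v (cls c i), f e]]])).
  by apply: eq_Pr => f; rewrite /good_event rx /=; congr (_ && _); apply: eq_forallb => v; rewrite inE.
rewrite (@Pr_linked_dominated _ p _ _ _ _ (~: free c)
  (fun v f => [forall i, [exists e in spokes v (cls c i), f e]])).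
- by congr (_ * _); apply: eq_bigr => v; rewrite inE => /eqP cv; apply: Pr_spokes_hit.
- by rewrite disjoint_subset; apply/fintype.subsetP => v vf; rewrite inE finset.in_setC negbK.
- exact: crossing_disjoint_free.
- by move=> v _; apply: depends_spokes_hit => i; apply: cls_disjoint_free.
Qed.

Lemma miss_ge0 c : 0 <= \prod_i (1 - q ^+ #|cls c i|).
Proof. by apply: prodr_ge0 => i _; rewrite subr_ge0 exprn_ile1 // ltW. Qed.

Lemma Pr_good_event_le c x : rooted c x ->
  q ^+ 3 * Pr p (good_event c x) <=
  q ^+ #|crossing c| * (\prod_i (1 - q ^+ #|cls c i|)) ^+ #|free c|.
Proof.
move=> rx; rewrite Pr_good_eventE // mulrA; apply: ler_wpM2r.
  by apply: exprn_ge0; apply: miss_ge0.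
apply: bits_prod_le; apply: leq_trans (card_triangle x).
by apply/subset_leq_card/fintype.subsetP => e; rewrite inE => /andP[].
Qed.

Lemma Pr_good_event_ge c x : rooted c x ->
  p ^+ 3 * q ^+ #|crossing c| * (\prod_i (1 - q ^+ #|cls c i|)) ^+ #|free c| <=
  Pr p (good_event c x).
Proof.
move=> rx; rewrite Pr_good_eventE //; apply: ler_wpM2r.
  by apply: exprn_ge0; apply: miss_ge0.
apply: bits_prod_ge; apply: leq_trans (card_triangle x).
by apply/subset_leq_card/fintype.subsetP => e; rewrite inE => /andP[].
Qed.

(** Only vertices uncolored by both have to be dominated, which keeps the spokes apart from the
    prescribed pairs. Where the two prescriptions clash [g] follows [c], and the events cannot hold
    together. The exponent 6 counts the root pairs of both tuples. *)
Lemma Pr_pair_le c x c' x' (B : 'I_n -> pred bits) (V := free c :&: free c') :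
  (forall v, v \in V -> depends (spokes v (~: V)) (B v)) ->
  (forall f, good_event c x f -> good_event c' x' f -> [forall v in V, B v f]) ->
  q ^+ 6 * Pr p (fun f => good_event c x f && good_event c' x' f) <=
  q ^+ #|crossing c :|: crossing c'| * \prod_(v in V) Pr p (B v).
Proof.
move=> dB hB; pose U := crossing c :|: crossing c'.
pose g e := if e \in crossing c then e \in triangle x else e \in triangle x'.
apply: (@le_trans _ _ (q ^+ 6 * Pr p (fun f => [forall e in U, f e == g e] &&
    [forall v in V, B v f]))).
  apply: ler_wpM2l; first by rewrite exprn_ge0 // ltW.
  apply: Pr_le => // f /andP[A A']; rewrite hB // andbT.
  apply/forallP => e; apply/implyP; rewrite /g inE.
  case: ifP => [ec _|_ /= ec].
    by case/and3P: A => _ /forallP/(_ e) + _; rewrite ec.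
  by case/and3P: A' => _ /forallP/(_ e) + _; rewrite ec.
rewrite (@Pr_linked_dominated _ p _ _ _ _ (~: V) B) //.
- rewrite mulrA; apply: ler_wpM2r.
    by apply: prodr_ge0 => v _; apply: Pr_ge0.
  apply: bits_prod_le; apply: (@leq_trans #|triangle x :|: triangle x'|).
    apply/subset_leq_card/fintype.subsetP => e; rewrite inE => /andP[_].
    by rewrite /g finset.in_setU; case: ifP => _ ->; rewrite ?orbT.
  apply: leq_trans (_ : #|triangle x| + #|triangle x'| <= _)%N; first by rewrite cardsU leq_subr.
  exact: leq_add (card_triangle x) (card_triangle x').
- by rewrite disjoint_subset; apply/fintype.subsetP => v vf; rewrite inE finset.in_setC negbK.
- move=> e; rewrite inE => /orP[]/crossing_disjoint_free; apply: disjointWr.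
    exact: finset.subsetIl.
  exact: finset.subsetIr.
Qed.

Lemma cls_pair_subset c c' : (forall i, cls c i \subset ~: (free c :&: free c')) /\
  (forall i, cls c' i \subset ~: (free c :&: free c')).
Proof.
by split=> i; apply/fintype.subsetP => v; rewrite !inE => /eqP -> //; rewrite andbF.
Qed.

(** For nearly coinciding tuples domination by the first is almost the whole condition; that by the
    second is dropped. *)
Lemma Pr_pair_le_near c x c' x' :
  q ^+ 6 * Pr p (fun f => good_event c x f && good_event c' x' f) <=
  q ^+ #|crossing c :|: crossing c'| *
    (\prod_i (1 - q ^+ #|cls c i|)) ^+ #|free c :&: free c'|.
Proof.
have [cW cW'] := cls_pair_subset c c'.
apply: le_trans (@Pr_pair_le c x c' x'
  (fun v f => [forall i, [exists e in spokes v (cls c i), f e]]) _ _) _.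
- by move=> v vV; apply: depends_spokes_hit.
- move=> f /and3P[_ _ /forallP dc] _; apply/forallP => v; apply/implyP.
  by rewrite !inE => /andP[cv _]; have := dc v; rewrite cv.
- rewrite -[X in _ <= _ * X]prodr_const le_eqVlt; apply/orP; left; apply/eqP; congr (_ * _).
  apply: eq_bigr => v; rewrite !inE => /andP[/eqP cv _].
  exact: Pr_spokes_hit.
Qed.

Lemma card_clsU c c' i a :
  (#|cls c i :|: cls c' a| = #|cls c i| + #|cls c' a| - overlap c c' i a)%N.
Proof. by rewrite cardsU. Qed.

(** [Pr_hit_all] for the six sets at each vertex uncolored by both. The 12 ordered pairs of disjoint
    sets within one tuple give 6 q^(2k) after halving; an overlap r lowers the exponent of a mixed
    pair to 2 k - r. *)
Lemma Pr_pair_le_far c x c' x' k :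
  (forall i, #|cls c i| = k) -> (forall a, #|cls c' a| = k) ->
  q ^+ 6 * Pr p (fun f => good_event c x f && good_event c' x' f) <=
  q ^+ #|crossing c :|: crossing c'| *
    (1 - 6 * q ^+ k + 6 * q ^+ (2 * k)
     + \sum_i \sum_a q ^+ (2 * k - overlap c c' i a)) ^+ #|free c :&: free c'|.
Proof.
move=> kc kc'; have [cW cW'] := cls_pair_subset c c'.
pose Z (t : 'I_3 + 'I_3) : {set 'I_n} := match t with inl i => cls c i | inr a => cls c' a end.
apply: le_trans (@Pr_pair_le c x c' x'
  (fun v f => [forall t, [exists e in spokes v (Z t), f e]]) _ _) _.
- move=> v vV; apply: (@depends_forall _ _ xpredT) => -[i|i] _ /=;
    by apply: dependsS (@depends_some _ _) => //; apply: imsetS.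
- move=> f /and3P[_ _ /forallP dc] /and3P[_ _ /forallP dc']; apply/forallP => v; apply/implyP.
  rewrite !inE => /andP[cv cv']; have := dc v; have := dc' v; rewrite cv cv' /=.
  by move=> /forallP h' /forallP h; apply/forallP => -[i|i]; [exact: h|exact: h'].
apply: ler_wpM2l; first by rewrite exprn_ge0 // ltW.
rewrite -prodr_const; apply: ler_prod => v; rewrite !inE => /andP[/eqP cv /eqP cv'].
rewrite Pr_ge0 //=; apply: le_trans (Pr_hit_all pw _) _.
have vZ t : v \notin Z t by case: t => i; rewrite /Z inE ?cv ?cv'.
have cZ t : #|spokes v (Z t)| = k by rewrite card_spokes //; case: t => i; rewrite /Z ?kc ?kc'.
have cZU s t : #|spokes v (Z s) :|: spokes v (Z t)| = #|Z s :|: Z t|.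
  by rewrite spokesU card_spokes // finset.in_setU negb_or !vZ.
have dbl c1 i : (forall i, #|cls c1 i| = k) ->
    \sum_(j | j != i) q ^+ #|cls c1 i :|: cls c1 j| = 2 * q ^+ (2 * k).
  move=> kc1; rewrite (eq_bigr (fun => q ^+ (2 * k))) => [|j ji].
    rewrite sumr_const (_ : #|_| = 2%N) ?mulr_natl //.
    by rewrite -[RHS](congr1 predn (card_ord 3)) -(cardC1 i); apply: eq_card.
  by rewrite cardsU !kc1 (disjoint_setI0 (cls_disjoint c1 _)) 1?eq_sym // cards0 subn0 mul2n addnn.
have -> : \sum_t q ^+ #|spokes v (Z t)| = 6 * q ^+ k.
  under eq_bigr do rewrite cZ.
  by rewrite sumr_const card_sum !card_ord mulr_natl.
rewrite big_sumType.
have L i : \sum_(t | t != inl i) q ^+ #|spokes v (Z (inl i)) :|: spokes v (Z t)| =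
    2 * q ^+ (2 * k) + \sum_a q ^+ (2 * k - overlap c c' i a).
  rewrite big_sumType -(dbl c i kc); congr (_ + _).
    by apply: eq_big => j // _; rewrite cZU.
  by apply: eq_big => j // _; rewrite cZU /= card_clsU kc kc' mul2n addnn.
have L' a : \sum_(t | t != inr a) q ^+ #|spokes v (Z (inr a)) :|: spokes v (Z t)| =
    \sum_i q ^+ (2 * k - overlap c c' i a) + 2 * q ^+ (2 * k).
  rewrite big_sumType -(dbl c' a kc'); congr (_ + _).
    by apply: eq_big => j // _; rewrite cZU /= finset.setUC card_clsU kc kc' mul2n addnn.
  by apply: eq_big => j // _; rewrite cZU.
under eq_bigr do rewrite L.
under [X in _ + _ * (_ + X)]eq_bigr do rewrite L'.
rewrite !big_split /= !sumr_const !card_ord [X in _ * (_ + (X + _))]exchange_big /=.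
rewrite -[2 * _ *+ 3]mulr_natl; set A := q ^+ k; set B := q ^+ _; set S := \sum_i _.
lra.
Qed.

End EventBounds.

(** * Counting colorings *)

Section Counting.
Variable n : nat.
Implicit Types (c : {ffun 'I_n -> option 'I_3}) (x : {ffun 'I_3 -> 'I_n}).

Lemma coloring_eq c c' : (forall i, cls c i = cls c' i) -> c = c'.
Proof.
move=> E; apply/ffunP => v.
have H i : (c v == Some i) = (c' v == Some i) by move/setP/(_ v): (E i); rewrite !inE.
case cv: (c v) => [i|]; first by apply/esym/eqP; rewrite -H cv.
case cv': (c' v) => [i|] //.
by move: (H i); rewrite cv cv' eqxx.
Qed.

Lemma card_rooted c : #|[set x | rooted c x]| = (\prod_i #|cls c i|)%N.
Proof.
transitivity #|family (fun i => mem (cls c i))|; last by rewrite card_family foldrE big_image.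
by apply: eq_card => x; rewrite inE; apply: eq_forallb => i; rewrite !inE.
Qed.

Definition sized c (ks : 'I_3 -> nat) : bool := [forall i, #|cls c i| == ks i].

Let i0 : 'I_3 := ord0.
Let i1 : 'I_3 := lift ord0 ord0.
Let i2 : 'I_3 := lift ord0 (lift ord0 ord0).

Lemma card_sized (ks : 'I_3 -> nat) :
  #|[set c | sized c ks]| =
  ('C(n, ks i0) * ('C(n - ks i0, ks i1) * 'C(n - ks i0 - ks i1, ks i2)))%N.
Proof.
pose D := [set t : {set 'I_n} * {set 'I_n} * {set 'I_n} |
  [&& #|t.1.1| == ks i0, (t.1.2 \subset ~: t.1.1) && (#|t.1.2| == ks i1) &
   (t.2 \subset ~: (t.1.1 :|: t.1.2)) && (#|t.2| == ks i2)]].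
transitivity #|D|.
  rewrite -(@card_in_imset _ _ (fun c => (cls c i0, cls c i1, cls c i2))); last first.
    move=> c c' _ _ [E0 E1 E2]; apply: coloring_eq => i.
    by case: (ord3P i) => ->.
  apply: eq_card => -[[X1 X2] X3]; apply/imsetP/idP => [[c]|].
    rewrite inE => /forallP sc [-> -> ->]; rewrite inE /= !sc !andbT /=.
    rewrite finset.setCU finset.subsetI -!finset.disjoints_subset.
    by rewrite !cls_disjoint.
  rewrite inE /= => /and3P[k0 /andP[d12 k1] /andP[]].
  rewrite finset.setCU finset.subsetI => /andP[d13 d23] k2.
  rewrite -!finset.disjoints_subset in d12 d13 d23.
  rewrite disjoint_sym in d12; rewrite disjoint_sym in d13; rewrite disjoint_sym in d23.
  have [C0 C1 C2] := cls_coloring_of d12 d13 d23.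
  exists (coloring_of X1 X2 X3); last by rewrite C0 C1 C2.
  rewrite inE; apply/forallP => i.
  by case: (ord3P i) => ->; rewrite ?C0 ?C1 ?C2.
transitivity (\sum_(X1 : {set 'I_n} | #|X1| == ks i0)
    \sum_(X2 : {set 'I_n} | (X2 \subset ~: X1) && (#|X2| == ks i1))
      \sum_(X3 : {set 'I_n} | (X3 \subset ~: (X1 :|: X2)) && (#|X3| == ks i2)) 1)%N.
  rewrite pair_big_dep /= pair_big_dep /= -[LHS]sum1_card; apply: eq_bigl => t.
  by rewrite inE andbA.
rewrite (eq_bigr (fun => ('C(n - ks i0, ks i1) * 'C(n - ks i0 - ks i1, ks i2))%N)); last first.
  move=> X1 /eqP k0.
  rewrite (eq_bigr (fun => 'C(n - ks i0 - ks i1, ks i2))) => [|X2 /andP[sX /eqP k1]].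
    by rewrite sum_nat_const -[X in (X * _)%N]cardsE cards_draws cardsCs finset.setCK card_ord k0.
  rewrite sum1dep_card cards_draws cardsCs finset.setCK card_ord cardsU.
  rewrite -finset.disjoints_subset in sX; rewrite disjoint_sym in sX.
  by rewrite (disjoint_setI0 sX) cards0 subn0 subnDA k0 k1.
by rewrite sum_nat_const -[X in (X * _)%N]cardsE card_draws card_ord.
Qed.

Lemma ffactD (N a b : nat) : (N ^_ (a + b) = N ^_ a * (N - a) ^_ b)%N.
Proof.
elim: b => [|b IH]; first by rewrite addn0 ffactn0 muln1.
by rewrite addnS !ffactnSr IH subnDA mulnA.
Qed.

Lemma card_sized_ffact (ks : 'I_3 -> nat) :
  (#|[set c | sized c ks]| * \prod_i (ks i)`!)%N = (n ^_ (\sum_i ks i))%N.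
Proof.
rewrite card_sized !big_ord_recl !big_ord0 addn0 muln1 !ffactD -!bin_ffact.
by rewrite -/i0 -/i1 -/i2; ring.
Qed.

Lemma card_pairs (ks : 'I_3 -> nat) :
  #|[set t : {ffun 'I_n -> option 'I_3} * {ffun 'I_3 -> 'I_n} |
      sized t.1 ks && rooted t.1 t.2]| =
  (#|[set c | sized c ks]| * \prod_i ks i)%N.
Proof.
transitivity (\sum_(c | sized c ks) \sum_(x | rooted c x) 1)%N.
  by rewrite pair_big_dep /= sum1dep_card.
rewrite -[X in (X * _)%N]sum1_card big_distrl /=.
apply: eq_big => [c|c /forallP sc]; first by rewrite inE.
rewrite sum1dep_card card_rooted mul1n; apply: eq_bigr => i _.
exact/eqP.
Qed.

Definition opt_cls c (o : option 'I_3) : {set 'I_n} := [set v | c v == o].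

(* [c'] is determined by the pieces of its classes cut out by the classes of [c]. *)
Lemma card_overlap (c : {ffun 'I_n -> option 'I_3}) (r : option 'I_3 -> 'I_3 -> nat) :
  (#|[set c' | [forall o, forall a, #|opt_cls c o :&: cls c' a| == r o a]]| <=
   \prod_o \prod_a 'C(#|opt_cls c o|, r o a))%N.
Proof.
pose F (u : option 'I_3 * 'I_3) : pred {set 'I_n} :=
  fun X => (X \subset opt_cls c u.1) && (#|X| == r u.1 u.2).
pose h c' : {ffun option 'I_3 * 'I_3 -> {set 'I_n}} :=
  [ffun u => opt_cls c u.1 :&: cls c' u.2].
have hI : injective h.
  move=> c1 c2 E; apply: coloring_eq => a; apply/setP => v.
  move/ffunP/(_ (c v, a)): E; rewrite !ffunE /= => /setP/(_ v).
  by rewrite !inE eqxx.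
rewrite -(card_imset _ hI); apply: (@leq_trans #|family F|).
  apply/subset_leq_card/fintype.subsetP => g /imsetP[d dH E].
  move: dH; rewrite inE => /forallP H; apply/familyP => -[w a].
  rewrite E ffunE unfold_in /F /= finset.subsetIl; exact: (forallP (H w)).
rewrite card_family foldrE big_image /= pair_bigA /=.
rewrite leq_eqVlt; apply/orP; left; apply/eqP; apply: eq_bigr => -[w a] _ /=.
by rewrite -cards_draws; apply: eq_card => X; rewrite !inE.
Qed.

End Counting.

(** * Real estimates *)

Section RealBounds.
Local Open Scope classical_set_scope.
Local Open Scope ring_scope.
Variable R : realType.
Implicit Types (x y a : R) (m j : nat).

Lemma exprB1_le_expR x m : 0 <= x <= 1 -> (1 - x) ^+ m <= expR (- (m%:R * x)).
Proof.
move=> /andP[x0 x1]; rewrite -mulrN expRM_natl.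
apply: lerXn2r; rewrite ?nnegrE ?subr_ge0 ?expR_ge0 //.
exact: expR_ge1Dx.
Qed.

(** From 1 / (1 - x) = 1 + x / (1 - x) <= exp(x / (1 - x)), where x / (1 - x) <= x + 2 x^2 for x <=
    1 / 2. *)
Lemma expR_le_1B x : 0 <= x <= 2^-1 -> expR (- (x + 2 * x ^+ 2)) <= 1 - x.
Proof.
move=> /andP[x0 x2]; have x1 : 0 < 1 - x by lra.
rewrite expRN -[leRHS]invrK lef_pV2 ?posrE ?invr_gt0 ?expR_gt0 //.
apply: le_trans (_ : 1 + x / (1 - x) <= _).
  by rewrite le_eqVlt; apply/orP; left; apply/eqP; field; rewrite gt_eqF.
apply: le_trans (expR_ge1Dx _) _; rewrite ler_expR ler_pdivrMr //; nra.
Qed.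

Lemma bernoulli_ineq x m : 0 <= x <= 1 -> 1 - m%:R * x <= (1 - x) ^+ m.
Proof.
move=> /andP[x0 x1]; elim: m => [|m IH]; first by rewrite mul0r subr0 expr0.
rewrite exprS -natr1.
have : (1 - x) * (1 - m%:R * x) <= (1 - x) * (1 - x) ^+ m by apply: ler_wpM2l => //; lra.
have : 0 <= m%:R * x * x by rewrite !mulr_ge0.
nra.
Qed.

Lemma fact_ge_expR j : j%:R ^+ j <= expR j%:R * j`!%:R :> R.
Proof.
case: j => [|j]; first by rewrite expr0 expR0 mul1r.
have := @expR_ge1Dxn R j.+1%:R j (ler0n _ _).
rewrite -ler_pdivrMr ?ltr0n ?fact_gt0 //; lra.
Qed.

(** A weak Stirling bound by induction, whose step is (1 - 1 / (j + 2))^(j + 2) <= 1 / e. The extra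
    factor [j] over (j / e)^j is affordable: cubed, it is paid by the k^3 choices of the roots. *)
Lemma fact_le_expR j : (0 < j)%N -> j`!%:R * expR j%:R <= expR 1 * j%:R ^+ j.+1 :> R.
Proof.
case: j => // j _; elim: j => [|j IH].
  by rewrite expr1n mul1r mulr1.
have -> : expR j.+2%:R = expR 1 * expR j.+1%:R :> R by rewrite -expRD -natr1 addrC.
rewrite factS natrM.
have H : j.+1%:R ^+ j.+2 * expR 1 <= j.+2%:R ^+ j.+2 :> R.
  have h2 : 0 < j.+2%:R :> R by rewrite ltr0n.
  have : (1 - j.+2%:R^-1) ^+ j.+2 <= expR (- (j.+2%:R * j.+2%:R^-1)) :> R.
    by apply: exprB1_le_expR; rewrite invr_ge0 ler0n /= invf_le1 // ler1n.
  rewrite mulfV ?gt_eqF // expRN => h.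
  have E : 1 - j.+2%:R^-1 = j.+1%:R / j.+2%:R :> R.
    by rewrite -[j.+1%:R](addrK 1) natr1 mulrBl mul1r mulfV ?gt_eqF.
  rewrite E expr_div_n in h.
  by move: h; rewrite ler_pdivrMr ?exprn_gt0 // ler_pdivlMl ?expR_gt0 // mulrC.
rewrite [in leRHS]exprS.
have e1 : 0 <= expR 1 :> R by exact: expR_ge0.
have h2 : 0 <= j.+2%:R :> R by [].
have a1 := ler_wpM2l h2 (ler_wpM2l e1 IH).
have a2 := ler_wpM2l h2 (ler_wpM2l e1 H).
apply: le_trans (_ : j.+2%:R * (expR 1 * (j.+1`!%:R * expR j.+1%:R)) <= _).
  by rewrite le_eqVlt; apply/orP; left; apply/eqP; ring.
apply: le_trans a1 _; apply: le_trans (_ : j.+2%:R * (expR 1 * (j.+1%:R ^+ j.+2 * expR 1)) <= _).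
  by rewrite le_eqVlt; apply/orP; left; apply/eqP; ring.
apply: le_trans a2 _.
by rewrite le_eqVlt; apply/orP; left; apply/eqP; ring.
Qed.

(** With [a] = exp(- s), the Taylor term of order j + 1 of exp(k s) leaves one spare factor k, which
    eventually exceeds [C / e]. *)
Lemma poly_exp_small j a e : 0 < a < 1 -> 0 < e ->
  \forall k \near \oo, k%:R ^+ j * a ^+ k <= e.
Proof.
move=> /andP[a0 a1] e0; pose s := - ln a.
have s0 : 0 < s by rewrite oppr_gt0 ln_lt0 ?a0.
have aE : a = expR (- s) by rewrite opprK lnK.
pose C : R := j.+1`!%:R / s ^+ j.+1.
have C0 : 0 < C by rewrite divr_gt0 ?exprn_gt0 ?ltr0n ?fact_gt0.
near=> k.
have k0 : 0 < k%:R :> R by rewrite ltr0n; near: k; exists 1%N.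
have kC : C / e <= k%:R.
  near: k; exists (Num.truncn (C / e)).+1 => // k /= hk.
  by rewrite ltW //; apply: lt_le_trans (truncnS_gt _) _; rewrite ler_nat.
have h : (k%:R * s) ^+ j.+1 / j.+1`!%:R <= expR (k%:R * s).
  by have := @expR_ge1Dxn R (k%:R * s) j (mulr_ge0 (ltW k0) (ltW s0)); lra.
have -> : a ^+ k = (expR (k%:R * s))^-1 by rewrite aE -expRM_natl mulrN expRN.
rewrite ler_pdivrMr ?expR_gt0 //.
apply: le_trans (ler_wpM2l (ltW e0) h).
have -> : e * ((k%:R * s) ^+ j.+1 / j.+1`!%:R) = (e * k%:R / C) * k%:R ^+ j.
  rewrite /C exprMn [k%:R ^+ j.+1]exprS; field.
  by rewrite gt_eqF ?exprn_gt0 //= pnatr_eq0 -lt0n fact_gt0.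
apply: ler_peMl; first by rewrite exprn_ge0 // ltW.
by rewrite ler_pdivlMr // mul1r mulrC -ler_pdivrMr.
Unshelve. all: by end_near. Qed.

Lemma poly_exp_smallC C j a e : 0 < a < 1 -> 0 < e ->
  \forall k \near \oo, C * (k%:R ^+ j * a ^+ k) <= e.
Proof.
move=> a01 e0; have /andP[a0 _] := a01; have C1 : 0 < `|C| + 1 by rewrite ltr_wpDl.
near=> k.
have h : k%:R ^+ j * a ^+ k <= e / (`|C| + 1).
  by near: k; apply: poly_exp_small => //; rewrite divr_gt0.
have h0 : 0 <= k%:R ^+ j * a ^+ k by rewrite mulr_ge0 ?exprn_ge0 // ltW.
apply: le_trans (_ : (`|C| + 1) * (k%:R ^+ j * a ^+ k) <= _).
  by apply: ler_wpM2r => //; have := ler_norm C; lra.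
by rewrite mulrC -ler_pdivlMr.
Unshelve. all: by end_near. Qed.

End RealBounds.

(** * Second moment *)

Section NatBounds.
Local Open Scope nat_scope.

Lemma ffact_le_exp m j : m ^_ j <= m ^ j.
Proof.
elim: j => [|j IH]; first by rewrite ffactn0 expn0.
by rewrite ffactnSr expnSr leq_mul // leq_subr.
Qed.

Lemma ffact_ge_exp m j : (m - j) ^ j <= m ^_ j.
Proof.
suff H i : i <= j -> (m - j) ^ i <= m ^_ i by exact: H.
elim: i => [|i IH] ij; first by rewrite ffactn0 expn0.
by rewrite ffactnSr expnSr leq_mul ?IH ?leq_sub2l // ltnW.
Qed.

Lemma bin_le_exp m j : 'C(m, j) <= m ^ j.
Proof.
apply: leq_trans (ffact_le_exp m j).
by rewrite -bin_ffact leq_pmulr ?fact_gt0.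
Qed.

Lemma bin_le_expC k j : j <= k -> 'C(k, j) <= k ^ (k - j).
Proof. by move=> jk; rewrite -bin_sub // bin_le_exp. Qed.

Lemma fact_le_sub k s : s <= k -> k`! <= (k - s)`! * k ^ s.
Proof.
move=> sk; rewrite -(ffact_fact sk) mulnC leq_mul2l ffact_le_exp orbT //.
Qed.

Variables (k n : nat) (r : 'I_3 -> 'I_3 -> nat).
Let s a := \sum_i r i a.
Let tot := \sum_i \sum_a r i a.
Hypothesis r_col : forall a, s a <= k.

Let r_le i a : r i a <= k.
Proof. by apply: leq_trans (r_col a); rewrite /s (bigD1 i) //= leq_addr. Qed.

Let sum_s : \sum_a s a = tot.
Proof. by rewrite /s exchange_big. Qed.

Let k3 : 3 * k = \sum_(i < 3) k. Proof. by rewrite sum_nat_const card_ord. Qed.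

Let sum_sub : \sum_a (k - s a) = 3 * k - tot.
Proof.
rewrite sumnB // sum_s sum_nat_const card_ord //.
Qed.

(** Without k!^3, the left side bounds the number of colorings with overlap [r] to a fixed one.
    Relative to about n^(3k) / k!^3 colorings in all, each common vertex costs a factor k^2 / n: one
    [k] from the binomial coefficients, one from k! <= (k - s)! k^s. *)
Lemma count_far :
  (\prod_i \prod_a 'C(k, r i a)) * (\prod_a 'C(n, k - s a)) * k`! ^ 3 <=
  k ^ (2 * tot) * n ^ (3 * k - tot).
Proof.
rewrite -mulnA mul2n -addnn expnD -mulnA.
apply: leq_mul.
  rewrite /tot expn_sum; apply: leq_prod => i _.
  by rewrite expn_sum; apply: leq_prod => a _; apply: bin_le_exp.
have -> : k`! ^ 3 = \prod_(a < 3) k`! by rewrite prod_nat_const card_ord.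
rewrite -sum_sub -sum_s !expn_sum -!big_split /=.
apply: leq_prod => a _.
apply: leq_trans (leq_mul (leqnn _) (fact_le_sub (r_col a))) _.
by rewrite mulnA bin_ffact mulnC leq_mul2l ffact_le_exp orbT.
Qed.

(** Near [k] times a permutation matrix the missing vertices are chosen instead: C(k, r) <= k^(k -
    r) along [t] and C(k, r) <= k^r off it, where the exponents of either kind sum to at most
    [d]. *)
Lemma count_near (t : {perm 'I_3}) (d := 3 * k - \sum_i r i (t i)) : 0 < k ->
  (\prod_i \prod_a 'C(k, r i a)) * (\prod_a 'C(n, k - s a)) <=
  k ^ (2 * d) * n ^ (3 * k - tot).
Proof.
move=> k0; apply: leq_mul.
  have -> : \prod_i \prod_a 'C(k, r i a) =
      (\prod_i 'C(k, r i (t i))) * \prod_i \prod_(a | a != t i) 'C(k, r i a).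
    by rewrite -big_split /=; apply: eq_bigr => i _; rewrite (bigD1 (t i)).
  rewrite mul2n -addnn expnD; apply: leq_mul.
    rewrite /d k3 -sumnB // expn_sum.
    by apply: leq_prod => i _; apply: bin_le_expC.
  apply: (@leq_trans (k ^ (\sum_i \sum_(a | a != t i) r i a))).
    rewrite expn_sum; apply: leq_prod => i _; rewrite expn_sum.
    by apply: leq_prod => a _; apply: bin_le_exp.
  rewrite leq_pexp2l //.
  have : tot <= 3 * k.
    by rewrite -sum_s k3; apply: leq_sum.
  have -> : tot = \sum_i r i (t i) + \sum_i \sum_(a | a != t i) r i a.
    by rewrite -big_split /=; apply: eq_bigr => i _; rewrite (bigD1 (t i)).
  rewrite /d; lia.
rewrite -sum_sub expn_sum; apply: leq_prod => a _; exact: bin_le_exp.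
Qed.

End NatBounds.

(** * Estimates in the regime where n q^k lies within q^k of k *)

Section SecondMomentNumerics.
Variables (R : realType) (q u : R) (k n : nat).
Hypotheses (q01 : 0 < q < 1) (k0 : (0 < k)%N).
Hypothesis (nqk_le : n%:R * q ^+ k <= k%:R).
Hypothesis (nqk_ge : k%:R - q ^+ k <= n%:R * q ^+ k).
Hypothesis (kqk : 108 * (k%:R * q ^+ k) <= 1).
Hypotheses (u0 : 0 < u) (u2 : u ^+ 2 = q) (kuk : 9 * (k%:R * u ^+ k) <= 1).

Let x : R := q ^+ k.
Let q0 : 0 < q. Proof. by case/andP: q01. Qed.
Let q1 : q <= 1. Proof. by case/andP: q01 => _ /ltW. Qed.
Let x0 : 0 < x. Proof. exact: exprn_gt0. Qed.
Let k1 : 1 <= k%:R :> R. Proof. by rewrite ler1n. Qed.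
Let xk : x <= k%:R * x. Proof. exact: ler_peMl (ltW x0) k1. Qed.
Let x108 : 108 * x <= 1. Proof. by have := xk; move: kqk; rewrite -/x; lra. Qed.
Let k2 : k%:R <= 2 * (n%:R * x).
Proof. by move: nqk_ge x108 k1; rewrite -/x; lra. Qed.

Let n_gt0 : 0 < n%:R :> R.
Proof.
have h : 0 < n%:R * x by move: k1 k2; lra.
by rewrite pmulr_lgt0 in h.
Qed.

Let inv_n_le : n%:R^-1 <= 2 * x / k%:R.
Proof.
rewrite ler_pdivlMr ?ltr0n // mulrC ler_pdivrMr ?n_gt0 //.
by have := k2; lra.
Qed.

Let n_ge : 18 * k%:R ^+ 2 <= n%:R :> R.
Proof.
have h : k%:R * (36 * (k%:R * x)) <= k%:R * 1.
  by apply: ler_wpM2l => //; move: kqk; rewrite -/x; have := xk; have := x0; lra.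
rewrite -(ler_pM2r x0); have := k2; rewrite expr2; lra.
Qed.

Let le_3kn : (3 * k <= n)%N.
Proof.
rewrite -(ler_nat R) natrM; have := n_ge; have := k1; rewrite expr2; nra.
Qed.

(** By [expR_le_1B] the exponent is at most 6 n (x + 2 x^2), where n x <= k and 12 n x^2 <= 12 k x
    <= 1. *)
Lemma miss_lower j : (j <= n)%N -> expR (- (6 * k%:R + 1)) <= (1 - x) ^+ (6 * j).
Proof.
move=> jn.
have h : expR (- (x + 2 * x ^+ 2)) <= 1 - x.
  by apply: expR_le_1B; rewrite ltW //=; have := x108; lra.
apply: le_trans (_ : expR (- (x + 2 * x ^+ 2)) ^+ (6 * j) <= _); last first.
  by apply: lerXn2r; rewrite ?nnegrE ?expR_ge0 // subr_ge0; have := x108; lra.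
rewrite -expRM_natl ler_expR mulrN lerN2 natrM.
have y0 : 0 <= x + 2 * x ^+ 2 by rewrite expr2; have := x0; nra.
apply: le_trans (_ : 6 * n%:R * (x + 2 * x ^+ 2) <= _).
  by rewrite ler_wpM2r // ler_wpM2l // ler_nat.
have : n%:R * x * x <= k%:R * x by apply: ler_wpM2r; [exact: ltW|exact: nqk_le].
by rewrite expr2; move: kqk nqk_le; rewrite -/x; lra.
Qed.

(** The right exponent exceeds the left one by at most 9 k, and (1 - x)^(9k) >= 1 - 9 k x >= 1 /
    2. *)
Lemma miss_near V : (n - 6 * k <= V)%N ->
  (1 - x) ^+ (3 * V) <= 2 * (1 - x) ^+ (3 * (n - 3 * k)).
Proof.
move=> hV; have x1 : 0 <= 1 - x by have := x108; have := x0; lra.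
have h : (1 - x) ^+ (3 * V) * (1 - x) ^+ (9 * k) <= (1 - x) ^+ (3 * (n - 3 * k)).
  rewrite -exprD; apply: ler_wiXn2l => //; first by have := x0; lra.
  by move: le_3kn hV; clear; lia.
have b : 1 - (9 * k)%:R * x <= (1 - x) ^+ (9 * k).
  by apply: bernoulli_ineq; have := x108; have := x0; lra.
have b2 : 2^-1 <= (1 - x) ^+ (9 * k).
  by apply: le_trans b; rewrite natrM; move: kqk; rewrite -/x; have := x0; lra.
have := ler_wpM2l (exprn_ge0 (3 * V) x1) b2.
lra.
Qed.

(** By 1 + y <= exp y only n times the overlap sum has to be bounded; it produces the factor exp(2
    tot). The constant 4 collects the bounded errors, such as those of replacing [V] by [n] and n x
    by k. *)
Lemma miss_far V (r : 'I_3 -> 'I_3 -> nat) (tot := (\sum_i \sum_a r i a)%N) :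
  (V <= n)%N -> (n - 6 * k <= V)%N -> (forall i a, (r i a <= k)%N) ->
  (1 - 6 * x + 6 * q ^+ (2 * k) + \sum_i \sum_a q ^+ (2 * k - r i a)) ^+ V <=
  expR 4 * expR 2 ^+ tot * (1 - x) ^+ (6 * (n - 3 * k)).
Proof.
move=> Vn nV rk.
have q2k : q ^+ (2 * k) = x ^+ 2 by rewrite mulnC exprM.
rewrite q2k; set S := \sum_i \sum_a q ^+ _.
have S0 : 0 <= S by do 2 (apply: sumr_ge0 => ? _); rewrite exprn_ge0 // ltW.
have nS : n%:R * S <= 1 + 2 * tot%:R.
  (* The left side is at most k q^(k - r). If 2 r <= k this is at most k u^k <= 1 / 9, and nine such
     terms add up to 1; otherwise it is at most k <= 2 r. *)
  have h i a : n%:R * q ^+ (2 * k - r i a) <= 9^-1 + 2 * (r i a)%:R.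
    have -> : (2 * k - r i a = k + (k - r i a))%N by move: (rk i a); clear; lia.
    rewrite exprD mulrA.
    apply: le_trans (_ : k%:R * q ^+ (k - r i a) <= _).
      by apply: ler_wpM2r => //; rewrite exprn_ge0 // ltW.
    have [rk2|rk2] := leqP (2 * r i a) k.
      have : q ^+ (k - r i a) <= u ^+ k.
        rewrite -u2 -exprM; apply: ler_wiXn2l; first exact: ltW.
          by rewrite -(@expr_le1 _ 2) ?u2 // ltW.
        by move: rk2; clear; lia.
      have := @ler_wpM2l _ k%:R (ler0n _ _) (q ^+ (k - r i a)) (u ^+ k).
      move=> /[apply]; have : 0 <= (r i a)%:R :> R by []. 
      by move: kuk; lra.
    have : q ^+ (k - r i a) <= 1 by apply: exprn_ile1 => //; exact: ltW.
    have := @ler_wpM2l _ k%:R (ler0n _ _) (q ^+ (k - r i a)) 1.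
    move=> /[apply]; rewrite mulr1.
    have : k%:R <= 2 * (r i a)%:R :> R by rewrite -natrM ler_nat ltnW.
    lra.
  rewrite mulr_sumr.
  apply: le_trans (_ : \sum_(i < 3) \sum_(a < 3) (9^-1 + 2 * (r i a)%:R) <= _).
    by apply: ler_sum => i _; rewrite mulr_sumr; apply: ler_sum => a _.
  rewrite /tot natr_sum mulr_sumr.
  under eq_bigr do rewrite big_split /= sumr_const card_ord -mulr_sumr -natr_sum.
  rewrite big_split /= sumr_const card_ord -mulr_sumr.
  have -> : 9^-1 *+ 3 *+ 3 = 1 :> R by rewrite -mulrnA -[_ *+ (3 * 3)]mulr_natr mulVf.
  by [].
set y := - (6 * x) + 6 * x ^+ 2 + S.
have -> : 1 - 6 * x + 6 * x ^+ 2 + S = 1 + y by rewrite /y; ring.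
have y1 : 0 <= 1 + y.
  by rewrite /y; have : 0 <= x ^+ 2 by [rewrite exprn_ge0 // ltW]; move: S0 x108; lra.
apply: le_trans (_ : expR y ^+ V <= _).
  by apply: lerXn2r; rewrite ?nnegrE ?expR_ge0 // expR_ge1Dx.
apply: le_trans (_ : expR (4 + 2 * tot%:R) * expR (- (6 * k%:R + 1)) <= _); last first.
  rewrite expRD mulrC [2 * _]mulrC expRM_natl mulrC.
  by apply: ler_wpM2l; [rewrite mulr_ge0 ?exprn_ge0 ?expR_ge0|apply: miss_lower; rewrite leq_subr].
rewrite -expRD -expRM_natl ler_expR /y.
have V1 : V%:R <= n%:R :> R by rewrite ler_nat.
have V2 : n%:R - 6 * k%:R <= V%:R :> R.
  by rewrite lerBlDr -natrM -natrD ler_nat; move: nV; clear; lia.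
have a1 : (n%:R - 6 * k%:R) * x <= V%:R * x by rewrite ler_wpM2r // ltW.
have a2 : V%:R * (x * x) <= n%:R * (x * x) by rewrite ler_wpM2r // mulr_ge0 // ltW.
have a3 : V%:R * S <= n%:R * S by rewrite ler_wpM2r.
have a4 : n%:R * x * x <= k%:R * x by rewrite ler_wpM2r // ltW.
move: kqk nqk_ge; rewrite -/x expr2 => b1 b2.
have b3 := xk; lra.
Qed.

Variable w : R.
Hypotheses (w0 : 0 < w) (w36 : w ^+ 36 = q).

Let w1 : w <= 1.
Proof. by rewrite -(@expr_le1 _ 36) ?w36 // ltW. Qed.

(* The probability of a good event with classes of size [k], up to constants. *)
Definition event_scale : R := q ^+ (3 * k ^ 2) * (1 - x) ^+ (3 * (n - 3 * k)).
Local Notation pi := event_scale.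

Let x1 : 0 <= 1 - x. Proof. by have := x108; have := x0; lra. Qed.

Lemma event_scale_ge0 : 0 <= pi.
Proof. by rewrite mulr_ge0 ?exprn_ge0 // ltW. Qed.

(** The saving k tot - S is at least k d / 36, which is why [w] is a 36th root of [q]. *)
Lemma q_le_w tot S d : (S <= k * tot)%N -> (36 * S + k * d <= 36 * (k * tot))%N ->
  q ^+ (k * tot - S) <= (w ^+ k) ^+ d.
Proof.
move=> hS hd; rewrite -w36 -!exprM; apply: ler_wiXn2l; rewrite ?(ltW w0) //.
by move: hS hd; clear; lia.
Qed.

(** The falling factorial is at least (n - 3 k)^(3k), and by Bernoulli its ratio to n^(3k) is at
    least 1 - 9 k^2 / n >= 1 / 2, as n >= 18 k^2. *)
Lemma coloring_count_lower N : (N * k`! ^ 3 = n ^_ (3 * k))%N ->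
  n%:R ^+ (3 * k) <= 2 * (N%:R * k`!%:R ^+ 3) :> R.
Proof.
move=> hN; rewrite -natrX -[k`!%:R ^+ 3]natrX -natrM hN.
apply: le_trans (_ : 2 * ((n - 3 * k) ^ (3 * k))%:R <= _); last first.
  by rewrite ler_pM2l // ler_nat ffact_ge_exp.
rewrite !natrX natrB ?le_3kn // natrM.
have n0 := n_gt0; have n18 := n_ge.
have -> : n%:R - 3 * k%:R = n%:R * (1 - 3 * k%:R / n%:R) :> R by field; rewrite gt_eqF.
rewrite exprMn mulrCA; apply: ler_peMr; first by rewrite exprn_ge0 // ltW.
have b : 1 - (3 * k)%:R * (3 * k%:R / n%:R) <= (1 - 3 * k%:R / n%:R) ^+ (3 * k) :> R.
  apply: bernoulli_ineq; rewrite divr_ge0 ?mulr_ge0 // ler_pdivrMr // mul1r.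
  by rewrite -natrM ler_nat le_3kn.
have : (3 * k)%:R * (3 * k%:R / n%:R) <= 2^-1 :> R.
  by rewrite mulrA ler_pdivrMr // natrM; move: n18; rewrite expr2; lra.
lra.
Qed.

(** Here [h] tuples share one overlap matrix with a fixed tuple. Up to a constant their proportion
    is at most (2 k x)^tot, as k^2 / n <= 2 k x; the [S] common pairs give back q^(-S) and
    domination gives back exp(2 tot). Decisive is x^tot q^(-S) = q^(k tot - S) <= w^(k tot). *)
Lemma far_total N h P U S V (r : 'I_3 -> 'I_3 -> nat) (X : R)
    (tot := (\sum_i \sum_a r i a)%N) :
  (N * k`! ^ 3 = n ^_ (3 * k))%N ->
  (h <= k ^ 3 * P)%N -> (P * k`! ^ 3 <= k ^ (2 * tot) * n ^ (3 * k - tot))%N ->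
  (tot <= 3 * k)%N -> (36 * S + k * tot <= 36 * (k * tot))%N ->
  (U + S = 6 * k ^ 2)%N ->
  (V <= n)%N -> (n - 6 * k <= V)%N -> (forall i a, (r i a <= k)%N) -> 0 <= X ->
  q ^+ 6 * X <= q ^+ U *
    (1 - 6 * x + 6 * q ^+ (2 * k) + \sum_i \sum_a q ^+ (2 * k - r i a)) ^+ V ->
  h%:R * X <= 2 * expR 4 * q ^- 6 * ((N * k ^ 3)%:R * pi ^+ 2) *
      (2 * expR 2 * (k%:R * w ^+ k)) ^+ tot.
Proof.
move=> hN hh hP htot hS hU Vn nV rk X0 hX.
have n0 := n_gt0; have f0 : 0 < k`!%:R ^+ 3 :> R by rewrite exprn_gt0 // ltr0n fact_gt0.
have hS' : (S <= k * tot)%N by move: hS; clear; lia.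
have kp : 0 < k%:R :> R by rewrite ltr0n.
have Hh : h%:R <= 2 * (N * k ^ 3)%:R * (2 * (k%:R * x)) ^+ tot.
  apply: le_trans (_ : k%:R ^+ 3 * P%:R <= _); first by rewrite -natrX -natrM ler_nat.
  rewrite -(ler_pM2r f0) -[X in X <= _]mulrA.
  have k30 : 0 <= k%:R ^+ 3 :> R by rewrite exprn_ge0.
  have hP' : P%:R * k`!%:R ^+ 3 <= k%:R ^+ (2 * tot) * n%:R ^+ (3 * k - tot) :> R.
    by rewrite -!natrX -!natrM ler_nat.
  apply: le_trans (ler_wpM2l k30 hP') _.
  have -> : n%:R ^+ (3 * k - tot) = n%:R ^+ (3 * k) * n%:R^-1 ^+ tot :> R.
    by rewrite exprVn -expfB_cond // gt_eqF.
  apply: le_trans (_ : k%:R ^+ 3 * (k%:R ^+ (2 * tot) *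
     ((2 * (N%:R * k`!%:R ^+ 3)) * (2 * x / k%:R) ^+ tot)) <= _).
    do 2 (apply: ler_wpM2l; first by rewrite exprn_ge0).
    apply: ler_pM; rewrite ?exprn_ge0 ?invr_ge0 ?ler0n //; first exact: coloring_count_lower.
    by apply: lerXn2r; rewrite ?nnegrE ?invr_ge0 ?divr_ge0 ?mulr_ge0 ?ler0n ?(ltW x0) // inv_n_le.
  have E : k%:R ^+ (2 * tot) * (2 * x / k%:R) ^+ tot = (2 * (k%:R * x)) ^+ tot.
    rewrite exprM -exprMn; congr (_ ^+ _); field; exact: lt0r_neq0.
  rewrite -E natrM natrX le_eqVlt; apply/orP; left; apply/eqP; ring.
have HX : X <= q ^- 6 * (q ^+ U * (expR 4 * expR 2 ^+ tot * (1 - x) ^+ (6 * (n - 3 * k)))).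
  rewrite ler_pdivlMl ?exprn_gt0 //; apply: le_trans hX _.
  by apply: ler_wpM2l; [rewrite exprn_ge0 // ltW|apply: miss_far].
apply: le_trans (ler_pM (ler0n _ _) X0 Hh HX) _.
have pi2 : pi ^+ 2 = q ^+ (U + S) * (1 - x) ^+ (6 * (n - 3 * k)).
  rewrite /pi exprMn -!exprM hU; congr (_ ^+ _ * _ ^+ _); ring.
have Hw := q_le_w hS' hS.
have E2 : x ^+ tot = q ^+ (k * tot - S) * q ^+ S by rewrite -exprD subnK // exprM.
apply: le_trans (_ : 2 * expR 4 * q ^- 6 * ((N * k ^ 3)%:R * pi ^+ 2) *
   ((2 * expR 2 * k%:R) ^+ tot * q ^+ (k * tot - S)) <= _).
  rewrite pi2 exprD !exprMn E2 le_eqVlt; apply/orP; left; apply/eqP; ring.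
rewrite [2 * expR 2 * (_ * _)]mulrA [(_ * w ^+ k) ^+ tot]exprMn.
apply: ler_wpM2l.
  by rewrite !mulr_ge0 ?expR_ge0 ?exprn_ge0 ?invr_ge0 ?ler0n ?event_scale_ge0 ?exprn_ge0 // ltW.
by apply: ler_wpM2l => //; rewrite exprn_ge0 ?mulr_ge0 ?expR_ge0.
Qed.

(** [q ^+ U] splits into q^(3 k^2), the weight of one tuple, x^(3k - tot), which cancels n^(3k -
    tot) up to k^d, and the saving q^(k tot - S) <= w^(k d). Together with the count k^(2d) this is
    the [d]-th power of k^3 w^k. *)
Lemma near_total h P U S V tot d (X : R) :
  (h <= k ^ 3 * P)%N -> (P <= k ^ (2 * d) * n ^ (3 * k - tot))%N ->
  (tot <= 3 * k)%N -> (3 * k - tot <= d)%N ->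
  (36 * S + k * d <= 36 * (k * tot))%N ->
  (U + S = 6 * k ^ 2)%N ->
  (n - 6 * k <= V)%N -> 0 <= X ->
  q ^+ 6 * X <= q ^+ U * (1 - x) ^+ (3 * V) ->
  h%:R * X <= 2 * q ^- 6 * pi * (k%:R ^+ 3 * (k%:R ^+ 3 * w ^+ k) ^+ d).
Proof.
move=> hh hP htot hd hS hU nV X0 hX.
have hS' : (S <= k * tot)%N by move: hS; clear; lia.
have kp : 0 < k%:R :> R by rewrite ltr0n.
have Hw := q_le_w hS' hS.
have Hh : h%:R <= k%:R ^+ 3 * (k%:R ^+ (2 * d) * n%:R ^+ (3 * k - tot)) :> R.
  by rewrite -!natrX -!natrM ler_nat; apply: leq_trans hh _; rewrite leq_mul2l hP orbT.
have HX : X <= q ^- 6 * (q ^+ U * (2 * (1 - x) ^+ (3 * (n - 3 * k)))).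
  rewrite ler_pdivlMl ?exprn_gt0 //; apply: le_trans hX _.
  by apply: ler_wpM2l; [rewrite exprn_ge0 // ltW|apply: miss_near].
apply: le_trans (ler_pM (ler0n _ _) X0 Hh HX) _.
have EU : q ^+ U = q ^+ (3 * k ^ 2) * (x ^+ (3 * k - tot) * q ^+ (k * tot - S)).
  rewrite -exprM -!exprD; congr (_ ^+ _).
  have : (k * (3 * k - tot) = 3 * k ^ 2 - k * tot)%N by rewrite mulnBr; congr (_ - _)%N; ring.
  have : (k * tot <= 3 * k ^ 2)%N by rewrite -mulnn mulnCA leq_mul2l htot orbT.
  move: hU hS'; clear; lia.
have nx : n%:R ^+ (3 * k - tot) * x ^+ (3 * k - tot) <= k%:R ^+ d.
  rewrite -exprMn; apply: le_trans (_ : k%:R ^+ (3 * k - tot) <= _).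
    by apply: lerXn2r; rewrite ?nnegrE ?mulr_ge0 // ltW.
  exact: ler_weXn2l.
rewrite EU /pi.
apply: le_trans (_ : 2 * q ^- 6 * (q ^+ (3 * k ^ 2) * (1 - x) ^+ (3 * (n - 3 * k))) *
  (k%:R ^+ 3 * (k%:R ^+ (2 * d) *
   ((n%:R ^+ (3 * k - tot) * x ^+ (3 * k - tot)) * q ^+ (k * tot - S)))) <= _).
  rewrite le_eqVlt; apply/orP; left; apply/eqP; ring.
apply: ler_wpM2l.
  by rewrite !mulr_ge0 ?invr_ge0 ?exprn_ge0 // ltW.
apply: ler_wpM2l; first by rewrite exprn_ge0.
have -> : (k%:R ^+ 3 * w ^+ k) ^+ d = k%:R ^+ (2 * d) * (k%:R ^+ d * (w ^+ k) ^+ d).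
  by rewrite exprMn mulrA -exprD; congr (_ * _); rewrite -exprM; congr (_ ^+ _); ring.
apply: ler_wpM2l; first by rewrite exprn_ge0.
apply: ler_pM => //; last by rewrite exprn_ge0 // ltW.
by rewrite mulr_ge0 ?exprn_ge0 // ltW.
Qed.

(** [fact_le_expR] gives k!^3 <= e^3 k^(3k + 3) e^(-3k). The excess k^3 is matched by the root
    choices, and e^(-3k) by the domination probability. The 4 comes from two factors 1 / 2: in
    [coloring_count_lower], and in (n q^k / k)^(3k) >= 1 - 3 x >= 1 / 2. *)
Lemma mean_lower N : (N * k`! ^ 3 = n ^_ (3 * k))%N ->
  expR (- 5) / 4 <= (N * k ^ 3)%:R * pi.
Proof.
move=> hN; have f0 : 0 < k`!%:R :> R by rewrite ltr0n fact_gt0.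
have n0 := n_gt0.
have kp : 0 < k%:R :> R by rewrite ltr0n.
have HN := coloring_count_lower hN.
have Hm : expR (- (3 * k%:R + 1)) <= (1 - x) ^+ (3 * (n - 3 * k)).
  (* Squaring doubles the exponent to a multiple of 6, the form covered by [miss_lower]. *)
  rewrite -(@ler_pXn2r _ 2) ?nnegrE ?expR_ge0 ?exprn_ge0 //.
  rewrite -expRM_natl -exprM.
  have -> : (3 * (n - 3 * k) * 2 = 6 * (n - 3 * k))%N by ring.
  apply: le_trans (miss_lower (leq_subr _ _)).
  by rewrite ler_expR; lra.
have Hq : k%:R ^+ (3 * k) <= 2 * (n%:R ^+ (3 * k) * q ^+ (3 * k ^ 2)) :> R.
  have -> : q ^+ (3 * k ^ 2) = x ^+ (3 * k) by rewrite -exprM; congr (_ ^+ _); ring.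
  rewrite -exprMn.
  apply: le_trans (_ : 2 * (k%:R * (1 - x / k%:R)) ^+ (3 * k) <= _); last first.
    rewrite ler_pM2l //; apply: lerXn2r.
    - rewrite nnegrE mulr_ge0 // subr_ge0 ler_pdivrMr // mul1r.
      by have := x108; move: k1; lra.
    - by rewrite nnegrE mulr_ge0 // ltW.
    - by rewrite mulrBr mulr1 mulrCA mulfV ?mulr1 ?lt0r_neq0.
  rewrite exprMn mulrCA; apply: ler_peMr; first by rewrite exprn_ge0.
  have b : 1 - (3 * k)%:R * (x / k%:R) <= (1 - x / k%:R) ^+ (3 * k).
    apply: bernoulli_ineq; rewrite divr_ge0 ?(ltW x0) // ler_pdivrMr // mul1r.
    by have := x108; move: k1; lra.
  have E : (3 * k)%:R * (x / k%:R) = 3 * x :> R by rewrite natrM; field; exact: lt0r_neq0.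
  by move: b x108; rewrite E; lra.
have Hf : (k`!%:R * expR k%:R) ^+ 3 <= (expR 1 * k%:R ^+ k.+1) ^+ 3 :> R.
  by apply: lerXn2r; rewrite ?nnegrE ?mulr_ge0 ?expR_ge0 ?exprn_ge0 // fact_le_expR.
have ek : 0 < expR k%:R ^+ 3 :> R by rewrite exprn_gt0 // expR_gt0.
have f3 : 0 < k`!%:R ^+ 3 :> R by rewrite exprn_gt0.
rewrite -(ler_pM2r (mulr_gt0 f3 ek)) -exprMn.
have x0' := ltW x0; have q0' := ltW q0.
apply: le_trans (_ : expR (-5) / 4 * (expR 1 * k%:R ^+ k.+1) ^+ 3 <= _).
  by apply: ler_wpM2l => //; rewrite divr_ge0 ?expR_ge0.
apply: le_trans (_ : k%:R ^+ 3 * expR k%:R ^+ 3 * (4^-1 * k%:R ^+ (3 * k)) *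
  expR (- (3 * k%:R + 1)) <= _).
  have -> : expR (- (3 * k%:R + 1)) = expR (- (3 * k%:R)) * expR (- 1) :> R.
    by rewrite -expRD opprD.
  have -> : expR (- (3 * k%:R)) = (expR k%:R ^+ 3)^-1 :> R by rewrite expRN -expRM_natl.
  have -> : (expR 1 * k%:R ^+ k.+1) ^+ 3 = expR 3 * (k%:R ^+ 3 * k%:R ^+ (3 * k)) :> R.
    rewrite exprMn -expRM_natl mulr1 -!exprM -exprD; congr (_ * _ ^+ _); ring.
  have e5 : expR (- 5) * expR 3 <= expR (- 1) :> R by rewrite -expRD ler_expR; lra.
  have kk : 0 <= k%:R ^+ 3 * k%:R ^+ (3 * k) / 4 :> R by rewrite !mulr_ge0 ?exprn_ge0.
  have := ler_wpM2l kk e5.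
  move=> h; apply: le_trans (le_trans _ h) _; rewrite le_eqVlt; apply/orP; left; apply/eqP.
    by ring.
  by field; rewrite gt_eqF.
rewrite /pi natrM natrX.
apply: le_trans (_ : k%:R ^+ 3 * expR k%:R ^+ 3 *
   ((N%:R * k`!%:R ^+ 3) * q ^+ (3 * k ^ 2)) * (1 - x) ^+ (3 * (n - 3 * k)) <= _); last first.
  by rewrite le_eqVlt; apply/orP; left; apply/eqP; ring.
apply: ler_pM => //; rewrite ?expR_ge0 ?mulr_ge0 ?exprn_ge0 ?expR_ge0 //.
apply: ler_wpM2l; first by rewrite mulr_ge0 ?exprn_ge0 ?expR_ge0.
have q3 : 0 <= q ^+ (3 * k ^ 2) by rewrite exprn_ge0.
have := ler_wpM2r q3 HN; lra.
Qed.

End SecondMomentNumerics.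

(* With N the number of events that occur, 1 - (1 - a N)^2 is at most 1, and
   it vanishes when N = 0. *)
Lemma Pr_second_moment (R : realFieldType) (p : R) (E T : finType) (P : pred T)
    (A : T -> pred {ffun E -> bool}) (a : R) : 0 <= p <= 1 ->
  2 * a * \sum_(t | P t) Pr p (A t)
    - a ^+ 2 * \sum_(t | P t) \sum_(s | P s) Pr p (fun f => A t f && A s f) <=
  Pr p (fun f => [exists t, P t && A t f]).
Proof.
move=> p01.
under eq_bigr do rewrite PrE.
under [X in _ - _ * X]eq_bigr do under eq_bigr do rewrite PrE.
rewrite exchange_big /=.
under [X in _ - _ * X]eq_bigr do rewrite exchange_big /=.
rewrite [X in _ - _ * X]exchange_big /= PrE !mulr_sumr -sumrB; apply: ler_sum => f _.
rewrite -mulr_sumr.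
under [X in _ - _ * X]eq_bigr do rewrite -mulr_sumr.
rewrite -mulr_sumr ![_ * (weight p f * _)]mulrCA -mulrBr.
apply: ler_wpM2l; first exact: weight_ge0.
set N := \sum_(t | P t) (A t f)%:R.
have -> : \sum_(t | P t) \sum_(s | P s) (A t f && A s f)%:R = N * N :> R.
  rewrite /N big_distrlr /=; apply: eq_bigr => t _; apply: eq_bigr => s _.
  by rewrite -natrM mulnb.
case: existsP => [_|none]; last first.
  have -> : N = 0.
    rewrite /N big1 // => t Pt; case: (boolP (A t f)) => // At.
    by case: none; exists t; rewrite Pt.
  by rewrite !mulr0 subr0.
by have := sqr_ge0 (1 - a * N); rewrite /=; lra.
Qed.

(** * How the classes of two colorings overlap *)

Section Overlaps.
Variable n : nat.
Implicit Types (c : {ffun 'I_n -> option 'I_3}) (x : {ffun 'I_3 -> 'I_n}).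

Lemma card_opt_cls_split c (X : {set 'I_n}) : #|X| = (\sum_o #|opt_cls c o :&: X|)%N.
Proof.
rewrite -sum1_card (partition_big c predT) //=; apply: eq_bigr => w _.
by rewrite sum1dep_card; apply: eq_card => v; rewrite !inE andbC.
Qed.

Lemma big_option3 (T : Type) (idx : T) (op : Monoid.com_law idx) (F : option 'I_3 -> T) :
  \big[op/idx]_w F w = op (F None) (\big[op/idx]_i F (Some i)).
Proof.
rewrite (bigD1 None) //=; congr (op _ _).
rewrite (reindex_omap Some id) /=; last by case.
by apply: eq_bigl => i; rewrite eqxx.
Qed.

Lemma opt_cls_Some c i : opt_cls c (Some i) = cls c i. Proof. by []. Qed.

Lemma opt_cls_None c : opt_cls c None = free c. Proof. by []. Qed.

Lemma overlap_col c c' a :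
  (#|free c :&: cls c' a| + \sum_i overlap c c' i a = #|cls c' a|)%N.
Proof. by rewrite [RHS](card_opt_cls_split c) big_option3. Qed.

Lemma overlapC c c' i a : overlap c c' i a = overlap c' c a i.
Proof. by rewrite /overlap finset.setIC. Qed.

Lemma overlap_row c c' i :
  (#|free c' :&: cls c i| + \sum_a overlap c c' i a = #|cls c i|)%N.
Proof. by rewrite -(overlap_col c'); congr (_ + _)%N; apply: eq_bigr => a _; rewrite overlapC. Qed.

Lemma card_freeI c c' k : sized c (fun=> k) -> sized c' (fun=> k) ->
  (n - 6 * k <= #|free c :&: free c'|)%N.
Proof.
move=> /forallP sc /forallP sc'.
have := card_free c; have := card_free c'.
have sum_cls c1 : (forall i, #|cls c1 i| == k) -> (\sum_i #|cls c1 i| = 3 * k)%N.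
  by move=> s1; rewrite (eq_bigr (fun=> k)) ?sum_nat_const ?card_ord // => i _; apply/eqP.
rewrite !sum_cls //.
have := cardsU (free c) (free c').
have : (#|free c :|: free c'| <= n)%N by rewrite -[leqRHS]card_ord max_card.
by have := subset_leq_card (finset.subsetIl (free c) (free c')); clear; lia.
Qed.

Lemma card_crossing_sized c k : sized c (fun=> k) -> #|crossing c| = (3 * k ^ 2)%N.
Proof.
move=> /forallP sc; have := card_crossing c.
rewrite (eq_bigr (fun=> (2 * (k * k))%N)) => [|i _].
  by rewrite sum_nat_const card_ord -mulnn; lia.
rewrite (eq_bigr (fun=> (k * k)%N)) => [|j _]; last by rewrite !(eqP (sc _)).
rewrite sum_nat_const; congr (_ * _)%N.
by rewrite -[RHS](congr1 predn (card_ord 3)) -(cardC1 i); apply: eq_card.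
Qed.

Lemma card_profile c k (r : 'I_3 -> 'I_3 -> nat) : sized c (fun=> k) ->
  (#|[set t : {ffun 'I_n -> option 'I_3} * {ffun 'I_3 -> 'I_n} |
      (sized t.1 (fun=> k) && rooted t.1 t.2) &&
      [forall i, forall a, overlap c t.1 i a == r i a]]| <=
   k ^ 3 * ((\prod_i \prod_a 'C(k, r i a)) * \prod_a 'C(n, k - \sum_i r i a)))%N.
Proof.
move=> sc.
apply: (@leq_trans (\sum_(c' | sized c' (fun=> k) &&
    [forall i, forall a, overlap c c' i a == r i a]) \sum_(x | rooted c' x) 1)).
  rewrite pair_big_dep /= -sum1dep_card leq_eqVlt; apply/orP; left; apply/eqP.
  by apply: eq_bigl => t; rewrite andbAC.
rewrite (eq_bigr (fun=> (k ^ 3)%N)) => [|c' /andP[/forallP sc' _]]; last first.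
  rewrite sum1dep_card card_rooted (eq_bigr (fun=> k)) => [|i _]; last exact/eqP.
  by rewrite prod_nat_const card_ord.
rewrite sum_nat_const mulnC leq_mul2l; apply/orP; right.
(* In the row of vertices uncolored by [c] the entry is forced by the column sum, since every class
   of [c'] has [k] elements. *)
pose r' (w : option 'I_3) a := if w is Some i then r i a else (k - \sum_i r i a)%N.
apply: (@leq_trans #|[set c' | [forall w, forall a, #|opt_cls c w :&: cls c' a| == r' w a]]|).
  apply/subset_leq_card/fintype.subsetP => c' /andP[/forallP sc' /forallP ov].
  have ovE i a : overlap c c' i a = r i a by apply/eqP; apply: (forallP (ov i)).
  rewrite inE; apply/forallP => w; apply/forallP => a; case: w => [i|] /=.
    by rewrite opt_cls_Some -ovE.
  rewrite opt_cls_None -(eqP (sc' a)) -(overlap_col c c' a).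
  by rewrite (eq_bigr _ (fun i _ => ovE i a)) addnK.
apply: leq_trans (card_overlap c r') _.
rewrite big_option3 /= [X in (X <= _)%N]mulnC; apply: leq_mul.
  apply: leq_prod => i _; apply: leq_prod => a _.
  by rewrite opt_cls_Some (eqP (forallP sc i)).
apply: leq_prod => a _; apply: leq_bin2l.
by rewrite -[leqRHS]card_ord max_card.
Qed.

(** The six tuples with the same sets and roots as [t], up to renaming; they form the diagonal part
    of the second moment. *)
Definition relabel (s : {perm 'I_3}) (t : {ffun 'I_n -> option 'I_3} * {ffun 'I_3 -> 'I_n}) :
    {ffun 'I_n -> option 'I_3} * {ffun 'I_3 -> 'I_n} :=
  ([ffun v => omap s (t.1 v)], [ffun i => t.2 ((s^-1)%g i)]).

(* The roots agree because they span the unique edges between the classes. *)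
Lemma full_overlap (s : {perm 'I_3}) c x c' x' k f :
  sized c (fun=> k) -> sized c' (fun=> k) ->
  (forall i, overlap c c' i (s i) = k) ->
  good_event c x f -> good_event c' x' f -> (c', x') = relabel s (c, x).
Proof.
move=> /forallP sc /forallP sc' ov /and3P[rx lx _] /and3P[rx' lx' _].
have clsE i : cls c i = cls c' (s i).
  apply/eqP; rewrite eqEcard (eqP (sc i)) (eqP (sc' (s i))) leqnn andbT.
  apply/finset.setIidPl/eqP; rewrite eqEcard finset.subsetIl (eqP (sc i)).
  by rewrite -/(overlap _ _ _ _) ov leqnn.
congr (_, _).
  apply: coloring_eq => j; rewrite -(permKV s j) -clsE; apply/setP => v.
  rewrite !inE ffunE /=; case: (c v) => [i|] //=.
  by rewrite !(inj_eq Some_inj) (inj_eq perm_inj).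
apply/ffunP => j; rewrite ffunE /=; set i := (s^-1)%g j.
have -> : j = s i by rewrite /i permKV.
have [i' ii'] : exists i', i != i'.
  by exists (if i == ord0 then lift ord0 ord0 else ord0); case: (i =P ord0) => [->|/eqP].
have sii' : s i != s i' by rewrite (inj_eq perm_inj).
have /(linkedP _ rx)/(_ _ _ ii') := lx; have /(linkedP _ rx')/(_ _ _ sii') := lx'.
rewrite !clsE => -> /set1_inj E.
have : x' (s i) \in [set x i; x i'] by rewrite -E set21.
rewrite !inE => /orP[]/eqP // xE.
have := forallP rx' (s i); rewrite xE.
have : x i' \in cls c i' by rewrite inE; exact: (forallP rx).
rewrite clsE inE => /eqP -> /eqP[] /perm_inj E'.
by rewrite E' eqxx in ii'.
Qed.

End Overlaps.

Lemma sum_le_of_card (R : realFieldType) (T : finType) (A : pred T) (F : T -> R) B :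
  0 <= B -> (forall t, A t -> #|A|%:R * F t <= B) -> \sum_(t | A t) F t <= B.
Proof.
move=> B0 H; have [A0|A0] := posnP #|A|.
  by rewrite big_pred0 // => t; apply: (card0_eq A0).
apply: le_trans (_ : \sum_(t | A t) B / #|A|%:R <= _).
  by apply: ler_sum => t At; rewrite ler_pdivlMr ?ltr0n // mulrC H.
by rewrite sumr_const -[_ *+ #|_|]mulr_natl mulrCA mulfV ?mulr1 // pnatr_eq0 -lt0n.
Qed.

(** * Second moment of the number of tuples with all three sizes equal to k *)

Section SecondMoment.
Variables (R : realType) (p u w : R) (k n : nat).
Hypothesis p01 : 0 < p < 1.
Local Notation q := (1 - p).
Hypothesis k0 : (0 < k)%N.
Hypothesis (nqk_le : n%:R * q ^+ k <= k%:R).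
Hypothesis (nqk_ge : k%:R - q ^+ k <= n%:R * q ^+ k).
Hypothesis (kqk : 108 * (k%:R * q ^+ k) <= 1).
Hypotheses (u0 : 0 < u) (u2 : u ^+ 2 = q) (kuk : 9 * (k%:R * u ^+ k) <= 1).
Hypotheses (w0 : 0 < w) (w36 : w ^+ 36 = q).
Hypothesis (kw3 : k%:R ^+ 3 * w ^+ k <= 1).
Hypothesis (kw1 : 2 * expR 2 * (k%:R * w ^+ k) <= 1).

Notation bits := {ffun {set 'I_n} -> bool}.
Notation tuple := ({ffun 'I_n -> option 'I_3} * {ffun 'I_3 -> 'I_n})%type.
Implicit Types (t : tuple).

Let pw : 0 <= p <= 1. Proof. by case/andP: p01 => ? ?; rewrite !ltW. Qed.
Let p0 : 0 < p. Proof. by case/andP: p01. Qed.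
Let q0 : 0 < q. Proof. by rewrite subr_gt0; case/andP: p01. Qed.
Let q01 : 0 < q < 1. Proof. by rewrite q0 gtrBl. Qed.

Definition ktuple t := sized t.1 (fun=> k) && rooted t.1 t.2.
Definition num_colorings := #|[set c : {ffun 'I_n -> option 'I_3} | sized c (fun=> k)]|.
Local Notation N := num_colorings.
Local Notation pi := (event_scale q k n).
Local Notation M := ((N * k ^ 3)%:R : R).

Lemma num_coloringsE : (N * k`! ^ 3 = n ^_ (3 * k))%N.
Proof.
have := card_sized_ffact n (fun=> k).
by rewrite prod_nat_const sum_nat_const card_ord.
Qed.

Lemma card_ktuple : #|[pred t | ktuple t]| = (N * k ^ 3)%N.
Proof.
have := card_pairs n (fun=> k); rewrite prod_nat_const card_ord => <-.
by apply: eq_card => t; rewrite !inE.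
Qed.

Lemma miss_sized (c : {ffun 'I_n -> option 'I_3}) : sized c (fun=> k) ->
  \prod_i (1 - q ^+ #|cls c i|) = (1 - q ^+ k) ^+ 3.
Proof.
move=> /forallP sc; rewrite (eq_bigr (fun=> 1 - q ^+ k)) => [|i _].
  by rewrite prodr_const card_ord.
by rewrite (eqP (sc i)).
Qed.

Lemma card_free_sized (c : {ffun 'I_n -> option 'I_3}) : sized c (fun=> k) ->
  #|free c| = (n - 3 * k)%N.
Proof.
move=> /forallP sc; have := card_free c.
rewrite (eq_bigr (fun=> k)) ?sum_nat_const ?card_ord; last by move=> i _; apply/eqP.
by clear; lia.
Qed.

Lemma ktuple_le t : ktuple t -> Pr p (good_event t.1 t.2) <= q ^- 3 * pi.
Proof.
move=> /andP[st rt]; rewrite ler_pdivlMl ?exprn_gt0 //.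
apply: le_trans (Pr_good_event_le p01 rt) _.
by rewrite miss_sized // (card_crossing_sized st) card_free_sized // -exprM.
Qed.

Lemma ktuple_ge t : ktuple t -> p ^+ 3 * pi <= Pr p (good_event t.1 t.2).
Proof.
move=> /andP[st rt]; apply: le_trans (Pr_good_event_ge p01 rt).
by rewrite miss_sized // (card_crossing_sized st) card_free_sized // -exprM mulrA.
Qed.

Local Notation C1 := (2 * expR 4 * q ^- 6).
Local Notation delta := (4 * expR 4 * expR 2 * q ^- 6 * (k%:R ^+ 6 * w ^+ k)).

Let pi0 : 0 <= pi.
Proof. by apply: (event_scale_ge0 n q01 k0 kqk). Qed.

Let kR1 : 1 <= k%:R :> R. Proof. by rewrite ler1n. Qed.

Let delta0 : 0 <= delta.
Proof. by rewrite !mulr_ge0 ?expR_ge0 ?invr_ge0 ?exprn_ge0 ?ler0n // ltW. Qed.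

(** With zero overlap the tuples are nearly independent, which gives the main term
    [C1 * (M * pi ^+ 2)]. Every other matrix is charged [delta], small enough to survive the sum
    over (k + 1)^9 matrices. Relabellings of [t] are not rare in this sense and are treated
    apart. *)
Lemma same_profile_sum t (A : pred tuple) (r : 'I_3 -> 'I_3 -> nat) :
  ktuple t ->
  (forall t', A t' -> [/\ ktuple t', ~~ [exists s, t' == relabel s t] &
     forall i a, overlap t.1 t'.1 i a = r i a]) ->
  \sum_(t' | A t') Pr p (fun f : bits => good_event t.1 t.2 f && good_event t'.1 t'.2 f) <=
  ((\sum_i \sum_a r i a == 0)%N)%:R * (C1 * (M * pi ^+ 2)) + delta * (pi + M * pi ^+ 2).
Proof.
move=> kt HA; set B := (X in _ <= X).
have B0 : 0 <= B.
  have M0 : 0 <= M * pi ^+ 2 by rewrite mulr_ge0 ?exprn_ge0 ?ler0n.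
  apply: addr_ge0; last exact: mulr_ge0 delta0 (addr_ge0 pi0 M0).
  apply: mulr_ge0 => //; apply: mulr_ge0 => //.
  by rewrite !mulr_ge0 ?expR_ge0 ?invr_ge0 ?exprn_ge0 // ltW.
(* All of [A] has the same overlap matrix, so one element [t0] supplies its row and column bounds
   and the number [S] of common pairs. *)
have [/pred0P A0|/pred0Pn[t0 At0]] := boolP (pred0b A); first by rewrite big_pred0.
have /andP[sc rx] := kt.
have [/andP[sc0 rx0] _ ov0] := HA _ At0.
have rcol a : (\sum_i r i a <= k)%N.
  rewrite -(eqP (forallP sc0 a)) -(overlap_col t.1 t0.1 a) -(eq_bigr _ (fun i _ => ov0 i a)).
  exact: leq_addl.
have rrow i : (\sum_a r i a <= k)%N.
  rewrite -(eqP (forallP sc i)) -(overlap_row t.1 t0.1 i) -(eq_bigr _ (fun a _ => ov0 i a)).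
  exact: leq_addl.
have rle i a : (r i a <= k)%N by apply: leq_trans (rcol a); rewrite (bigD1 i) //= leq_addr.
pose tot := (\sum_i \sum_a r i a)%N.
have tot3 : (tot <= 3 * k)%N.
  have -> : (3 * k = \sum_(i < 3) k)%N by rewrite sum_nat_const card_ord.
  exact: leq_sum.
pose P := ((\prod_i \prod_a 'C(k, r i a)) * \prod_a 'C(n, k - \sum_i r i a))%N.
have hA : (#|A| <= k ^ 3 * P)%N.
  apply: leq_trans (card_profile r sc); apply/subset_leq_card/fintype.subsetP => t' At'.
  have [kt' _ ov] := HA _ At'; rewrite inE -/(ktuple t') kt' /=.
  by apply/forallP => i; apply/forallP => a; rewrite ov.
pose r' i a : R := (r i a)%:R.
pose S := #|crossing t.1 :&: crossing t0.1|.
have sharedS : shared r' = (2 * S)%:R.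
  rewrite /S -card_crossingI /shared; apply: eq_bigr => i _; apply: eq_bigr => a _.
  rewrite /r' ov0; congr (_ * _); rewrite /minor; apply: eq_bigr => j _.
  by apply: eq_bigr => b _; rewrite ov0.
have totalE : total r' = tot%:R.
  by rewrite /total /tot natr_sum; apply: eq_bigr => i _; rewrite natr_sum.
have US t' : A t' -> (#|crossing t.1 :|: crossing t'.1| + S = 6 * k ^ 2)%N.
  move=> At'; have [/andP[sc' _] _ ov] := HA _ At'.
  have -> : S = #|crossing t.1 :&: crossing t'.1|.
    have H : (2 * S)%:R = (2 * #|crossing t.1 :&: crossing t'.1|)%:R :> R.
      rewrite -sharedS -card_crossingI /shared; apply: eq_bigr => i _; apply: eq_bigr => a _.
      rewrite /r' ov; congr (_ * _); rewrite /minor; apply: eq_bigr => j _.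
      by apply: eq_bigr => b _; rewrite ov.
    by move/eqP: H; rewrite eqr_nat eqn_pmul2l // => /eqP.
  rewrite cardsU !(card_crossing_sized (k := k)) //.
  have := subset_leq_card (finset.subsetIl (crossing t.1) (crossing t'.1)).
  by rewrite (card_crossing_sized sc); clear; lia.
have Vb t' : A t' -> (n - 6 * k <= #|free t.1 :&: free t'.1|)%N.
  by move=> At'; have [/andP[sc' _] _ _] := HA _ At'; exact: card_freeI.
have Vn t' : (#|free t.1 :&: free t'.1| <= n)%N by rewrite -[leqRHS]card_ord max_card.
have rowR i : \sum_a r' i a <= k%:R by rewrite -natr_sum ler_nat.
have colR a : \sum_i r' i a <= k%:R by rewrite -natr_sum ler_nat.
have k20 : 0 <= M * pi ^+ 2 by rewrite mulr_ge0 ?exprn_ge0 ?ler0n.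
have q6 : 0 <= q ^- 6 by rewrite invr_ge0 exprn_ge0 // ltW.
have e4 : 0 <= expR 4 :> R := expR_ge0 _.
have e2 : 1 <= expR 2 :> R by rewrite -expR0 ler_expR.
have C10 : 0 <= C1 by rewrite !mulr_ge0.
have e41 : 1 <= expR 4 :> R by rewrite -expR0 ler_expR.
have wk0 : 0 <= w ^+ k by rewrite exprn_ge0 // ltW.
have [far|[s near]] := overlap_dichotomy (ler0n R k) (fun i a => ler0n R (r i a)) rowR colR.
  have {}far : (36 * S + k * tot <= 36 * (k * tot))%N.
    move: far; rewrite -/r' sharedS totalE -!natrM -natrD ler_nat; clear; lia.
  apply: sum_le_of_card => // t' At'.
  have [/andP[sc' rx'] _ ov] := HA _ At'.
  have bound := Pr_pair_le_far p01 t.2 t'.2 (fun i => eqP (forallP sc i)) (fun i => eqP (forallP sc' i)).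
  have E : \sum_i \sum_a q ^+ (2 * k - overlap t.1 t'.1 i a) = \sum_i \sum_a q ^+ (2 * k - r i a).
    by apply: eq_bigr => i _; apply: eq_bigr => a _; rewrite ov.
  rewrite E in bound.
  have := far_total q01 k0 nqk_le nqk_ge kqk u0 u2 kuk w0 w36 num_coloringsE hA
    (count_far n rcol) tot3 far (US _ At') (Vn t') (Vb _ At') rle (Pr_ge0 pw _) bound.
  move=> h; apply: le_trans h _; rewrite /B -/tot.
  (* Only the zero matrix uses the main term; otherwise one factor k w^k is absorbed by [delta]. *)
  have [->|tot0] := posnP tot.
    by rewrite expr0 mulr1 mul1r lerDl mulr_ge0 ?addr_ge0.
  apply: le_trans (_ : C1 * (M * pi ^+ 2) * (2 * expR 2 * (k%:R * w ^+ k)) <= _).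
    apply: ler_wpM2l; first exact: mulr_ge0.
    by apply: ler_iXnr => //; rewrite !mulr_ge0 // ?expR_ge0.
  apply: le_trans (_ : delta * (M * pi ^+ 2) <= _).
    have -> : C1 * (M * pi ^+ 2) * (2 * expR 2 * (k%:R * w ^+ k)) =
      4 * expR 4 * expR 2 * q ^- 6 * (k%:R * w ^+ k) * (M * pi ^+ 2) by ring.
    apply: ler_wpM2r => //; apply: ler_wpM2l; first by rewrite !mulr_ge0 ?expR_ge0.
    by apply: ler_wpM2r => //; apply: ler_eXnr.
  rewrite mul0r add0r; apply: ler_wpM2l => //.
  by rewrite lerDr.
pose d := (3 * k - \sum_i r i (s i))%N.
have sumrs : (\sum_i r i (s i) <= 3 * k)%N.
  have -> : (3 * k = \sum_(i < 3) k)%N by rewrite sum_nat_const card_ord.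
  exact: leq_sum.
have {}near : (36 * S + k * d <= 36 * (k * tot))%N.
  have : (18 * (2 * S) + k * (3 * k) <= 36 * (k * tot) + k * \sum_i r i (s i))%N.
    by move: near; rewrite -/r' sharedS totalE -natr_sum -!natrM -!natrD ler_nat.
  rewrite /d mulnBr; have : (k * \sum_i r i (s i) <= k * (3 * k))%N by rewrite leq_mul2l sumrs orbT.
  by clear; lia.
(* Distance zero means that the classes agree up to [s]. Both events then force a relabelling, which
   is excluded, so all these probabilities vanish. *)
have [d0|d0] := posnP d.
  rewrite big1 // => t' At'; have [/andP[sc' rx'] nrel ov] := HA _ At'.
  have full i : overlap t.1 t'.1 i (s i) = k.
    rewrite ov; apply/eqP; rewrite eqn_leq rle leqNgt /=; apply/negP => lt.
    have : (\sum_i r i (s i) < \sum_(i < 3) k)%N.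
      by rewrite (bigD1 i) //= [ltnRHS](bigD1 i) //= -addSn leq_add // leq_sum.
    rewrite sum_nat_const card_ord; move/eqP: d0; rewrite subn_eq0; clear; lia.
  rewrite /Pr big_pred0 // => f; apply/negP => /andP[g g'].
  have := full_overlap sc sc' full g g'; rewrite -!surjective_pairing => E.
  by case/existsP: nrel; exists s; rewrite E.
apply: sum_le_of_card => // t' At'.
have [/andP[sc' rx'] _ ov] := HA _ At'.
have bound := Pr_pair_le_near p01 t.1 t.2 t'.1 t'.2.
rewrite miss_sized // -exprM in bound.
have totd : (3 * k - tot <= d)%N.
  apply: leq_sub2l; rewrite /tot; apply: leq_sum => i _.
  by rewrite (bigD1 (s i)) //= leq_addr.
have := near_total q01 k0 nqk_le nqk_ge kqk w0 w36 hA (count_near n rcol s k0) tot3 totd near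
  (US _ At') (Vb _ At') (Pr_ge0 pw _) bound.
move=> h; apply: le_trans h _.
apply: le_trans (_ : delta * pi <= _).
  have -> : 2 * q ^- 6 * pi * (k%:R ^+ 3 * (k%:R ^+ 3 * w ^+ k) ^+ d) =
    2 * q ^- 6 * (k%:R ^+ 3 * (k%:R ^+ 3 * w ^+ k) ^+ d) * pi by ring.
  apply: ler_wpM2r => //.
  have -> : delta = 2 * q ^- 6 * (2 * expR 4 * expR 2 * (k%:R ^+ 3 * (k%:R ^+ 3 * w ^+ k))) by ring.
  apply: ler_wpM2l; first by rewrite mulr_ge0.
  have k30 : 0 <= k%:R ^+ 3 :> R by rewrite exprn_ge0.
  have X0 : 0 <= k%:R ^+ 3 * (k%:R ^+ 3 * w ^+ k) by rewrite !mulr_ge0.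
  apply: le_trans (_ : k%:R ^+ 3 * (k%:R ^+ 3 * w ^+ k) <= _).
    apply: ler_wpM2l; first by rewrite exprn_ge0.
    by apply: ler_iXnr => //; rewrite mulr_ge0.
  apply: ler_peMl => //; have := ler_pM ler01 ler01 e41 e2; rewrite mulr1.
  set z := expR 4 * expR 2 => z1; rewrite -mulrA -/z; apply: le_trans z1 _.
  by rewrite ler_peMl ?ler1n // mulr_ge0 ?expR_ge0.
rewrite /B; apply: le_trans (_ : delta * (pi + M * pi ^+ 2) <= _).
  by apply: ler_wpM2l => //; rewrite lerDl.
by rewrite lerDr; apply: mulr_ge0 => //; apply: mulr_ge0.
Qed.

Hypothesis delta_small : (k.+1 ^ 9)%:R * delta <= 1.

Local Notation D1 := (6 * q ^- 3 + 1).
Local Notation D2 := (C1 + 1).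

Let k20 : 0 <= M * pi ^+ 2. Proof. by rewrite mulr_ge0 ?exprn_ge0 ?ler0n. Qed.

Let C10 : 0 <= C1.
Proof. by rewrite !mulr_ge0 ?expR_ge0 ?invr_ge0 ?exprn_ge0 // ltW. Qed.

Lemma relabel_sum t : ktuple t ->
  \sum_(t' | ktuple t' && [exists s, t' == relabel s t])
    Pr p (fun f : bits => good_event t.1 t.2 f && good_event t'.1 t'.2 f) <=
  6 * q ^- 3 * pi.
Proof.
move=> kt; pose F (t' : tuple) :=
  Pr p (fun f : bits => good_event t.1 t.2 f && good_event t'.1 t'.2 f).
have F0 t' : 0 <= F t' by apply: Pr_ge0.
apply: le_trans (_ : \sum_(s : {perm 'I_3}) F (relabel s t) <= _).
  apply: le_trans (_ : \sum_t' \sum_(s : {perm 'I_3} | t' == relabel s t) F t' <= _).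
    rewrite [leLHS]big_mkcond; apply: ler_sum => t' _; case: ifP => [/andP[_ /existsP[s ts]]|_].
      by rewrite (bigD1 s) //= lerDl sumr_ge0.
    exact: sumr_ge0.
  rewrite (exchange_big_dep xpredT) //=; apply: ler_sum => s _.
  by rewrite big_pred1_eq.
apply: le_trans (_ : \sum_(s : {perm 'I_3}) q ^- 3 * pi <= _).
  apply: ler_sum => s _; apply: le_trans (ktuple_le kt).
  by apply: Pr_le => // f /andP[].
by rewrite sumr_const card_Sn -[_ *+ _`!]mulr_natl mulrA.
Qed.

(** The six relabellings give 6 q^(-3) pi, the zero matrix gives the [C1] term, and by [delta_small]
    the errors of all matrices add up to at most pi + M pi^2. *)
Lemma pair_sum t : ktuple t ->
  \sum_(t' | ktuple t')
    Pr p (fun f : bits => good_event t.1 t.2 f && good_event t'.1 t'.2 f) <=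
  D1 * pi + D2 * (M * pi ^+ 2).
Proof.
move=> kt; rewrite (bigID (fun t' => [exists s, t' == relabel s t])) /=.
have := relabel_sum kt; set X := \sum_(t' | _) _ => hX.
pose prof t' : {ffun 'I_3 * 'I_3 -> 'I_k.+1} := [ffun z => inord (overlap t.1 t'.1 z.1 z.2)].
rewrite (partition_big prof predT) //=.
pose tot (r : {ffun 'I_3 * 'I_3 -> 'I_k.+1}) := (\sum_i \sum_a r (i, a))%N.
apply: le_trans (lerD hX (_ : _ <= \sum_(r : {ffun 'I_3 * 'I_3 -> 'I_k.+1})
  (((tot r == 0)%N)%:R * (C1 * (M * pi ^+ 2)) + delta * (pi + M * pi ^+ 2)))) _.
  apply: ler_sum => r _; apply: (same_profile_sum (r := fun i a => r (i, a))) => //.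
  move=> t' /andP[/andP[kt' nrel] /eqP rE]; split=> // i a.
  rewrite -rE ffunE /= inordK // ltnS.
  have /andP[/forallP st' _] := kt'.
  by rewrite -(eqP (st' a)) subset_leq_card // finset.subsetIr.
rewrite big_split /= -mulr_suml sumr_const -[_ *+ #|_|]mulr_natl.
rewrite card_ffun card_prod !card_ord.
have h1 : \sum_(r : {ffun 'I_3 * 'I_3 -> 'I_k.+1}) ((tot r == 0)%N)%:R <= 1 :> R.
  rewrite (bigD1 [ffun=> ord0]) //= big1 ?addr0 => [|r r0].
    by rewrite -[leRHS]/(1%:R) ler_nat leq_b1.
  case: eqP => // tr; case/eqP: r0; apply/ffunP => -[i a]; rewrite ffunE; apply: val_inj => /=.
  move/eqP: tr; rewrite /tot sum_nat_eq0 => /forallP/(_ i)/=.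
  by rewrite sum_nat_eq0 => /forallP/(_ a)/= /eqP.
have h2 := ler_wpM2r (mulr_ge0 C10 k20) h1.
have h3 := ler_wpM2r (addr_ge0 pi0 k20) delta_small.
rewrite mulrA; move: h2 h3; lra.
Qed.

Lemma gnp_good_lower (c : R := expR (- 5) / 4) :
  p ^+ 6 * c / (D1 + D2 * c) <= gnp_good p n.
Proof.
have c0 : 0 < c by rewrite divr_gt0 ?expR_gt0.
have D10 : 0 < D1.
  by rewrite ltr_wpDl // mulr_ge0 // invr_ge0 exprn_ge0 // ltW.
have D20 : 0 < D2 by rewrite ltr_wpDl.
pose Y := M * pi.
have Yc : c <= Y.
  exact: (mean_lower q01 k0 nqk_le nqk_ge kqk num_coloringsE).
have DY : 0 < D1 + D2 * Y by rewrite addr_gt0 // mulr_gt0 // (lt_le_trans c0).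
have Dc : 0 < D1 + D2 * c by rewrite addr_gt0 // mulr_gt0.
(* The maximizer of 2 a mu - a^2 sigma for mu = p^3 Y and sigma = Y (D1 + D2 Y), the bounds on the
   two moments. *)
pose a := p ^+ 3 / (D1 + D2 * Y).
have a0 : 0 <= a by rewrite divr_ge0 ?exprn_ge0 // ltW.
have mean : p ^+ 3 * Y <= \sum_(t | ktuple t) Pr p (good_event t.1 t.2).
  apply: le_trans (_ : \sum_(t | ktuple t) p ^+ 3 * pi <= _).
    by rewrite sumr_const card_ktuple -[_ *+ _]mulr_natl /Y mulrCA.
  by apply: ler_sum => t; apply: ktuple_ge.
have second : \sum_(t | ktuple t) \sum_(t' | ktuple t')
    Pr p (fun f : bits => good_event t.1 t.2 f && good_event t'.1 t'.2 f) <=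
    Y * (D1 + D2 * Y).
  apply: le_trans (_ : \sum_(t | ktuple t) (D1 * pi + D2 * (M * pi ^+ 2)) <= _).
    by apply: ler_sum => t; apply: pair_sum.
  rewrite sumr_const card_ktuple -[_ *+ _]mulr_natl /Y le_eqVlt; apply/orP; left; apply/eqP.
  by ring.
have := @Pr_second_moment _ p _ _ ktuple (fun t => good_event t.1 t.2) a pw.
rewrite gnp_goodE; set P1 := Pr p _ => hP.
have P12 : P1 <= Pr p (fun f : bits => [exists t : tuple, good_event t.1 t.2 f]).
  apply: Pr_le => // f /existsP[t /andP[_ g]]; by apply/existsP; exists t.
apply: le_trans P12; apply: le_trans hP.
have b1 := ler_wpM2l a0 mean.
have b2 := ler_wpM2l (sqr_ge0 a) second.
have E1 : a * (p ^+ 3 * Y) = p ^+ 6 * Y / (D1 + D2 * Y).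
  by rewrite /a; move: DY; set Z := D1 + _ => Z0; field; rewrite gt_eqF.
have E2 : a ^+ 2 * (Y * (D1 + D2 * Y)) = p ^+ 6 * Y / (D1 + D2 * Y).
  by rewrite /a; move: DY; set Z := D1 + _ => Z0; field; rewrite gt_eqF.
rewrite E1 in b1; rewrite E2 in b2.
(* Y / (D1 + D2 Y) increases with [Y], so [Y] may be replaced by its lower bound [c]. *)
apply: le_trans (_ : p ^+ 6 * Y / (D1 + D2 * Y) <= _).
  rewrite ler_pdivrMr // [leRHS]mulrAC ler_pdivlMr // -[X in X <= _]mulrA -[X in _ <= X]mulrA.
  apply: ler_wpM2l; first by rewrite exprn_ge0 // ltW.
  have := ler_wpM2l (ltW D10) Yc; lra.
move: b1 b2; rewrite -[2 * a * _]mulrA; lra.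
Qed.

End SecondMoment.

(** * First moment *)

Section FirstMoment.
Variables (R : realType) (p : R) (n : nat).
Hypothesis p01 : 0 < p < 1.
Local Notation q := (1 - p).
Notation bits := {ffun {set 'I_n} -> bool}.
Notation tuple := ({ffun 'I_n -> option 'I_3} * {ffun 'I_3 -> 'I_n})%type.
Implicit Types (t : tuple).

Let pw : 0 <= p <= 1. Proof. by case/andP: p01 => ? ?; rewrite !ltW. Qed.
Let q0 : 0 < q. Proof. by rewrite subr_gt0; case/andP: p01. Qed.
Let q1 : q <= 1. Proof. by rewrite gerBl; case/andP: pw. Qed.

Definition ncolor k l m := ('C(n, k) * ('C(n - k, l) * 'C(n - k - l, m)))%N.

Lemma ncolor_fact k l m : (ncolor k l m * (k`! * l`! * m`!) = n ^_ (k + l + m))%N.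
Proof.
by rewrite /ncolor !ffactD -!bin_ffact subnDA; ring.
Qed.

Lemma ncolorCA k l m : ncolor k l m = ncolor l k m.
Proof.
apply/eqP; rewrite -(@eqn_pmul2r (k`! * l`! * m`!)) ?muln_gt0 ?fact_gt0 //.
by rewrite ncolor_fact [(k`! * _)%N]mulnC ncolor_fact [(k + _)%N]addnC.
Qed.

Lemma ncolorAC k l m : ncolor k l m = ncolor k m l.
Proof.
apply/eqP; rewrite -(@eqn_pmul2r (k`! * l`! * m`!)) ?muln_gt0 ?fact_gt0 //.
by rewrite ncolor_fact mulnAC ncolor_fact addnAC.
Qed.

(** Bounds the expected number of tuples of these sizes, up to the factor q^(-3) for the three root
    edges. *)
Definition union_term k l m : R :=
  (ncolor k l m * (k * l * m))%:R * (q ^+ (k * l + k * m + l * m) *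
    ((1 - q ^+ k) * (1 - q ^+ l) * (1 - q ^+ m)) ^+ (n - (k + l + m))).

Lemma termCA k l m : union_term k l m = union_term l k m.
Proof.
rewrite /union_term ncolorCA [(k + l)%N]addnC [(1 - q ^+ k) * _]mulrC [(k * l)%N]mulnC.
by rewrite [(l * k + k * m + _)%N]addnAC.
Qed.

Lemma termAC k l m : union_term k l m = union_term k m l.
Proof.
rewrite /union_term ncolorAC [(k + l + m)%N]addnAC [(1 - q ^+ k) * _ * _]mulrAC [(k * l * m)%N]mulnAC.
by rewrite [(k * l + k * m)%N]addnC [(l * m)%N]mulnC.
Qed.

Lemma first_moment : q ^+ 3 * gnp_good p n <=
  \sum_(ks : {ffun 'I_3 -> 'I_n.+1} |
     [&& [forall i, 0 < ks i]%N &
       (ks ord0 + ks (lift ord0 ord0) + ks (lift ord0 (lift ord0 ord0)) <= n)%N])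
    union_term (ks ord0) (ks (lift ord0 ord0)) (ks (lift ord0 (lift ord0 ord0))).
Proof.
set i0 : 'I_3 := ord0; set i1 : 'I_3 := lift ord0 ord0.
set i2 : 'I_3 := lift ord0 (lift ord0 ord0).
pose F t : R := q ^+ #|crossing t.1| * (\prod_i (1 - q ^+ #|cls t.1 i|)) ^+ #|free t.1|.
apply: (@le_trans _ _ (\sum_(t | rooted t.1 t.2) F t)).
  rewrite gnp_goodE.
  apply: (@le_trans _ _ (q ^+ 3 * \sum_(t | rooted t.1 t.2) Pr p (good_event t.1 t.2))).
    apply: ler_wpM2l; first by rewrite exprn_ge0 // ltW.
    apply: le_trans (Pr_union pw _ _); apply: Pr_le => // f /existsP[t g].
    by apply/existsP; exists t; rewrite g andbT; case/and3P: g.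
  by rewrite mulr_sumr; apply: ler_sum => t rt; apply: Pr_good_event_le.
pose sz t : {ffun 'I_3 -> 'I_n.+1} := [ffun i => inord #|cls t.1 i|].
have szE t i : sz t i = #|cls t.1 i| :> nat.
  by rewrite ffunE inordK // ltnS -[leqRHS]card_ord max_card.
have sum3 (G : 'I_3 -> nat) : (\sum_i G i = G i0 + G i1 + G i2)%N.
  by rewrite !big_ord_recl big_ord0 addn0 addnA.
rewrite (partition_big sz (fun ks =>
  [&& [forall i, 0 < ks i]%N & (ks i0 + ks i1 + ks i2 <= n)%N])) /=; last first.
  move=> t /forallP rt; apply/andP; split.
    by apply/forallP => i; rewrite szE; apply/card_gt0P; exists (t.2 i); rewrite inE.
  by rewrite !szE -(sum3 (fun i => #|cls t.1 i|)) -[leqRHS](card_free t.1) leq_addl.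
apply: ler_sum => ks _.
rewrite (eq_bigr (fun=> q ^+ (ks i0 * ks i1 + ks i0 * ks i2 + ks i1 * ks i2) *
    ((1 - q ^+ ks i0) * (1 - q ^+ ks i1) * (1 - q ^+ ks i2)) ^+ (n - (ks i0 + ks i1 + ks i2)))).
  rewrite sumr_const /union_term -[_ *+ #|_|]mulr_natl.
  apply: ler_wpM2r.
    have h i : 0 <= 1 - q ^+ ks i by rewrite subr_ge0 exprn_ile1 // ltW.
    by rewrite mulr_ge0 ?exprn_ge0 ?mulr_ge0 // ltW.
  rewrite ler_nat.
  have := card_pairs n (fun i => ks i : nat).
  rewrite card_sized !big_ord_recl big_ord0 muln1 [(ks _ * (_ * _))%N]mulnA => <-.
  apply/subset_leq_card/fintype.subsetP => t /andP[rt /eqP <-].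
  by rewrite inE rt andbT; apply/forallP => i; rewrite szE.
move=> t /andP[rt /eqP <-]; rewrite /F !szE; congr (_ ^+ _ * _ ^+ _).
- apply/eqP; rewrite -(eqn_pmul2l (isT : (0 < 2)%N)) card_crossing.
  by apply/eqP; rewrite sum3 (big_mkcond (fun j => j != i0)) (big_mkcond (fun j => j != i1))
    (big_mkcond (fun j => j != i2)) !sum3 /=; clear; lia.
- by rewrite !big_ord_recl big_ord0 mulr1 mulrA.
- by rewrite -(sum3 (fun i => #|cls t.1 i|)); have := card_free t.1; clear; lia.
Qed.

End FirstMoment.

(** * Poisson weights and their tails *)

Section Poisson.
Variable R : realType.
Implicit Types (y e t : R) (j : nat).

Definition pois j y : R := y ^+ j * expR (- y) / j`!%:R.

Lemma fact_gt0R j : 0 < j`!%:R :> R.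
Proof. by rewrite ltr0n fact_gt0. Qed.

Lemma pois_ge0 j y : 0 <= y -> 0 <= pois j y.
Proof. by move=> y0; rewrite !mulr_ge0 ?exprn_ge0 ?expR_ge0 ?invr_ge0 ?ler0n. Qed.

Lemma pois_le1 j y : 0 <= y -> pois j y <= 1.
Proof.
move=> y0; rewrite /pois ler_pdivrMr ?fact_gt0R // mul1r expRN ler_pdivrMr ?expR_gt0 //.
rewrite mulrC -ler_pdivrMr ?fact_gt0R //.
case: j => [|j]; first by rewrite expr0 divr1 -expR0 ler_expR.
by have := @expR_ge1Dxn R y j y0; lra.
Qed.

(** The function t exp(1 - t) increases up to t = 1 and decreases afterwards; this is its maximum
    over t >= 0 at distance at least [e] from 1, attained at 1 - e or 1 + e. *)
Definition pois_rate e : R := Num.max ((1 - e) * expR e) ((1 + e) * expR (- e)).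

Lemma pois_rate_lt1 e : 0 < e < 1 -> 0 < pois_rate e < 1.
Proof.
move=> /andP[e0 e1]; rewrite lt_max mulr_gt0 ?expR_gt0 ?subr_gt0 //= gt_max.
have h1 : 1 - e < expR (- e) by apply: expR_gt1Dx; rewrite oppr_eq0 gt_eqF.
have h2 : 1 + e < expR e by apply: expR_gt1Dx; rewrite gt_eqF.
apply/andP; split.
  by rewrite -ltr_pdivlMr ?expR_gt0 // div1r -expRN.
by rewrite expRN ltr_pdivrMr ?expR_gt0 // mul1r.
Qed.

Lemma mul_expR_le1 t : t * expR (1 - t) <= 1.
Proof.
have := expR_ge1Dx (t - 1); rewrite addrC subrK => h.
have E : expR (t - 1) * expR (1 - t) = 1 :> R by rewrite -expRD -(opprB t) subrr expR0.
by rewrite -[leRHS]E ler_wpM2r ?expR_ge0.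
Qed.

Lemma pois_rate_le e t : 0 < e < 1 -> 0 <= t -> t <= 1 - e \/ 1 + e <= t ->
  t * expR (1 - t) <= pois_rate e.
Proof.
move=> /andP[e0 e1] t0 H; rewrite le_max; case: H => H; apply/orP; [left|right].
  have d0 : 0 < 1 - e by rewrite subr_gt0.
  (* Writing t = (1 - e) s splits off (1 - e) exp(e); the rest, s exp((1 - e)(1 - s)), is at most s
     exp(1 - s) <= 1 because s <= 1. *)
  pose s := t / (1 - e); have tE : t = (1 - e) * s by rewrite mulrC divfK // gt_eqF.
  have s1 : s <= 1 by rewrite ler_pdivrMr // mul1r.
  have s0 : 0 <= s by rewrite divr_ge0 // ltW.
  have -> : expR (1 - t) = expR e * expR ((1 - e) * (1 - s)).
    by rewrite -expRD tE; congr expR; ring.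
  rewrite tE mulrACA; apply: ler_piMr; first by rewrite mulr_ge0 ?expR_ge0 // ltW.
  apply: le_trans (mul_expR_le1 s); apply: ler_wpM2l => //; rewrite ler_expR; nra.
have d0 : 0 < 1 + e by rewrite addr_gt0.
pose s := t / (1 + e); have tE : t = (1 + e) * s by rewrite mulrC divfK // gt_eqF.
have s1 : 1 <= s by rewrite ler_pdivlMr // mul1r.
have s0 : 0 <= s by lra.
have -> : expR (1 - t) = expR (- e) * expR ((1 + e) * (1 - s)).
  by rewrite -expRD tE; congr expR; ring.
rewrite tE mulrACA; apply: ler_piMr; first by rewrite mulr_ge0 ?expR_ge0 // ltW.
apply: le_trans (mul_expR_le1 s); apply: ler_wpM2l => //; rewrite ler_expR; nra.
Qed.

(** With t = y / j, the bound j! >= (j / e)^j shows that the weight is at most (t exp(1 - t))^j. *)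
Lemma pois_tail e j y : 0 < e < 1 -> (0 < j)%N -> 0 <= y ->
  y <= (1 - e) * j%:R \/ (1 + e) * j%:R <= y -> pois j y <= pois_rate e ^+ j.
Proof.
move=> e01 j0 y0 H; have jR : 0 < j%:R :> R by rewrite ltr0n.
pose t := y / j%:R; have yE : y = t * j%:R by rewrite divfK // gt_eqF.
have t0 : 0 <= t by rewrite divr_ge0 // ltW.
have h : t * expR (1 - t) <= pois_rate e.
  by apply: pois_rate_le => //; case: H => H; [left; rewrite ler_pdivrMr|right; rewrite ler_pdivlMr].
apply: le_trans (_ : (t * expR (1 - t)) ^+ j <= _); last first.
  by apply: lerXn2r; rewrite ?nnegrE ?mulr_ge0 ?expR_ge0 // (le_trans _ h) ?mulr_ge0 ?expR_ge0.
rewrite /pois ler_pdivrMr ?fact_gt0R // exprMn -expRM_natl.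
have -> : y ^+ j * expR (- y) = t ^+ j * (expR (- y) * j%:R ^+ j).
  by rewrite {1}yE exprMn; ring.
rewrite -mulrA; apply: ler_wpM2l; first exact: exprn_ge0.
apply: le_trans (ler_wpM2l (expR_ge0 _) (fact_ge_expR R j)) _.
rewrite mulrA -expRD ler_wpM2r ?ler0n // ler_expR yE.
by rewrite le_eqVlt; apply/orP; left; apply/eqP; ring.
Qed.

End Poisson.

(** * The union bound for a single triple of sizes *)

Section TermBounds.
Variables (R : realType) (p : R) (n : nat).
Hypothesis p01 : 0 < p < 1.
Local Notation q := (1 - p).
Local Notation term k l m := (union_term p n k l m).

Let p0 : 0 < p. Proof. by case/andP: p01. Qed.
Let q0 : 0 < q. Proof. by rewrite subr_gt0; case/andP: p01. Qed.
Let q0' : 0 <= q. Proof. exact: ltW. Qed.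
Let q1 : q <= 1. Proof. by rewrite gerBl ltW. Qed.
Let qj0 j : 0 <= q ^+ j. Proof. exact: exprn_ge0. Qed.
Let qj1 j : 0 <= 1 - q ^+ j. Proof. by rewrite subr_ge0 exprn_ile1. Qed.
Let qjB j : 1 - q ^+ j <= 1. Proof. by rewrite gerBl. Qed.

Lemma ncolor_le k l m : (ncolor n k l m <= n ^ (k + l + m))%N.
Proof.
apply: leq_trans (ffact_le_exp n _); rewrite -ncolor_fact.
by rewrite leq_pmulr // !muln_gt0 !fact_gt0.
Qed.

Lemma klm_le k l m : (k + l + m <= n)%N -> ((k * l * m)%:R : R) <= n%:R ^+ 3.
Proof.
by move=> s; rewrite -natrX ler_nat (_ : n ^ 3 = n * n * n)%N ?leq_mul //; lia.
Qed.

Lemma term_le_crude k l m : (k + l + m <= n)%N ->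
  term k l m <= n%:R ^+ 3 * (n%:R ^+ (k + l + m) * q ^+ (k * l + k * m + l * m)).
Proof.
move=> s; rewrite /union_term natrM.
have -> : n%:R ^+ 3 * (n%:R ^+ (k + l + m) * q ^+ (k * l + k * m + l * m)) =
  n%:R ^+ (k + l + m) * n%:R ^+ 3 * (q ^+ (k * l + k * m + l * m) * 1) by ring.
apply: ler_pM; rewrite ?mulr_ge0 ?exprn_ge0 ?mulr_ge0 //.
  by apply: ler_pM => //; [rewrite -natrX ler_nat ncolor_le|exact: klm_le].
apply: ler_wpM2l => //; apply: exprn_ile1; first by rewrite !mulr_ge0.
have h : (1 - q ^+ k) * (1 - q ^+ l) <= 1.
  by rewrite -[leRHS]mulr1; apply: ler_pM.
by rewrite -[leRHS]mulr1; apply: ler_pM => //; rewrite mulr_ge0.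
Qed.

(** The last exponential corrects for the k + l + m vertices inside the sets, which need not be
    dominated. *)
Lemma term_le_pois k l m : (k + l + m <= n)%N ->
  term k l m <= (k * l * m)%:R *
    (pois l (n%:R * q ^+ k) * pois m (n%:R * q ^+ l) * pois k (n%:R * q ^+ m)) *
    expR ((k + l + m)%:R * (q ^+ k + q ^+ l + q ^+ m)).
Proof.
move=> s; rewrite /union_term natrM.
have f0 j : 0 < j`!%:R :> R := fact_gt0R R j.
have hN : (ncolor n k l m)%:R <= n%:R ^+ (k + l + m) / (k`!%:R * l`!%:R * m`!%:R) :> R.
  rewrite ler_pdivlMr ?mulr_gt0 // -!natrM -natrX ler_nat ncolor_fact.
  exact: ffact_le_exp.
set Q := q ^+ k + q ^+ l + q ^+ m.
have hE : ((1 - q ^+ k) * (1 - q ^+ l) * (1 - q ^+ m)) ^+ (n - (k + l + m)) <=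
    expR (- ((n%:R - (k + l + m)%:R) * Q)).
  rewrite -natrB // -mulrN expRM_natl; apply: lerXn2r.
  - by rewrite nnegrE !mulr_ge0.
  - by rewrite nnegrE expR_ge0.
  - rewrite /Q !opprD !expRD.
    by do !(apply: ler_pM; rewrite ?mulr_ge0 //); exact: expR_ge1Dx.
apply: le_trans (_ : n%:R ^+ (k + l + m) / (k`!%:R * l`!%:R * m`!%:R) * (k * l * m)%:R *
   (q ^+ (k * l + k * m + l * m) * expR (- ((n%:R - (k + l + m)%:R) * Q))) <= _).
  apply: ler_pM; rewrite ?mulr_ge0 ?exprn_ge0 ?mulr_ge0 //.
    by apply: ler_wpM2r.
  by apply: ler_wpM2l.
have -> : expR (- ((n%:R - (k + l + m)%:R) * Q)) = expR ((k + l + m)%:R * Q) *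
   (expR (- (n%:R * q ^+ k)) * expR (- (n%:R * q ^+ l)) * expR (- (n%:R * q ^+ m))).
  by rewrite -!expRD /Q; congr expR; ring.
rewrite /pois !exprMn -!exprM !exprD [(m * k)%N]mulnC.
rewrite le_eqVlt; apply/orP; left; apply/eqP; field.
by rewrite !gt_eqF.
Qed.

Section Sorted.
Variable e : R.
Hypothesis e01 : 0 < e < 1.
Hypothesis q_window : q * (1 + e) <= 1 - e.
Hypothesis window : forall j, (0 < j)%N ->
  n%:R * q ^+ j <= (1 - e) * j%:R \/ (1 + e) * j%:R <= n%:R * q ^+ j.

Local Notation rho := (pois_rate e).

(* Only [l = m] can make both the [m]- and the [k]-factor typical, and then
   [window] excludes it. *)
Lemma pois_prod_le k l m : (0 < l)%N -> (l <= m)%N -> (m <= k)%N ->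
  pois l (n%:R * q ^+ k) * pois m (n%:R * q ^+ l) * pois k (n%:R * q ^+ m) <= rho ^+ l.
Proof.
move=> l0 lm mk; have /andP[r0 r1] := pois_rate_lt1 e01.
have nq j : 0 <= n%:R * q ^+ j by rewrite mulr_ge0.
have m0 : (0 < m)%N by exact: leq_trans lm.
have rle j : (l <= j)%N -> rho ^+ j <= rho ^+ l.
  by move=> lj; apply: ler_wiXn2l => //; exact: ltW.
have P0 i j : 0 <= pois i (n%:R * q ^+ j) := pois_ge0 i (nq j).
have P1 i j : pois i (n%:R * q ^+ j) <= 1 := pois_le1 i (nq j).
suff [H|H] : pois m (n%:R * q ^+ l) <= rho ^+ l \/ pois k (n%:R * q ^+ m) <= rho ^+ l.
- rewrite mulrAC -[leRHS]mul1r; apply: ler_pM => //; [exact: mulr_ge0|exact: mulr_ile1].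
- rewrite -[leRHS]mul1r; apply: ler_pM => //; [exact: mulr_ge0|exact: mulr_ile1].
move: lm; rewrite leq_eqVlt => /predU1P[lm|lm].
  by left; rewrite -lm; apply: pois_tail => //; exact: window.
have [H|H] := lerP ((1 + e) * m%:R) (n%:R * q ^+ l).
  by left; apply: le_trans (rle m _); [apply: pois_tail => //; right|exact: ltnW].
right; apply: le_trans (rle k _); last by apply: leq_trans mk; exact: ltnW.
apply: pois_tail => //; first exact: leq_trans mk.
left; have e1 : 0 <= 1 - e by case/andP: e01; lra.
have mkR : m%:R <= k%:R :> R by rewrite ler_nat.
apply: le_trans (ler_wpM2l e1 mkR).
(* As l < m, q^m <= q q^l; then [q_window] carries a value below (1 + e) m to one below (1 - e)
   m. *)
apply: le_trans (_ : q * (n%:R * q ^+ l) <= _).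
  rewrite mulrCA -exprS; apply: ler_wpM2l => //; exact: ler_wiXn2l.
apply: le_trans (ler_wpM2l q0' (ltW H)) _.
by rewrite mulrA ler_wpM2r.
Qed.

(** By [n_upper] and [n_lower], the logarithm of [n] to base 1 / q lies between K and 2 K. The
    square root [sg] is used because typical sizes are only known to be at least K / 2. *)
Variables (K : nat) (sg : R).
Hypothesis K0 : (0 < K)%N.
Hypotheses (sg0 : 0 < sg) (sg2 : sg ^+ 2 = rho).
Hypothesis n_upper : n%:R * q ^+ (2 * K) <= 1.
Hypothesis n_lower : 1 <= n%:R * q ^+ K.
Hypothesis n80 : (80 * K <= n)%N.
Hypothesis K_exp : expR (- p / 2) ^+ K <= q ^+ 92 / 2.
Hypothesis K6 : K%:R ^+ 6 * q ^+ K <= 1.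
Hypothesis K600 : K%:R ^+ 600 * (q ^+ 8) ^+ K <= 2^-1.
Hypothesis K4 : 900 * (K%:R ^+ 4 * q ^+ K) <= 1.

Let n0 : (0 < n)%N. Proof. by apply: leq_trans n80; rewrite muln_gt0. Qed.
Let n1 : 1 <= n%:R :> R. Proof. by rewrite ler1n. Qed.

Lemma n_pow_le i j : n%:R ^+ i * q ^+ (2 * K * i + j) <= q ^+ j.
Proof.
rewrite exprD mulrA exprM -exprMn; apply: ler_piMl => //.
by apply: exprn_ile1 => //; apply: mulr_ge0.
Qed.

(** The k m >= 20 K k pairs between the two larger sets are enough: the crude count n^(6 + 3k) and
    the margin q^(2K) together ask for an exponent 14 K + 6 K k <= 20 K k. *)
Lemma term_two_large k l m : (l <= m)%N -> (m <= k)%N -> (k + l + m <= n)%N ->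
  (20 * K <= m)%N -> n%:R ^+ 3 * term k l m <= q ^+ (2 * K).
Proof.
move=> lm mk s mK.
have n3 : 0 <= n%:R ^+ 3 :> R by apply: exprn_ge0.
apply: le_trans (ler_wpM2l n3 (term_le_crude s)) _.
apply: le_trans (_ : n%:R ^+ (6 + 3 * k) * q ^+ (2 * K * (6 + 3 * k) + 2 * K) <= _); last first.
  exact: n_pow_le.
rewrite mulrA -exprD mulrA -exprD; apply: ler_pM; rewrite ?exprn_ge0 //.
  by apply: ler_weXn2l => //; move: lm mk; clear; lia.
apply: ler_wiXn2l => //; apply: (@leq_trans (m * k)).
  apply: (@leq_trans (20 * K * k)); last by rewrite leq_mul2r mK orbT.
  have : (K <= K * k)%N.
    by rewrite leq_pmulr // (leq_trans _ mk) // (leq_trans _ mK) // muln_gt0.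
  rewrite mulnDr -!mulnA; set a := (K * k)%N; rewrite [(K * (3 * k))%N]mulnCA -/a.
  by clear; lia.
by rewrite [(m * k)%N]mulnC -addnA addnCA leq_addr.
Qed.

Lemma half_pow2 : (2^-1 : R) ^+ (K ^ 2) <= 2^-1 ^+ K.
Proof.
by apply: ler_wiXn2l; rewrite ?invr_ge0 ?invf_le1 ?ler1n // -mulnn leq_pmulr.
Qed.

(** Once the sets of sizes [l] and [m] are fixed, each of the other [n'] vertices either lies in the
    third set, with weight q^(l + m), or is dominated by both; [B] adds the two weights, and by the
    binomial theorem B^n' bounds the sum over all third sets. As B <= 1 - p q^l, the resulting exp(-
    p K^3 / 2) beats n^(46 K) <= q^(-92 K^2). *)
Lemma term_small_dominates k l m : (0 < m)%N -> (l <= m)%N -> (k + l + m <= n)%N ->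
  (m < 20 * K)%N -> K%:R ^+ 3 <= n%:R * q ^+ l ->
  n%:R ^+ 3 * term k l m <= 2^-1 ^+ K.
Proof.
move=> m0 lm s mK hl.
have n3 : 0 <= n%:R ^+ 3 :> R by apply: exprn_ge0.
pose n' := (n - l - m)%N.
pose B := q ^+ (l + m) + (1 - q ^+ l) * (1 - q ^+ m).
have hT : term k l m <= n%:R ^+ 3 * (n%:R ^+ (l + m) * B ^+ n').
  rewrite /union_term; set X := q ^+ _ * _.
  have X0 : 0 <= X by rewrite mulr_ge0 // exprn_ge0 // !mulr_ge0.
  have -> : (ncolor n k l m * (k * l * m))%:R * X =
      (k * l * m)%:R * ((ncolor n l m k)%:R * X) :> R.
    by rewrite ncolorCA ncolorAC natrM; ring.
  apply: ler_pM => //; [exact: mulr_ge0|exact: klm_le|].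
  have N_le : (ncolor n l m k <= n ^ (l + m) * 'C(n', k))%N.
    rewrite /ncolor expnD mulnA; apply: leq_mul => //.
    apply: leq_mul; first exact: bin_le_exp.
    apply: leq_trans (bin_le_exp _ _) _; by rewrite leq_exp2r // leq_subr.
  have X_le : X <= (q ^+ (l + m)) ^+ k * ((1 - q ^+ l) * (1 - q ^+ m)) ^+ (n' - k).
    rewrite /X -exprM; apply: ler_pM; rewrite ?exprn_ge0 ?mulr_ge0 //.
      by apply: ler_wiXn2l => //; move: (leq_addl (l * m) ((l + m) * k)); clear; lia.
    have -> : (n - (k + l + m) = n' - k)%N by rewrite /n'; clear; lia.
    apply: lerXn2r; rewrite ?nnegrE ?mulr_ge0 //.
    by rewrite -mulrA; apply: ler_piMl; rewrite ?mulr_ge0.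
  apply: le_trans (_ : (n ^ (l + m) * 'C(n', k))%:R *
     ((q ^+ (l + m)) ^+ k * ((1 - q ^+ l) * (1 - q ^+ m)) ^+ (n' - k)) <= _).
    by apply: ler_pM => //; rewrite ler_nat.
  rewrite natrM natrX -mulrA; apply: ler_wpM2l; first exact: exprn_ge0.
  have kn' : (k < n'.+1)%N by rewrite ltnS /n'; move: s; clear; lia.
  rewrite /B [q ^+ _ + _]addrC [(_ + q ^+ (l + m)) ^+ n']exprDn (bigD1 (Ordinal kn')) //=.
  rewrite -[(_ * _) *+ 'C(_, _)]mulr_natl.
  rewrite [(q ^+ (l + m)) ^+ k * _]mulrC lerDl; apply: sumr_ge0 => j _.
  by rewrite mulrn_wge0 // mulr_ge0 ?exprn_ge0 ?mulr_ge0.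
have hB : B <= 1 - p * q ^+ l.
  have h1 : q ^+ (l + m) <= q * q ^+ l.
    by rewrite addnC exprD; apply: ler_wpM2r => //; rewrite -[leRHS]expr1; apply: ler_wiXn2l.
  have h2 : q ^+ (l + m) <= q ^+ m.
    by apply: ler_wiXn2l => //; exact: leq_addl.
  rewrite /B; have -> : (1 - q ^+ l) * (1 - q ^+ m) = 1 - q ^+ l - q ^+ m + q ^+ (l + m).
    by rewrite exprD; ring.
  lra.
have B0 : 0 <= B by rewrite addr_ge0 // mulr_ge0.
have ql01 : 0 <= p * q ^+ l <= 1.
  by rewrite mulr_ge0 ?(ltW p0) //= mulr_ile1 ?(ltW p0) ?exprn_ile1 // ltW //; case/andP: p01.
have hBn : B ^+ n' <= expR (- (n'%:R * (p * q ^+ l))).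
  apply: le_trans (_ : (1 - p * q ^+ l) ^+ n' <= _); last exact: exprB1_le_expR.
  by apply: lerXn2r; rewrite ?nnegrE // (le_trans B0).
(* By [n80], l + m < 40 K <= n / 2. *)
have n'2 : n%:R <= 2 * n'%:R :> R.
  by rewrite -natrM ler_nat /n'; move: n80 mK lm; clear; lia.
have hE : B ^+ n' <= (expR (- p / 2) ^+ K) ^+ (K ^ 2).
  apply: le_trans hBn _; rewrite -exprM -expRM_natl ler_expR.
  have -> : (K * K ^ 2 = K ^ 3)%N by rewrite expnS.
  rewrite natrX.
  have a1 : 2 * n'%:R * q ^+ l >= K%:R ^+ 3.
    by apply: le_trans hl _; apply: ler_wpM2r.
  have := ler_wpM2l (ltW p0) a1; lra.
have hE' : B ^+ n' <= q ^+ (92 * K ^ 2) * 2^-1 ^+ K.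
  apply: le_trans hE _.
  apply: le_trans (_ : (q ^+ 92 / 2) ^+ (K ^ 2) <= _).
    by apply: lerXn2r; rewrite ?nnegrE ?exprn_ge0 ?expR_ge0 // mulr_ge0 ?invr_ge0.
  by rewrite exprMn -exprM; apply: ler_wpM2l => //; exact: half_pow2.
apply: le_trans (ler_wpM2l n3 hT) _.
(* 3 + 3 + l + m <= 46 K, as l <= m < 20 K and K >= 1. *)
apply: le_trans (_ : n%:R ^+ (46 * K) * (q ^+ (92 * K ^ 2) * 2^-1 ^+ K) <= _).
  have -> : n%:R ^+ 3 * (n%:R ^+ 3 * (n%:R ^+ (l + m) * B ^+ n')) =
      n%:R ^+ (3 + 3 + (l + m)) * B ^+ n' by rewrite !(exprD n%:R); ring.
  apply: ler_pM; rewrite ?exprn_ge0 //.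
  by apply: ler_weXn2l => //; move: K0 mK lm; clear; lia.
rewrite mulrA; apply: ler_piMl; first by rewrite exprn_ge0 ?invr_ge0.
have := n_pow_le (46 * K) 0; rewrite expr0 addn0.
by rewrite (_ : 2 * K * (46 * K) = 92 * K ^ 2)%N //; rewrite -mulnn; ring.
Qed.

Let qK : n%:R^-1 <= q ^+ K.
Proof. by rewrite -div1r ler_pdivrMr ?ltr0n // mulrC. Qed.

(** Each of the [k] vertices of the third set costs n q^(l + m) <= (n q^l)^2 / n <= K^6 q^K. With k
    >= 100 K this yields q^(100 K^2), of which 92 K^2 pay for n^(46 K) and 8 K^2 for K^(600 K). *)
Lemma term_large_third k l m : (l <= m)%N -> (k + l + m <= n)%N ->
  (m < 20 * K)%N -> n%:R * q ^+ l <= K%:R ^+ 3 -> (100 * K <= k)%N ->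
  n%:R ^+ 3 * term k l m <= 2^-1 ^+ K.
Proof.
move=> lm s mK hl hk.
have n3 : 0 <= n%:R ^+ 3 :> R by apply: exprn_ge0.
have nql0 : 0 <= n%:R * q ^+ l by apply: mulr_ge0.
have g0 : 0 <= n%:R * q ^+ (l + m) by apply: mulr_ge0.
have gK : n%:R * q ^+ (l + m) <= K%:R ^+ 6 * q ^+ K.
  apply: le_trans (_ : (n%:R * q ^+ l) * (n%:R * q ^+ l) * n%:R^-1 <= _).
    have -> : n%:R * q ^+ l * (n%:R * q ^+ l) * n%:R^-1 = n%:R * q ^+ (l + l).
      by rewrite exprD; field; rewrite gt_eqF // ltr0n.
    by apply: ler_wpM2l => //; apply: ler_wiXn2l => //; rewrite leq_add2l.
  apply: ler_pM; rewrite ?invr_ge0 ?mulr_ge0 //.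
  by rewrite (exprD _ 3 3); apply: ler_pM.
have g1 : n%:R * q ^+ (l + m) <= 1 by apply: le_trans gK K6.
have gk : (n%:R * q ^+ (l + m)) ^+ k <= (K%:R ^+ 6 * q ^+ K) ^+ (100 * K).
  apply: le_trans (_ : (n%:R * q ^+ (l + m)) ^+ (100 * K) <= _).
    exact: ler_wiXn2l.
  by apply: lerXn2r; rewrite ?nnegrE ?mulr_ge0 ?exprn_ge0.
apply: le_trans (ler_wpM2l n3 (term_le_crude s)) _.
apply: le_trans (_ : n%:R ^+ (46 * K) * (K%:R ^+ 6 * q ^+ K) ^+ (100 * K) <= _).
  apply: le_trans (_ : n%:R ^+ (3 + 3 + (l + m)) * (n%:R * q ^+ (l + m)) ^+ k <= _).
    apply: le_trans (_ : n%:R ^+ (3 + 3 + (l + m)) * (n%:R ^+ k * q ^+ (k * l + k * m)) <= _).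
      apply: le_trans (_ : n%:R ^+ 3 * (n%:R ^+ 3 * (n%:R ^+ (k + l + m) * q ^+ (k * l + k * m))) <= _).
        do 3 (apply: ler_wpM2l; first exact: exprn_ge0).
        by apply: ler_wiXn2l => //; exact: leq_addr.
      by rewrite le_eqVlt; apply/orP; left; apply/eqP; rewrite !(exprD n%:R); ring.
    by rewrite exprMn -exprM mulnDl [(l * k)%N]mulnC [(m * k)%N]mulnC.
  apply: ler_pM; rewrite ?exprn_ge0 //.
  by apply: ler_weXn2l => //; move: K0 mK lm; clear; lia.
have -> : (K%:R ^+ 6 * q ^+ K) ^+ (100 * K) =
    q ^+ (2 * K * (46 * K) + 0) * (K%:R ^+ 600 * (q ^+ 8) ^+ K) ^+ K.
  have e1 : (K%:R ^+ 6) ^+ (100 * K) = (K%:R ^+ 600) ^+ K :> R.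
    by rewrite -(exprM _ 6) -(exprM _ 600); congr (_ ^+ _); rewrite mulnA.
  have e2 : (q ^+ K) ^+ (100 * K) = q ^+ (2 * K * (46 * K) + 0) * ((q ^+ 8) ^+ K) ^+ K.
    by rewrite -(exprM q 8) -(exprM q K) -(exprM q (8 * K)) -exprD; congr (_ ^+ _); ring.
  by rewrite [(_ * q ^+ K) ^+ _]exprMn e1 e2 [(_ * (q ^+ 8) ^+ K) ^+ K]exprMn; exact: mulrCA.
rewrite mulrA -[leRHS]mul1r; apply: ler_pM.
- by rewrite mulr_ge0 // exprn_ge0.
- by rewrite exprn_ge0 // mulr_ge0 ?exprn_ge0.
- by have := n_pow_le (46 * K) 0; rewrite expr0.
- by apply: lerXn2r; rewrite ?nnegrE ?invr_ge0 // mulr_ge0 ?exprn_ge0.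
Qed.

(** From n q^l <= K^3 follow q^l <= K^3 q^K and, by [K6], l >= K / 2, hence rho^l <= sg^K. The
    correction exponent is at most 300 K times 3 K^3 q^K, which [K4] bounds by 1. *)
Lemma term_typical k l m : (0 < l)%N -> (l <= m)%N -> (m <= k)%N -> (k + l + m <= n)%N ->
  n%:R * q ^+ l <= K%:R ^+ 3 -> (k < 100 * K)%N ->
  term k l m <= (100 * K)%:R ^+ 3 * (expR 1 * sg ^+ K).
Proof.
move=> l0 lm mk s hl hk.
have m0 : (0 < m)%N by apply: leq_trans lm.
have k0 : (0 < k)%N by apply: leq_trans mk.
have nql0 : 0 <= n%:R * q ^+ l by apply: mulr_ge0.
have /andP[r0 r1] := pois_rate_lt1 e01.
have qlK : q ^+ l <= K%:R ^+ 3 * q ^+ K.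
  apply: le_trans (_ : (n%:R * q ^+ l) * n%:R^-1 <= _).
    by rewrite mulrAC mulfV ?mul1r // gt_eqF // ltr0n.
  by apply: ler_pM; rewrite ?invr_ge0.
have l2 : (K <= 2 * l)%N.
  rewrite leqNgt; apply/negP => lK.
  have h1 : q ^+ K < q ^+ (2 * l) by rewrite ltr_iXn2l //; case/andP: p01 => + _; lra.
  have h2 : q ^+ (2 * l) <= q ^+ K.
    apply: le_trans (_ : (K%:R ^+ 3 * q ^+ K) ^+ 2 <= _).
      by rewrite mulnC exprM; apply: lerXn2r; rewrite ?nnegrE ?mulr_ge0 ?exprn_ge0.
    rewrite exprMn -exprM expr2 mulrA; apply: ler_piMl => //; exact: K6.
  by move: (lt_le_trans h1 h2); rewrite ltxx.
have sg1 : sg <= 1 by rewrite -(@expr_le1 _ 2) ?sg2 // ltW.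
have P0 i j : 0 <= pois i (n%:R * q ^+ j) by apply: pois_ge0; apply: mulr_ge0.
have hprod : 0 <= pois l (n%:R * q ^+ k) * pois m (n%:R * q ^+ l) * pois k (n%:R * q ^+ m).
  by apply: mulr_ge0 => //; apply: mulr_ge0.
apply: le_trans (term_le_pois s) _; rewrite -mulrA.
apply: ler_pM => //.
- exact: mulr_ge0 hprod (expR_ge0 _).
- by rewrite -natrX ler_nat (_ : (100 * K) ^ 3 = (100 * K) * (100 * K) * (100 * K))%N ?leq_mul //;
    move: hk lm mk; clear; lia.
rewrite mulrC; apply: ler_pM; rewrite ?expR_ge0 //.
- rewrite ler_expR.
  have a1 : q ^+ k <= q ^+ l by apply: ler_wiXn2l => //; apply: leq_trans mk.
  have a2 : q ^+ m <= q ^+ l by apply: ler_wiXn2l.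
  have a3 : (k + l + m)%:R <= (300 * K)%:R :> R.
    by rewrite ler_nat; move: hk lm mk; clear; lia.
  apply: le_trans (_ : (300 * K)%:R * (3 * (K%:R ^+ 3 * q ^+ K)) <= _).
    by apply: ler_pM => //; [rewrite !addr_ge0|move: a1 a2 qlK; lra].
  by apply: le_trans K4; rewrite natrM le_eqVlt; apply/orP; left; apply/eqP; ring.
- apply: le_trans (pois_prod_le l0 lm mk) _.
  by rewrite -sg2 -exprM; apply: ler_wiXn2l => //; exact: ltW.
Qed.

Definition typical_bound : R := (100 * K)%:R ^+ 3 * (expR 1 * sg ^+ K).
(** The division by n^3 allows for the sum over all (n + 1)^3 triples of sizes; [typical_bound] only
    has to survive (100 K)^3 of them. *)
Definition atypical_bound : R := (q ^+ (2 * K) + 2^-1 ^+ K) / n%:R ^+ 3.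

Lemma typical_bound_ge0 : 0 <= typical_bound.
Proof. by rewrite !mulr_ge0 ?exprn_ge0 ?expR_ge0 // ltW. Qed.

Lemma atypical_bound_ge0 : 0 <= atypical_bound.
Proof. by rewrite mulr_ge0 ?addr_ge0 ?invr_ge0 ?exprn_ge0. Qed.

Definition all_small k l m := [&& k < 100 * K, l < 100 * K & m < 100 * K]%N.

Lemma term_bound_sorted k l m : (0 < l)%N -> (l <= m)%N -> (m <= k)%N -> (k + l + m <= n)%N ->
  term k l m <= (all_small k l m)%:R * typical_bound + atypical_bound.
Proof.
move=> l0 lm mk s.
have n3 : 0 < n%:R ^+ 3 :> R by rewrite exprn_gt0 // ltr0n.
have m0 : (0 < m)%N by apply: leq_trans lm.
have T0 : 0 <= (all_small k l m)%:R * typical_bound by rewrite mulr_ge0 ?typical_bound_ge0.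
have suf : n%:R ^+ 3 * term k l m <= q ^+ (2 * K) + 2^-1 ^+ K ->
    term k l m <= (all_small k l m)%:R * typical_bound + atypical_bound.
  move=> h; apply: le_trans (_ : atypical_bound <= _); last by rewrite lerDr.
  by rewrite ler_pdivlMr // mulrC.
have h0 : 0 <= 2^-1 ^+ K :> R by rewrite exprn_ge0.
have [mK|mK] := leqP (20 * K) m.
  by apply: suf; apply: le_trans (term_two_large lm mk s mK) _; rewrite lerDl.
have [hl|hl] := lerP (K%:R ^+ 3) (n%:R * q ^+ l).
  by apply: suf; apply: le_trans (term_small_dominates m0 lm s mK hl) _; rewrite lerDr.
have [hk|hk] := leqP (100 * K) k.
  by apply: suf; apply: le_trans (term_large_third lm s mK (ltW hl) hk) _; rewrite lerDr.
apply: le_trans (term_typical l0 lm mk s (ltW hl) hk) _.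
have -> : all_small k l m.
  by rewrite /all_small hk; move: lm mk hk; clear; lia.
by rewrite mul1r lerDl atypical_bound_ge0.
Qed.

(** [union_term] and [all_small] are symmetric, so the sizes may be sorted. *)
Lemma term_bound k l m : (0 < k)%N -> (0 < l)%N -> (0 < m)%N -> (k + l + m <= n)%N ->
  term k l m <= (all_small k l m)%:R * typical_bound + atypical_bound.
Proof.
have CA a b c : all_small a b c = all_small b a c by rewrite /all_small andbCA.
have AC a b c : all_small a b c = all_small a c b by rewrite /all_small [X in _ && X]andbC.
have ordered a b c : (0 < a)%N -> (0 < b)%N -> (0 < c)%N -> (b <= c)%N -> (a + b + c <= n)%N ->
    term a b c <= (all_small a b c)%:R * typical_bound + atypical_bound.
  move=> a0 b0 c0 bc abc; have [ca|ac] := leqP c a; first exact: term_bound_sorted.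
  rewrite termAC termCA AC CA.
  have [ba|ab] := leqP b a.
    by rewrite termAC AC; apply: term_bound_sorted => //; [rewrite ltnW|move: abc; clear; lia].
  by apply: term_bound_sorted => //; [rewrite ltnW|move: abc; clear; lia].
move=> k0 l0 m0 s; have [lm|ml] := leqP l m; first exact: ordered.
by rewrite termAC AC; apply: ordered => //; [rewrite ltnW|move: s; clear; lia].
Qed.

End Sorted.
End TermBounds.

(** * Summation over all triples of sizes *)

Lemma card_ord_lt N a : (#|[pred j : 'I_N | (j < a)%N]| <= a)%N.
Proof.
case: a => [|a]; first by rewrite eq_card0.
rewrite -[leqRHS]card_ord; apply: (@leq_card_in _ _ (fun j : 'I_N => inord j : 'I_a.+1)).
move=> i j; rewrite !inE => ia ja /(congr1 val) /=; rewrite !inordK // => ij.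
exact: val_inj.
Qed.

Section Upper.
Variables (R : realType) (p e sg : R) (n K : nat).
Hypothesis p01 : 0 < p < 1.
Local Notation q := (1 - p).
Hypothesis e01 : 0 < e < 1.
Hypothesis q_window : q * (1 + e) <= 1 - e.
Hypothesis window : forall j, (0 < j)%N ->
  n%:R * q ^+ j <= (1 - e) * j%:R \/ (1 + e) * j%:R <= n%:R * q ^+ j.
Hypothesis K0 : (0 < K)%N.
Hypotheses (sg0 : 0 < sg) (sg2 : sg ^+ 2 = pois_rate e).
Hypothesis n_upper : n%:R * q ^+ (2 * K) <= 1.
Hypothesis n_lower : 1 <= n%:R * q ^+ K.
Hypothesis n80 : (80 * K <= n)%N.
Hypothesis K_exp : expR (- p / 2) ^+ K <= q ^+ 92 / 2.
Hypothesis K6 : K%:R ^+ 6 * q ^+ K <= 1.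
Hypothesis K600 : K%:R ^+ 600 * (q ^+ 8) ^+ K <= 2^-1.
Hypothesis K4 : 900 * (K%:R ^+ 4 * q ^+ K) <= 1.

Lemma gnp_good_upper : q ^+ 3 * gnp_good p n <=
  (100 * K)%:R ^+ 6 * (expR 1 * sg ^+ K) + 8 * (q ^+ (2 * K) + 2^-1 ^+ K).
Proof.
have q0 : 0 < q by rewrite subr_gt0; case/andP: p01.
have n0 : (0 < n)%N by apply: leq_trans n80; rewrite muln_gt0.
have nR : 0 < n%:R :> R by rewrite ltr0n.
apply: le_trans (first_moment n p01) _.
set i0 : 'I_3 := ord0; set i1 : 'I_3 := lift ord0 ord0.
set i2 : 'I_3 := lift ord0 (lift ord0 ord0).
pose T : R := typical_bound K sg; pose A : R := atypical_bound p n K.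
have T0 : 0 <= T by apply: typical_bound_ge0.
have A0 : 0 <= A by apply: atypical_bound_ge0.
apply: le_trans (_ : \sum_(ks : {ffun 'I_3 -> 'I_n.+1})
    ((all_small K (ks i0) (ks i1) (ks i2))%:R * T + A) <= _).
  rewrite big_mkcond; apply: ler_sum => ks _; case: ifP => [/andP[/forallP ks0 s]|_].
    exact: (term_bound p01 e01 q_window window K0 sg0 sg2).
  by rewrite addr_ge0 // mulr_ge0.
rewrite big_split /= -mulr_suml sumr_const card_ffun !card_ord -[_ *+ _]mulr_natl.
apply: lerD.
  have -> : (100 * K)%:R ^+ 6 * (expR 1 * sg ^+ K) = (100 * K)%:R ^+ 3 * T :> R.
    by rewrite /T /typical_bound (exprD _ 3 3) -mulrA.
  apply: ler_wpM2r => //; rewrite -natr_sum -natrX ler_nat.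
  rewrite (eq_bigr (fun ks : {ffun 'I_3 -> 'I_n.+1} =>
     if all_small K (ks i0) (ks i1) (ks i2) then 1%N else 0%N)); last first.
    by move=> ks _; case: ifP.
  rewrite -big_mkcond sum1_card.
  apply: (@leq_trans #|family (fun _ : 'I_3 => [pred j : 'I_n.+1 | (j < 100 * K)%N])|).
    apply/subset_leq_card/fintype.subsetP => ks; rewrite unfold_in => /and3P[s0 s1 s2].
    by apply/familyP => i; rewrite inE; case: (ord3P i) => ->.
  rewrite card_family foldrE big_image /= -[X in (_ <= _ ^ X)%N](card_ord 3) -prod_nat_const.
  by apply: leq_prod => i _; apply: card_ord_lt.
rewrite natrX /A /atypical_bound mulrCA mulrC; apply: ler_wpM2r.
  by rewrite addr_ge0 ?exprn_ge0 // ltW.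
(* The 8 bounds ((n + 1) / n)^3. *)
rewrite ler_pdivrMr ?exprn_gt0 // (_ : 8 = 2 ^+ 3) -?exprMn; last by ring.
apply: lerXn2r; rewrite ?nnegrE ?mulr_ge0 //.
by rewrite -natrM ler_nat; move: n0; clear; lia.
Qed.

End Upper.

(** * Conclusion *)

Section Asymptotics.
Local Open Scope classical_set_scope.
Local Open Scope ring_scope.
Variables (R : realType) (p : R).
Hypothesis p01 : 0 < p < 1.
Local Notation q := (1 - p).

Let p0 : 0 < p. Proof. by case/andP: p01. Qed.
Let q0 : 0 < q. Proof. by rewrite subr_gt0; case/andP: p01. Qed.
Let q1 : q < 1. Proof. by rewrite gtrBl. Qed.
Let q01 : 0 < q < 1. Proof. by rewrite q0. Qed.

Let s : R := Num.sqrt q.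
Let s0 : 0 < s. Proof. by rewrite sqrtr_gt0. Qed.
Let s2 : s ^+ 2 = q. Proof. by rewrite sqr_sqrtr // ltW. Qed.
Let s1 : s < 1. Proof. by rewrite -(@expr_lt1 _ 2) ?s2 // ltW. Qed.
Let s01 : 0 < s < 1. Proof. by rewrite s0. Qed.

Lemma near_ge (k1 : nat) : \forall k \near \oo, (k1 <= k)%N.
Proof. by exists k1. Qed.

(** For n the integer part of k / q^k, n q^k lies at most q^k below k, as [gnp_good_lower] requires.
    The bound on [k] makes these indices tend to infinity. *)
Lemma gnp_good_often : exists2 c : R, 0 < c &
  \forall k \near \oo, c <= gnp_good p (Num.truncn (k%:R / q ^+ k)) /\
    (k <= Num.truncn (k%:R / q ^+ k))%N.
Proof.
pose w : R := expR (ln q / 36).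
have w0 : 0 < w by exact: expR_gt0.
have w36 : w ^+ 36 = q.
  by rewrite /w -expRM_natl mulrC divfK // lnK.
have w1 : w < 1 by rewrite -(@expr_lt1 _ 36) ?w36 // ltW.
have w01 : 0 < w < 1 by rewrite w0.
pose C1 : R := 2 * expR 4 * q ^- 6.
pose c : R := p ^+ 6 * (expR (- 5) / 4) / (6 * q ^- 3 + 1 + (C1 + 1) * (expR (- 5) / 4)).
have C10 : 0 < C1 by rewrite !mulr_gt0 ?expR_gt0 // invr_gt0 exprn_gt0.
have c0 : 0 < c.
  rewrite divr_gt0 ?mulr_gt0 ?exprn_gt0 ?expR_gt0 ?invr_gt0 //.
  by rewrite !addr_gt0 ?mulr_gt0 ?addr_gt0 ?expR_gt0 ?invr_gt0 ?exprn_gt0.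
exists c => //.
near=> k.
have k0 : (0 < k)%N by near: k; exact: near_ge.
have kR : 1 <= k%:R :> R by rewrite ler1n.
have x0 : 0 < q ^+ k by rewrite exprn_gt0.
have y0 : 0 <= k%:R / q ^+ k by rewrite divr_ge0 // ltW.
set n := Num.truncn _.
have /andP[n_le n_gt] := truncn_itv y0.
rewrite -/n in n_le n_gt.
have nqk_le : n%:R * q ^+ k <= k%:R by rewrite -ler_pdivlMr.
have nqk_ge : k%:R - q ^+ k <= n%:R * q ^+ k.
  by move: n_gt; rewrite ltr_pdivrMr // -natr1 mulrDl mul1r => /ltW; rewrite lerBlDr.
split; last first.
  by rewrite truncn_ge_nat // ler_pdivlMr // ler_piMr // exprn_ile1 // ltW.
have kqk : 108 * (k%:R * q ^+ k) <= 1.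
  by near: k; apply: (poly_exp_smallC 108 1) => //; rewrite ltr01.
have kuk : 9 * (k%:R * s ^+ k) <= 1.
  by near: k; apply: (poly_exp_smallC 9 1).
have kw3 : k%:R ^+ 3 * w ^+ k <= 1.
  by near: k; apply: poly_exp_small.
have kw1 : 2 * expR 2 * (k%:R * w ^+ k) <= 1.
  by near: k; apply: (poly_exp_smallC _ 1).
have dl : (k.+1 ^ 9)%:R * (4 * expR 4 * expR 2 * q ^- 6 * (k%:R ^+ 6 * w ^+ k)) <= 1.
  (* The (k + 1)^9 <= (2 k)^9 overlap matrices raise the degree from 6 to 15. *)
  have dl' : 2 ^+ 9 * (4 * expR 4 * expR 2 * q ^- 6) * (k%:R ^+ 15 * w ^+ k) <= 1.
    by near: k; apply: poly_exp_smallC.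
  apply: le_trans dl'.
  have -> : 2 ^+ 9 * (4 * expR 4 * expR 2 * q ^- 6) * (k%:R ^+ 15 * w ^+ k) =
    (2 * k%:R) ^+ 9 * (4 * expR 4 * expR 2 * q ^- 6 * (k%:R ^+ 6 * w ^+ k)).
    rewrite (exprD _ 9 6) exprMn; ring.
  apply: ler_wpM2r.
    by rewrite !mulr_ge0 ?expR_ge0 ?invr_ge0 ?exprn_ge0 // ltW.
  by rewrite natrX -natrM; apply: lerXn2r; rewrite ?nnegrE // ler_nat; move: k0; clear; lia.
exact: (gnp_good_lower p01 k0 nqk_le nqk_ge kqk s0 s2 kuk w0 w36 kw3 kw1 dl).
Unshelve. all: by end_near. Qed.

(** The window width is 1 - s with s = sqrt q. For j <= K, n q^j is at least about K / s, which
    exceeds (2 - s) K by K (1 - s)^2 / s, and the rounding error q^K fits into this gap. For j > K,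
    n q^j <= n q^(K + 1) <= s K. *)
Lemma window_between K n : (0 < K)%N ->
  n%:R * (q ^+ K * s) <= K%:R -> K%:R <= n%:R * (q ^+ K * s) + q ^+ K * s ->
  q ^+ K <= (1 - s) ^+ 2 / s ->
  forall j, (0 < j)%N ->
  n%:R * q ^+ j <= (1 - (1 - s)) * j%:R \/ (1 + (1 - s)) * j%:R <= n%:R * q ^+ j.
Proof.
move=> K0 n_le n_ge qK j j0; have [jK|Kj] := leqP j K.
  right; apply: le_trans (_ : n%:R * q ^+ K <= _); last first.
    by apply: ler_wpM2l => //; apply: ler_wiXn2l => //; exact: ltW.
  apply: le_trans (_ : (1 + (1 - s)) * K%:R <= _).
    by rewrite ler_wpM2l ?ler_nat //; have := s1; lra.
  rewrite -(ler_pM2r s0).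
  move: qK; rewrite ler_pdivlMr // => qK.
  have K1 : (1 - s) ^+ 2 <= K%:R * (1 - s) ^+ 2 :> R.
    by apply: ler_peMl; rewrite ?ler1n // sqr_ge0.
  have E : K%:R * (1 - s) ^+ 2 = K%:R - (1 + (1 - s)) * K%:R * s by ring.
  by move: K1; rewrite E; lra.
left; rewrite subKr.
apply: le_trans (_ : n%:R * q ^+ K.+1 <= _).
  by apply: ler_wpM2l => //; apply: ler_wiXn2l => //; exact: ltW.
apply: le_trans (_ : s * K%:R <= _); last first.
  by apply: ler_wpM2l; [exact: ltW|rewrite ler_nat ltnW].
have -> : n%:R * q ^+ K.+1 = s * (n%:R * (q ^+ K * s)).
  by rewrite exprS -{1}s2; ring.
by apply: ler_wpM2l => //; exact: ltW.
Qed.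

(* Along this sequence n q^k is about k / sqrt q and n q^(k+1) about k sqrt q, so
   n q^j stays away from j for all j. *)
Lemma gnp_good_rare eps : 0 < eps ->
  \forall k \near \oo, gnp_good p (Num.truncn (k%:R / (q ^+ k * s))) <= eps /\
    (k <= Num.truncn (k%:R / (q ^+ k * s)))%N.
Proof.
move=> eps0.
have e01 : 0 < 1 - s < 1 by rewrite subr_gt0 s1 gtrBl.
have /andP[rho0 rho1] := pois_rate_lt1 e01.
pose sg := Num.sqrt (pois_rate (1 - s)).
have sg0 : 0 < sg by rewrite sqrtr_gt0.
have sg2 : sg ^+ 2 = pois_rate (1 - s) by rewrite sqr_sqrtr // ltW.
have sg01 : 0 < sg < 1 by rewrite sg0 -(@expr_lt1 _ 2) ?sg2 // ltW.
(* This is s (2 - s) <= 1 multiplied by s. *)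
have q_window : q * (1 + (1 - s)) <= 1 - (1 - s).
  rewrite subKr -s2 expr2 -mulrA; apply: ler_piMr; first exact: ltW.
  by have := sqr_ge0 (1 - s); rewrite expr2; lra.
have ex01 : 0 < expR (- p / 2) < 1 by rewrite expR_gt0 expR_lt1; have := p0; lra.
have q8 : 0 < q ^+ 8 < 1 by rewrite exprn_gt0 //= exprn_ilt1 // ltW.
have d0 : 0 < (1 - s) ^+ 2 / s by rewrite divr_gt0 ?exprn_gt0 // subr_gt0.
(* One third for each of the three terms of [gnp_good_upper], which bounds q^3 times the
   probability. *)
have e0 : 0 < eps * q ^+ 3 / 3 by rewrite divr_gt0 // mulr_gt0 // exprn_gt0.
have half01 : 0 < (2^-1 : R) < 1 by rewrite invr_gt0 ltr0n /= invf_lt1 ?ltr1n.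
near=> K.
have K0 : (0 < K)%N by near: K; exact: near_ge.
have KR : 1 <= K%:R :> R by rewrite ler1n.
have x0 : 0 < q ^+ K * s by rewrite mulr_gt0 // exprn_gt0.
have y0 : 0 <= K%:R / (q ^+ K * s) by rewrite divr_ge0 // ltW.
set n := Num.truncn _.
have /andP[n_le n_gt] := truncn_itv y0.
rewrite -/n in n_le n_gt.
have n_le' : n%:R * (q ^+ K * s) <= K%:R by rewrite -ler_pdivlMr.
have n_ge' : K%:R <= n%:R * (q ^+ K * s) + q ^+ K * s.
  by move: n_gt; rewrite ltr_pdivrMr // -natr1 mulrDl mul1r => /ltW.
(* The exponent 0 puts a pure exponential into the form of [poly_exp_smallC]. *)
have h80 : 80 * s * (K%:R ^+ 0 * q ^+ K) <= 1.
  by near: K; apply: poly_exp_smallC.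
have n80 : (80 * K <= n)%N.
  rewrite truncn_ge_nat // ler_pdivlMr // natrM.
  have : K%:R * (80 * s * (K%:R ^+ 0 * q ^+ K)) <= K%:R * 1 by apply: ler_wpM2l.
  by rewrite expr0; lra.
split; last by apply: leq_trans n80; move: K0; clear; lia.
have hw : q ^+ K <= (1 - s) ^+ 2 / s.
  have : K%:R ^+ 0 * q ^+ K <= (1 - s) ^+ 2 / s by near: K; apply: poly_exp_small.
  by rewrite expr0 mul1r.
have window := window_between K0 n_le' n_ge' hw.
have n_lower : 1 <= n%:R * q ^+ K.
  rewrite -(ler_pM2r s0) mul1r -mulrA.
  move: hw; rewrite ler_pdivlMr // => hw.
  have : 0 <= s * (1 - s) by rewrite mulr_ge0 // ?subr_ge0 ltW.
  by move: n_ge' hw KR; rewrite !expr2; lra.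
have n_upper : n%:R * q ^+ (2 * K) <= 1.
  have hK : s^-1 * (K%:R ^+ 1 * q ^+ K) <= 1 by near: K; apply: poly_exp_smallC.
  rewrite mul2n -addnn exprD mulrA; apply: le_trans hK; rewrite expr1 mulrA.
  apply: ler_wpM2r; first by rewrite exprn_ge0 // ltW.
  by rewrite [leRHS]mulrC ler_pdivlMr // -mulrA.
have K_exp : expR (- p / 2) ^+ K <= q ^+ 92 / 2.
  have : K%:R ^+ 0 * expR (- p / 2) ^+ K <= q ^+ 92 / 2.
    by near: K; apply: poly_exp_small => //; rewrite divr_gt0 // exprn_gt0.
  by rewrite expr0 mul1r.
have K6 : K%:R ^+ 6 * q ^+ K <= 1 by near: K; apply: poly_exp_small.
have K600 : K%:R ^+ 600 * (q ^+ 8) ^+ K <= 2^-1.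
  by near: K; apply: poly_exp_small => //; rewrite invr_gt0.
have K4 : 900 * (K%:R ^+ 4 * q ^+ K) <= 1 by near: K; apply: poly_exp_smallC.
have up := gnp_good_upper p01 e01 q_window window K0 sg0 sg2 n_upper n_lower n80 K_exp K6 K600 K4.
have f1 : (100 ^+ 6 * expR 1) * (K%:R ^+ 6 * sg ^+ K) <= eps * q ^+ 3 / 3.
  by near: K; apply: poly_exp_smallC.
have f2 : 8 * (K%:R ^+ 0 * q ^+ K) <= eps * q ^+ 3 / 3.
  by near: K; apply: poly_exp_smallC.
have f3 : 8 * (K%:R ^+ 0 * 2^-1 ^+ K) <= eps * q ^+ 3 / 3.
  by near: K; apply: poly_exp_smallC.
rewrite !expr0 !mul1r in f2 f3.
have q3 : 0 < q ^+ 3 by rewrite exprn_gt0.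
rewrite -(ler_pM2l q3); apply: le_trans up _.
have f2' : q ^+ (2 * K) <= q ^+ K by apply: ler_wiXn2l; rewrite ?(ltW q0) ?(ltW q1) // leq_pmull.
have -> : (100 * K)%:R ^+ 6 * (expR 1 * sg ^+ K) = 100 ^+ 6 * expR 1 * (K%:R ^+ 6 * sg ^+ K).
  by rewrite natrM exprMn mulrACA mulrA.
move: f1 f2 f3 f2'; lra.
Unshelve. all: by end_near. Qed.

End Asymptotics.

Local Open Scope classical_set_scope.
Local Open Scope ring_scope.

Theorem theorem1 (R : realType) (p : R) (hp : 0 < p < 1) :
  ~ cvgn (fun n : nat =>
      gnp_prob p [set G : sgraph n |
        exists k l m : nat,
          [/\ (0 < k)%N, (0 < l)%N, (0 < m)%N & (0 < X_count G k l m)%N]]).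
Proof.
move=> cv; pose P n := gnp_good p n.
have {}cv : cvgn P by exact: cv.
have [c c0 often] := gnp_good_often hp.
(* Within c / 4 of the limit, a value at least [c] puts the limit above 3 c / 4, and a value at most
   c / 4 puts it below c / 2. *)
have c4 : 0 < c / 4 by rewrite divr_gt0.
have rare := gnp_good_rare hp c4.
have /cvgrPdist_lt /(_ _ c4) [N _ HN] := cv.
near \oo => k.
have [ofk kn1] : c <= P (Num.truncn (k%:R / (1 - p) ^+ k)) /\
    (k <= Num.truncn (k%:R / (1 - p) ^+ k))%N by near: k; exact: often.
have [rak kn2] : P (Num.truncn (k%:R / ((1 - p) ^+ k * Num.sqrt (1 - p)))) <= c / 4 /\
    (k <= Num.truncn (k%:R / ((1 - p) ^+ k * Num.sqrt (1 - p))))%N by near: k; exact: rare.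
have Nk : (N <= k)%N by near: k; exact: near_ge.
have h1 := HN _ (leq_trans Nk kn1); have h2 := HN _ (leq_trans Nk kn2).
move: h1 h2; rewrite /= !ltr_norml => /andP[h1 _] /andP[_ h2].
move: ofk rak h1 h2; set l := limn P; lra.
Unshelve. all: by end_near. Qed.
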